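(* Let $r\ge 2$, let $\mathbb{F}_r$ be the free group on generators $g_1,\dots,g_r$, and for each $n\in\mathbb{N}$ let $\rho_n:\mathbb{F}_r\to B_n$ be the random homomorphism determined by $g_i\mapsto R_i^n$, where $R_1^n,\dots,R_r^n$ are independent uniformly random elements of $B_n$. Then for any $z\in\mathbb{C}[\mathbb{F}_r]$, \[ \|\rho_n(z)\|\to\|\lambda_{\mathbb{F}_r}(z)\| \] in probability as $n\to\infty$, where on both sides the norm is the operator norm.
   Context: $B_n$ is the finite group of signed $n\times n$ permutation matrices (matrices obtained from permutation matrices by replacing each entry $1$ by $+1$ or $-1$). Homomorphisms $\rho_n$ are extended linearly to $\mathbb{C}[\mathbb{F}_r]\to M_n(\mathbb{C})$. $\lambda_{\mathbb{F}_r}$ is the regular representation on $\ell^2(\mathbb{F}_r)$, $(\lambda_{\mathbb{F}_r}(g)f)(h)=f(g^{-1}h)$, extended linearly to $\mathbb{C}[\mathbb{F}_r]$. *)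

(* Defs.v *)
From HB Require Import structures.
From mathcomp Require Import all_boot all_order all_algebra all_fingroup.
From mathcomp Require Import finmap complex.
From mathcomp Require Import all_classical all_reals all_analysis.

Set Implicit Arguments.
Unset Strict Implicit.
Unset Printing Implicit Defensive.

Import Order.TTheory GRing.Theory Num.Theory.

Local Open Scope classical_set_scope.
Local Open Scope ring_scope.

(* The letter (i, false) stands for the generator g_i and (i, true) for its
   inverse. *)
Definition letter (r : nat) : Type := ('I_r * bool)%type.

Definition letter_inv r (l : letter r) : letter r := (l.1, ~~ l.2).

Definition reduced r (w : seq (letter r)) : bool :=
  sorted (fun a b : letter r => b != letter_inv a) w.

Record free_group (r : nat) : Type :=
  FreeGroup { word : seq (letter r); word_reduced : reduced word }.

HB.instance Definition _ r := [isSub for @word r].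
HB.instance Definition _ r := [Choice of free_group r by <:].

Definition letter_cons r (l : letter r) (w : seq (letter r)) : seq (letter r) :=
  if w is a :: w' then if a == letter_inv l then w' else l :: w else [:: l].

(* The reduced form of u ++ v, for v reduced. *)
Definition word_mul r (u v : seq (letter r)) : seq (letter r) :=
  foldr (@letter_cons r) v u.

Definition word_inv r (w : seq (letter r)) : seq (letter r) :=
  rev (map (@letter_inv r) w).

Section FreeGroup.
Variable r : nat.
Implicit Types (l : letter r) (u v w : seq (letter r)).

Lemma letter_invK : involutive (@letter_inv r).
Proof. by case=> i b; rewrite /letter_inv /= negbK. Qed.

Lemma reduced_behead l w : reduced (l :: w) -> reduced w.
Proof. exact: path_sorted. Qed.

Lemma letter_cons_reduced l w : reduced w -> reduced (letter_cons l w).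
Proof.
case: w => [|a w] //= aw; case: eqP => [_|/eqP ne]; first exact: path_sorted aw.
by rewrite /reduced /= ne.
Qed.

Lemma letter_consK l w : reduced w ->
  letter_cons l (letter_cons (letter_inv l) w) = w.
Proof.
case: w => [|a w] /=; first by rewrite eqxx.
rewrite letter_invK; case: eqP => [->|ne] aw; last by rewrite /= eqxx.
by case: w aw => [|b w] //= /andP[/negPf ->].
Qed.

Lemma letter_cons_path l w : reduced (l :: w) -> letter_cons l w = l :: w.
Proof. by case: w => [|a w] //= /andP[/negPf ->]. Qed.

Lemma word_mul_reduced u v : reduced v -> reduced (word_mul u v).
Proof. by move=> rv; elim: u => //= l u; apply: letter_cons_reduced. Qed.

Lemma word_mul_cons l u v : reduced v ->
  word_mul (letter_cons l u) v = letter_cons l (word_mul u v).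
Proof.
move=> rv; case: u => [|a u] //=; case: eqP => [->|//].
by rewrite letter_consK // word_mul_reduced.
Qed.

Lemma word_mulA u v w : reduced w ->
  word_mul u (word_mul v w) = word_mul (word_mul u v) w.
Proof. by move=> rw; elim: u => //= l u ->; rewrite word_mul_cons. Qed.

Lemma word_muls0 w : reduced w -> word_mul w [::] = w.
Proof.
elim: w => //= l w IH rlw.
by rewrite IH ?(reduced_behead rlw) // letter_cons_path.
Qed.

Lemma word_inv_reduced w : reduced w -> reduced (word_inv w).
Proof.
rewrite /reduced /word_inv rev_sorted sorted_map.
by apply: sub_sorted => a b /=; rewrite letter_invK eq_sym.
Qed.

Lemma word_invK : involutive (@word_inv r).
Proof.
by move=> w; rewrite /word_inv map_rev revK mapK //; apply: letter_invK.
Qed.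

Lemma word_mulVs w : word_mul (word_inv w) w = [::].
Proof.
elim: w => //= l w IH; rewrite /word_inv /= rev_cons /word_mul foldr_rcons /=.
by rewrite letter_invK eqxx.
Qed.

Lemma word_mulsV w : word_mul w (word_inv w) = [::].
Proof. by rewrite -{1}(word_invK w) word_mulVs. Qed.

Definition free_one : free_group r := @FreeGroup r [::] isT.
Definition free_mul (x y : free_group r) : free_group r :=
  FreeGroup (word_mul_reduced (word x) (word_reduced y)).
Definition free_inv (x : free_group r) : free_group r :=
  FreeGroup (word_inv_reduced (word_reduced x)).

Lemma free_mulA : associative free_mul.
Proof. by move=> x y z; apply/val_inj/word_mulA/word_reduced. Qed.
Lemma free_mul1g : left_id free_one free_mul.
Proof. by move=> x; apply/val_inj. Qed.
Lemma free_mulg1 : right_id free_one free_mul.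
Proof. by move=> x; apply/val_inj/word_muls0/word_reduced. Qed.
Lemma free_mulVg : left_inverse free_one free_inv free_mul.
Proof. by move=> x; apply/val_inj/word_mulVs. Qed.
Lemma free_mulgV : right_inverse free_one free_inv free_mul.
Proof. by move=> x; apply/val_inj/word_mulsV. Qed.

HB.instance Definition _ := isGroup.Build (free_group r)
  free_mulA free_mul1g free_mulg1 free_mulVg free_mulgV.

Definition free_gen (i : 'I_r) : free_group r := @FreeGroup r [:: (i, false)] isT.

End FreeGroup.

Section FreeGroupLift.
Variables (r : nat) (G : groupType) (x : 'I_r -> G).

Definition letter_val (l : letter r) : G := if l.2 then ((x l.1)^-1)%g else x l.1.

Definition free_lift (w : free_group r) : G :=
  (\prod_(l <- word w) letter_val l)%g.

Lemma letter_val_inv l : letter_val (letter_inv l) = ((letter_val l)^-1)%g.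
Proof. by case: l => i [] /=; rewrite /letter_val /= ?invgK. Qed.

Lemma prod_word_mul u v :
  (\prod_(l <- word_mul u v) letter_val l =
   (\prod_(l <- u) letter_val l) * \prod_(l <- v) letter_val l)%g.
Proof.
elim: u => [|l u IH]; first by rewrite big_nil mul1g.
rewrite big_cons -mulgA -{}IH /=; case: (word_mul u v) => [|a w] /=.
  by rewrite big_cons.
case: eqP => [->|_]; last by rewrite big_cons.
by rewrite big_cons letter_val_inv mulKVg.
Qed.

Lemma free_lift_gen i : free_lift (free_gen i) = x i.
Proof. by rewrite /free_lift /= big_seq1. Qed.

Lemma free_lift1 : free_lift 1%g = 1%g.
Proof. exact: big_nil. Qed.

Lemma free_liftM : {morph free_lift : u v / (u * v)%g}.
Proof. by move=> u v; apply: prod_word_mul. Qed.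

HB.instance Definition _ :=
  isMultiplicative.Build (free_group r) G free_lift free_liftM.
HB.instance Definition _ :=
  Multiplicative_isUMagmaMorphism.Build (free_group r) G free_lift free_lift1.

End FreeGroupLift.

Section SignedPerm.
Variables (R : realType) (n : nat).

Definition signed_perm_mx (s : 'S_n) (e : {ffun 'I_n -> bool}) : 'M[R[i]]_n :=
  \matrix_(i, j) ((-1) ^+ e i * perm_mx s i j).

Definition is_signed_perm_mx (A : 'M[R[i]]_n) : bool :=
  [exists s : 'S_n, exists e : {ffun 'I_n -> bool}, A == signed_perm_mx s e].

Record signed_perm : Type :=
  SignedPerm { signed_perm_val :> 'M[R[i]]_n;
               signed_perm_valP : is_signed_perm_mx signed_perm_val }.

HB.instance Definition _ := [isSub for signed_perm_val].
HB.instance Definition _ := [Choice of signed_perm by <:].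

Lemma is_signed_perm_mxP A :
  reflect (exists s e, A = signed_perm_mx s e) (is_signed_perm_mx A).
Proof.
apply: (iffP existsP) => [[s /existsP[e /eqP ->]]|[s [e ->]]].
  by exists s, e.
by exists s; apply/existsP; exists e.
Qed.

Let code (A : signed_perm) : option ('S_n * {ffun 'I_n -> bool}) :=
  [pick p | val A == signed_perm_mx p.1 p.2].
Let decode (p : option ('S_n * {ffun 'I_n -> bool})) : option signed_perm :=
  obind (fun p => insub (signed_perm_mx p.1 p.2)) p.

Let codeK : pcancel code decode.
Proof.
move=> A; rewrite /code; case: pickP => [p /eqP eA|none] /=.
  by rewrite -eA valK.
by have /is_signed_perm_mxP[s [e eA]] := valP A; have := none (s, e);
  rewrite /= eA eqxx.
Qed.

HB.instance Definition _ : isCountable signed_perm := PCanIsCountable codeK.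
HB.instance Definition _ :=
  fintype.isFinite.Build signed_perm (pcan_enumP codeK).

Lemma signed_perm_mx1 : signed_perm_mx 1%g [ffun=> false] = 1%:M.
Proof. by apply/matrixP => i j; rewrite !mxE ffunE mul1r perm1. Qed.

Lemma signed_perm_mxM s e t f :
  signed_perm_mx s e *m signed_perm_mx t f =
  signed_perm_mx (s * t)%g [ffun i => e i (+) f (s i)].
Proof.
apply/matrixP => i j; rewrite !mxE (bigD1 (s i)) //= big1 => [|k ne].
  by rewrite !mxE ffunE permM eqxx mulr1 addr0 signr_addb mulrA.
by rewrite !mxE eq_sym (negPf ne) mulr0 mul0r.
Qed.

Lemma signed_perm_mulP (A B : signed_perm) : is_signed_perm_mx (val A *m val B).
Proof.
have /is_signed_perm_mxP[s [e ->]] := valP A.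
have /is_signed_perm_mxP[t [f ->]] := valP B.
by rewrite signed_perm_mxM; apply/is_signed_perm_mxP; do 2!eexists.
Qed.

Lemma signed_perm_oneP : is_signed_perm_mx 1%:M.
Proof.
by rewrite -signed_perm_mx1; apply/is_signed_perm_mxP; do 2!eexists.
Qed.

Lemma signed_perm_mulV (s : 'S_n) (e : {ffun 'I_n -> bool}) :
  signed_perm_mx s^-1%g [ffun i => e ((s^-1)%g i)] *m signed_perm_mx s e = 1%:M.
Proof.
rewrite signed_perm_mxM mulVg -signed_perm_mx1; congr signed_perm_mx.
by apply/ffunP => i; rewrite !ffunE addbb.
Qed.

Lemma signed_perm_mul_invmx (A : signed_perm) :
  is_signed_perm_mx (invmx (val A)) /\ invmx (val A) *m val A = 1%:M.
Proof.
have /is_signed_perm_mxP[s [e ->]] := valP A.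
have VA := signed_perm_mulV s e; have [_ uA] := mulmx1_unit VA.
rewrite mulVmx //; split=> //; rewrite -[invmx _]mul1mx -VA mulmxK //.
by apply/is_signed_perm_mxP; do 2!eexists.
Qed.

Definition signed_perm_mul (A B : signed_perm) := SignedPerm (signed_perm_mulP A B).
Definition signed_perm_one := SignedPerm signed_perm_oneP.
Definition signed_perm_inv (A : signed_perm) :=
  SignedPerm (signed_perm_mul_invmx A).1.

Lemma signed_perm_mulA : associative signed_perm_mul.
Proof. by move=> A B C; apply/val_inj/mulmxA. Qed.
Lemma signed_perm_mul1 : left_id signed_perm_one signed_perm_mul.
Proof. by move=> A; apply/val_inj/mul1mx. Qed.
Lemma signed_perm_mulVg :
  left_inverse signed_perm_one signed_perm_inv signed_perm_mul.
Proof. by move=> A; apply/val_inj; exact: (signed_perm_mul_invmx A).2. Qed.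

HB.instance Definition _ := Finite_isGroup.Build signed_perm
  signed_perm_mulA signed_perm_mul1 signed_perm_mulVg.

HB.instance Definition _ := isPointed.Build signed_perm 1%g.
HB.instance Definition _ := @isMeasurable.Build default_measure_display
  signed_perm discrete_measurable discrete_measurable0
  discrete_measurableC discrete_measurableU.

End SignedPerm.

Section Probability.
Variable R : realType.

Definition uniform_signed_perm d (T : measurableType d) (P : probability T R)
    n (X : {RV P >-> signed_perm R n}) : Prop :=
  forall A : signed_perm R n,
    P (X @^-1` [set A]) = (#|{: signed_perm R n}|%:R^-1)%:E.

Definition mutually_independent d (T : measurableType d) (P : probability T R)
    d' (S : measurableType d') (I : finType) (X : I -> {RV P >-> S}) : Prop :=
  forall (J : {set I}) (A : I -> set S), (forall i, measurable (A i)) ->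
    P (\bigcap_(i in [set` J]) (X i @^-1` A i)) =
    (\prod_(i in J) P (X i @^-1` A i))%E.

(* Convergence in probability to c; for infinite c the condition fails, since
   `|x - c| is then +oo for every x. *)
Definition cvg_in_probability (d : nat -> measure_display)
    (T : forall n, measurableType (d n)) (P : forall n, probability (T n) R)
    (X : forall n, T n -> \bar R) (c : \bar R) : Prop :=
  forall eps : R, 0 < eps ->
    (fun n => P n [set w | (eps%:E <= `|X n w - c|)%E]) @ \oo --> 0%E.

End Probability.

Section Operators.
Variable R : realType.
(* R[i]^o is R[i] as a module over itself; it makes C-valued functions, and
   operators on them, modules over R[i] pointwise. *)
Local Notation C := (R[i]^o).

Definition l2norm (I : choiceType) (f : I -> C) : \bar R :=
  sqrte (\esum_(i in [set: I]) (Normc.normc (f i) ^+ 2)%:E).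

(* The supremum is taken over the unit ball of l^2(I), since f has l2norm +oo when
   it is not square-summable; in particular opnorm is +oo on unbounded operators.
   The space C^n with its Euclidean norm is l^2('I_n). *)
Definition opnorm (I J : choiceType) (T : (I -> C) -> (J -> C)) : \bar R :=
  ereal_sup [set l2norm (T f) | f in [set f : I -> C | (l2norm f <= 1)%E]].

Definition mx_op m n (A : 'M[R[i]]_(m, n)) (v : 'I_n -> C) : 'I_m -> C :=
  fun i => \sum_j A i j * v j.

Definition regular_rep (G : groupType) (g : G) (f : G -> C) : G -> C :=
  fun h => f (g^-1 * h)%g.

(* The group algebra C[G] is represented by its underlying vector space of
   finitely supported functions. *)
Definition linear_extension (G : groupType) (V : lmodType R[i]) (rho : G -> V)
    (z : {fsfun G -> R[i] with 0}) : V :=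
  \sum_(g <- finsupp z) z g *: rho g.

Lemma linear_extension_regularE (G : groupType) (z : {fsfun G -> R[i] with 0})
    (f : G -> C) (h : G) :
  linear_extension (@regular_rep G) z f h =
  \sum_(g <- finsupp z) z g * f (g^-1 * h)%g.
Proof. by rewrite /linear_extension !fct_sumE. Qed.

Lemma mx_opE m n (A : 'M[R[i]]_(m, n)) (v : 'cV[R[i]]_n) i :
  mx_op A (fun j => v j ord0) i = (A *m v) i ord0.
Proof. by rewrite mxE. Qed.

End Operators.

(* Main.v *)
(* Let A = rho_n(z) and let h be a polynomial with 0 <= h <= 1 on the possible
   spectrum of A^* A. The average of tr h(A^* A) / n over the choices of the
   generators lies in [0,1] for all n, and up to an explicit factor it is a
   polynomial in 1/n of degree linear in deg h. A Markov-type inequality on the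
   points 1/n then bounds its distance to its first order Taylor expansion at 0
   by a power of deg h over n^2. The constant term is the trace of
   h(lambda(z)^* lambda(z)). When traces are expanded into closed walks, the
   random signs cancel the walks using some edge an odd number of times; hence
   the coefficient of 1/n only involves words u c^D u^-1 with D even, whose total
   weight is controlled by powers of |lambda(z)| through first-entrance
   decompositions and the Cauchy-Schwarz inequality. With h the k-th power of a
   fixed cutoff and k of order log n, this gives the upper bound.
   For the lower bound, a nearly maximizing finitely supported function on F_r
   is transplanted to the orbit of a point fixed by no word of a given finite
   set; such a point exists with high probability, since a nontrivial word has a
   bounded mean number of fixed points. *)

Require Import Defs.
From HB Require Import structures.
From mathcomp Require Import all_boot all_order all_algebra all_fingroup.
From mathcomp Require Import finmap complex.
From mathcomp Require Import all_classical all_reals all_analysis.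
From mathcomp Require Import ring lra zify.

Set Implicit Arguments.
Unset Strict Implicit.
Unset Printing Implicit Defensive.

Import Order.TTheory GRing.Theory Num.Theory.

(** The signs make the $1/n$ term small. In $u c^D u^{-1}$ with $D \ge 2$ the root $c$ occurs at
    least twice, so the sum over $c$ is an inner product of two square-summable functions. For $D =
    1$ the sum would be of $\ell^1$ type; it would have to reflect the invariant vector of the
    permutation representation, whose eigenvalue $\sum_g z(g)$ can exceed $\|\lambda(z)\|$ in
    modulus. The constant term and the $1/n$ coefficient are bounded monomial by monomial. Smallness
    of $h$ on the spectrum of $\lambda(z)^* \lambda(z)$ is therefore too weak: the polynomial with
    the absolute values of the coefficients must be small at $\|\lambda(z)\|^2$. This dictates the
    cutoff $1 - (1 - (s/K)^m)^N$. The final balance: a norm above the threshold forces a trace of at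
    least $2^{-k}$, while the mean trace is at most $n 64^{-k}$ plus polynomials in $k$ times
    $64^{-k}$ and $1/n$. With $4^k \le n < 4^{k+1}$, all terms multiplied by $2^k$ are polynomial in
    $k$ times $2^{-k}$. *)

Local Notation SP n := ('S_n * {ffun 'I_n -> bool})%type.
Local Notation Omega r n := {ffun 'I_r -> SP n}.

Local Open Scope ring_scope.

(** * A Markov inequality on the points 1/n *)

Section Markov.
Variable R : realType.
Implicit Types (p : {poly R}) (x y s S M : R).

Lemma cosM_cos x y : cos x * cos y = (cos (x + y) + cos (x - y)) / 2.
Proof. rewrite cosD cosB; lra. Qed.

(** Induction on the degree: for $p = qX + c$ the product formula replaces $\cos(jt)\cos t$ by the
    mean of $\cos((j+1)t)$ and $\cos((j-1)t)$. *)
Lemma horner_cosE D p : (size p <= D.+1)%N ->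
  exists a : nat -> R, forall t, p.[cos t] = \sum_(j < D.+1) a j * cos (j%:R * t).
Proof.
elim: D p => [|D IH] p sp.
  exists (fun _ => p`_0) => t.
  by rewrite big_ord1 mul0r cos0 mulr1 {1}(size1_polyC sp) hornerC.
have [q [c [pE sq]]] : exists q c, p = q * 'X + c%:P /\ (size q <= D.+1)%N.
  exists (\poly_(i < D.+1) p`_i.+1), p`_0; split; last exact: size_poly.
  apply/polyP => i; rewrite coefD coefMX coefC coef_poly.
  case: i => [|i] /=; first by rewrite add0r.
  by rewrite addr0; case: ltnP => // h; rewrite nth_default // (leq_trans sp).
have [a ha] := IH _ sq.
(* Coefficients of frequency $j$: raised from $j-1$ ([b1]), lowered from $j+1$ ([b2]), the frequency
   $-1$ produced by $a_0$ and reflected to $1$ ([b3]), the constant ([b4]). *)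
pose b1 j := if j is j'.+1 then if (j' <= D)%N then a j' / 2 else 0 else 0.
pose b2 j := if (j.+1 <= D)%N then a j.+1 / 2 else 0.
pose b3 j := if j == 1%N then a 0%N / 2 else 0.
pose b4 j := if j == 0%N then c else 0.
exists (fun j => b1 j + b2 j + b3 j + b4 j) => t.
have -> : p.[cos t] = (\sum_(j < D.+1) a j * cos (j%:R * t)) * cos t + c.
  by rewrite pE hornerD hornerMX hornerC ha.
have e1 : (\sum_(j < D.+1) a j * cos (j%:R * t)) * cos t =
   \sum_(j < D.+1) (a j / 2) * cos (j.+1%:R * t)
   + (a 0%N / 2) * cos t + \sum_(j < D) (a j.+1 / 2) * cos (j%:R * t).
  rewrite big_distrl /= -addrA.
  have -> : (a 0%N / 2) * cos t + \sum_(j < D) (a j.+1 / 2) * cos (j%:R * t) =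
     \sum_(j < D.+1) (a j / 2) * cos (j%:R * t - t).
    rewrite big_ord_recl /= mul0r sub0r cosN; congr (_ + _).
    apply: eq_bigr => j _; congr (_ * cos _); rewrite /bump /= add1n -addn1 natrD; ring.
  rewrite -big_split /=; apply: eq_bigr => j _.
  have -> : j.+1%:R * t = j%:R * t + t by rewrite -natr1 mulrDl mul1r.
  rewrite -mulrA cosM_cos; lra.
have s1 : \sum_(j < D.+2) b1 j * cos (j%:R * t) = \sum_(j < D.+1) (a j / 2) * cos (j.+1%:R * t).
  rewrite big_ord_recl /= mul0r add0r; apply: eq_bigr => j _.
  by rewrite /bump /= add1n -ltnS ltn_ord.
have s2 : \sum_(j < D.+2) b2 j * cos (j%:R * t) = \sum_(j < D) (a j.+1 / 2) * cos (j%:R * t).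
  rewrite !big_ord_recr /= /b2 ltnn ltnNge leqnSn /= !mul0r !addr0.
  by apply: eq_bigr => j _; rewrite ltn_ord.
have s3 : \sum_(j < D.+2) b3 j * cos (j%:R * t) = a 0%N / 2 * cos t.
  rewrite 2!big_ord_recl big1 /= ?mul0r ?mul1r ?addr0 ?add0r //.
  by move=> i _; rewrite mul0r.
have s4 : \sum_(j < D.+2) b4 j * cos (j%:R * t) = c.
  rewrite big_ord_recl big1 /= ?mul0r ?addr0 ?cos0 ?mulr1 //.
  by move=> i _; rewrite mul0r.
under [RHS]eq_bigr do rewrite !mulrDl.
by rewrite !big_split /= s1 s2 s3 s4 e1; ring.
Qed.

(** Multiplying by $\sin f$, where $f = m\pi/N$ is half the angular step, makes the sum telescope
    over whole periods; $0 < m < N$ gives $\sin f \ne 0$. *)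
Lemma sum_cos_arith m N : (0 < m < N)%N ->
  \sum_(k < N) cos (m%:R * (k%:R * (pi *+ 2 / N%:R))) = 0 :> R.
Proof.
move=> /andP[m0 mN]; have N0 : (0 < N)%N by apply: leq_ltn_trans mN.
have NR : N%:R != 0 :> R by rewrite pnatr_eq0 -lt0n.
pose f : R := m%:R * (pi / N%:R).
have sf : sin f != 0.
  rewrite gt_eqF // sin_gt0_pi // /f; apply/andP; split.
    by rewrite !mulr_gt0 ?pi_gt0 ?invr_gt0 ?ltr0n.
  by rewrite mulrCA gtr_pMr ?pi_gt0 // ltr_pdivrMr ?ltr0n // mul1r ltr_nat.
apply: (mulfI sf); rewrite mulr0 mulr_sumr.
rewrite (eq_bigr (fun k : 'I_N => (sin (k.+1%:R * (f *+ 2) - f) - sin (k%:R * (f *+ 2) - f)) / 2)).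
  rewrite -mulr_suml -(big_mkord xpredT (fun k => sin (k.+1%:R * (f *+ 2) - f) - sin (k%:R * (f *+ 2) - f))).
  rewrite (telescope_sumr (fun k => sin (k%:R * (f *+ 2) - f))) // mul0r add0r.
  have -> : N%:R * (f *+ 2) - f = - f + (pi *+ 2) *+ m.
    by rewrite -(mulr_natl _ m) /f !mulr2n; field; exact: NR.
  by rewrite (periodicn (@sinD2pi R)) subrr mul0r.
move=> k _; have -> : m%:R * (k%:R * (pi *+ 2 / N%:R)) = k%:R * (f *+ 2).
  by rewrite /f !mulr2n; ring.
have -> : k.+1%:R * (f *+ 2) = k%:R * (f *+ 2) + f *+ 2 by rewrite -natr1 mulrDl mul1r.
have -> : k%:R * (f *+ 2) + f *+ 2 - f = k%:R * (f *+ 2) + f by ring.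
rewrite sinD sinB; lra.
Qed.

(** Discrete orthogonality at $2D+1$ equally spaced angles: the frequencies $j+l$ and $|j-l|$ that
    occur are below the number of nodes, so only the zero frequency survives summation. The factor 2
    is the inverse of the mean of $\cos^2$. *)
Lemma cos_coef_le D (a : nat -> R) (S : R) :
  let g t := \sum_(j < D.+1) a j * cos (j%:R * t) in
  (forall k, (k < D.*2.+1)%N -> `|g (k%:R * (pi *+ 2 / D.*2.+1%:R))| <= S) ->
  forall l, (l <= D)%N -> `|a l| <= 2 * S.
Proof.
move=> g gS l lD; set N := D.*2.+1 in gS *.
pose th (k : nat) : R := k%:R * (pi *+ 2 / N%:R).
have NR : 0 < N%:R :> R by rewrite ltr0n.
have S0 : 0 <= S by apply: le_trans (gS 0%N _).
have orth j : (j <= D)%N -> \sum_(k < N) cos (j%:R * th k) * cos (l%:R * th k) =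
   if j == l then (if l == 0%N then N%:R else N%:R / 2) else 0 :> R.
  move=> jD.
  have sumc m : (m < N)%N -> \sum_(k < N) cos (m%:R * th k) = if m == 0%N then N%:R else 0.
    case: m => [|m] mN; last by rewrite sum_cos_arith.
    rewrite (eq_bigr (fun _ => 1)); first by rewrite sumr_const card_ord.
    by move=> k _; rewrite mul0r cos0.
  rewrite (eq_bigr (fun k : 'I_N => (cos ((j + l)%:R * th k) + cos ((maxn j l - minn j l)%:R * th k)) / 2)).
    rewrite -mulr_suml big_split /= !sumc; [|rewrite /N; lia..].
    case: (j =P l) => [->|jl].
      rewrite maxnn minnn subnn eqxx addnn double_eq0.
      by case: eqP => _; [lra | rewrite add0r].
    have -> : ((j + l)%N == 0%N) = false by apply/eqP; lia.
    have -> : ((maxn j l - minn j l)%N == 0%N) = false by apply/eqP; lia.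
    by rewrite addr0 mul0r.
  move=> k _; have -> : (j + l)%:R * th k = j%:R * th k + l%:R * th k by rewrite natrD mulrDl.
  rewrite cosM_cos; congr ((_ + _) / 2); rewrite -mulrBl.
  case: (leqP j l) => jl.
    by rewrite natrB // -cosN -mulNr opprB.
  by rewrite natrB // ltnW.
have e : \sum_(k < N) g (th k) * cos (l%:R * th k) = a l * (if l == 0%N then N%:R else N%:R / 2).
  rewrite /g (eq_bigr (fun k : 'I_N => \sum_(j < D.+1) a j * (cos (j%:R * th k) * cos (l%:R * th k)))).
    rewrite exchange_big /= (eq_bigr (fun j : 'I_D.+1 => a j * \sum_(k < N) (cos (j%:R * th k) * cos (l%:R * th k)))); last by move=> j _; rewrite mulr_sumr.
    rewrite (bigD1 (Ordinal (lD : l < D.+1)%N)) //= orth // eqxx big1 ?addr0 // => j /eqP jl.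
    rewrite orth; last by rewrite -ltnS ltn_ord.
    by case: eqP => [e|]; [case: jl; apply/val_inj | rewrite mulr0].
  by move=> k _; rewrite mulr_suml; apply: eq_bigr => j _; rewrite mulrA.
have le1 : `|a l * (if l == 0%N then N%:R else N%:R / 2)| <= S * N%:R.
  rewrite -e (le_trans (ler_norm_sum _ _ _)) //.
  rewrite -[X in _ <= S * X%:R](card_ord N) mulr_natr -sumr_const ler_sum // => k _.
  by rewrite normrM -[S]mulr1 ler_pM // ?gS // cos_max.
have le2 : `|a l| * (N%:R / 2) <= S * N%:R.
  apply: le_trans le1; rewrite normrM ler_wpM2l //.
  by case: ifP => _; rewrite gtr0_norm ?divr_gt0 //; lra.
rewrite -(@ler_pM2r _ (N%:R / 2)) ?divr_gt0 //; lra.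
Qed.

Lemma norm_sin_natM n x : `|sin (n%:R * x)| <= n%:R * `|sin x|.
Proof.
elim: n => [|n IH]; first by rewrite !mul0r sin0 normr0.
rewrite -natr1 !mulrDl !mul1r sinD (le_trans (ler_normD _ _)) // lerD // normrM.
  by rewrite -[leRHS]mulr1 ler_pM // cos_max.
by rewrite -[leRHS]mul1r ler_pM // cos_max.
Qed.

Lemma cos_subE x y : cos x - cos y = - 2 * (sin ((x + y) / 2) * sin ((x - y) / 2)).
Proof.
have ex : x = (x + y) / 2 + (x - y) / 2 by lra.
have ey : y = (x + y) / 2 - (x - y) / 2 by lra.
by rewrite [in X in X - _]ex [in X in _ - X]ey cosD cosB; lra.
Qed.

(** A difference of cosines is a product of two sines, and each sine contributes a factor $n$. *)
Lemma cos_natM_lip n x y :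
  `|cos (n%:R * x) - cos (n%:R * y)| <= n%:R ^+ 2 * `|cos x - cos y|.
Proof.
rewrite !cos_subE !normrM [leRHS]mulrCA ler_wpM2l // expr2 mulrACA.
by rewrite ler_pM // -?mulrDr -?mulrBr -?mulrA norm_sin_natM.
Qed.

(** Real parts of the roots of unity of order $2D+1$. *)
Definition cheb_node D k : R := cos (k%:R * (pi *+ 2 / D.*2.+1%:R)).

(* p(cos t) = sum_j a_j cos(jt) with |a_j| <= 2S by
   discrete orthogonality, and cos(jt) is j^2-Lipschitz in cos t. *)
Lemma poly_lip D p S : (size p <= D.+1)%N ->
  (forall k, (k < D.*2.+1)%N -> `|p.[cheb_node D k]| <= S) ->
  forall x y, -1 <= x <= 1 -> -1 <= y <= 1 ->
  `|p.[x] - p.[y]| <= 2 * D.+1%:R ^+ 3 * S * `|x - y|.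
Proof.
move=> sp pS x y hx hy; have [a ha] := horner_cosE sp.
have S0 : 0 <= S by apply: le_trans (pS 0%N _).
have aS : forall l, (l <= D)%N -> `|a l| <= 2 * S.
  by apply: cos_coef_le => k kD; rewrite -ha; exact: pS.
have ex (u : R) : -1 <= u <= 1 -> u = cos (acos u) by move=> hu; rewrite acosK.
rewrite {1}(ex x) // {1}(ex y) // !ha -sumrB.
rewrite (le_trans (ler_norm_sum _ _ _)) //.
have -> : 2 * D.+1%:R ^+ 3 * S * `|x - y| = \sum_(j < D.+1) 2 * D.+1%:R ^+ 2 * S * `|x - y|.
  by rewrite sumr_const card_ord -mulr_natr; ring.
apply: ler_sum => j _; rewrite -mulrBr normrM -mulrA.
have -> : 2 * D.+1%:R ^+ 2 * (S * `|x - y|) = (2 * S) * (D.+1%:R ^+ 2 * `|x - y|) by ring.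
apply: ler_pM => //; first by apply: aS; rewrite -ltnS.
apply: le_trans (cos_natM_lip _ _ _) _; rewrite -!ex // ler_wpM2r //.
by rewrite lerXn2r ?nnegrE ?ler0n // ler_nat ltnW.
Qed.

Lemma cheb_node_itv D k : -1 <= cheb_node D k <= 1.
Proof. by rewrite cos_geN1 cos_le1. Qed.

Lemma invn_itv (N m : nat) : (0 < N)%N -> (N <= m)%N ->
  ((0 : R) <= (m%:R^-1 : R)) && ((m%:R^-1 : R) <= N%:R^-1).
Proof.
move=> N0 Nm; rewrite invr_ge0 ler0n lef_pV2 ?posrE ?ltr0n ?(leq_trans N0) //.
by rewrite ler_nat.
Qed.

(** With $n$ the integer part of $1/x$, the point $x$ lies in a gap of length $1/(n(n+1))$ between
    reciprocals. *)
Lemma near_invn (N : nat) x : (0 < N)%N -> 0 <= x <= N%:R^-1 ->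
  exists2 n, (N <= n)%N & `|x - n%:R^-1| <= N%:R^-1 ^+ 2.
Proof.
move=> N0 /andP[x0 xN]; have NR : 0 < N%:R :> R by rewrite ltr0n.
move: x0; rewrite le_eqVlt => /predU1P[<-|x0].
  (* At $x = 0$ there is no integer part of $1/x$ to take; $n = N^2$ is close enough. *)
  exists (N * N)%N; first by rewrite leq_pmulr.
  by rewrite sub0r normrN natrM invfM -expr2 ger0_norm // sqr_ge0.
pose n := Num.truncn x^-1.
have xi : 0 <= x^-1 by rewrite invr_ge0 ltW.
have /andP[n1 n2] := truncn_itv xi; rewrite -/n in n1 n2.
have Nn : (N <= n)%N.
  rewrite /n.
  by rewrite truncn_ge_nat // -(invrK N%:R) lef_pV2 // posrE invr_gt0.
have nR : 0 < n%:R :> R by rewrite ltr0n (leq_trans N0).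
exists n => //.
have h1 : x <= n%:R^-1 by rewrite -[x]invrK lef_pV2 // posrE invr_gt0.
have h2 : n.+1%:R^-1 <= x by rewrite -[x]invrK lef_pV2 ?posrE ?invr_gt0 ?ltr0n // ltW.
rewrite distrC ger0_norm ?subr_ge0 //.
apply: (@le_trans _ _ (n%:R^-1 - n.+1%:R^-1)); first by rewrite lerD2l lerN2.
have -> : n%:R^-1 - n.+1%:R^-1 = n%:R^-1 * n.+1%:R^-1 :> R.
  have h0 : n%:R != 0 :> R by rewrite gt_eqF.
  have hS : n.+1%:R != 0 :> R by rewrite pnatr_eq0.
  by move: hS; rewrite -natr1 => hS; field; rewrite ?h0 ?hS.
by rewrite expr2 ler_pM // ?invr_ge0 ?ler0n // lef_pV2 ?posrE ?ltr0Sn // ler_nat // leqW.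
Qed.

(** The Lipschitz estimate asks for a bound at the nodes, while only the points $1/n$ are
    controlled. The estimate itself closes this gap when the degree is small against $N$, whence
    $8(D+1)^3 \le N$. *)
Lemma poly_lip0_invn D p (N : nat) M : (size p <= D.+1)%N ->
  (8 * D.+1 ^ 3 <= N)%N -> (forall n, (N <= n)%N -> `|p.[n%:R^-1]| <= M) ->
  forall s, 0 <= s <= N%:R^-1 ->
  `|p.[s] - p.[0]| <= 8 * D.+1%:R ^+ 3 * N%:R * M * s.
Proof.
move=> sp DN pM; have N0 : (0 < N)%N by apply: leq_trans DN; rewrite muln_gt0 expn_gt0.
have NR : 0 < N%:R :> R by rewrite ltr0n.
(* The affine map from $[-1,1]$ onto $[0,1/N]$. *)
pose l : {poly R} := (2 * N%:R)^-1 *: 'X + (2 * N%:R)^-1%:P.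
pose q : {poly R} := p \Po l.
have qE x : q.[x] = p.[(x + 1) / (2 * N%:R)].
  by rewrite horner_comp; congr p.[_]; rewrite !hornerE; field; rewrite gt_eqF.
have sq : (size q <= D.+1)%N.
  apply: leq_trans (size_comp_poly_leq _ _) _.
  have s2 : ((size l).-1 <= 1)%N.
    have sl : (size l <= 2)%N.
      rewrite (leq_trans (size_polyD _ _)) // geq_max (leq_trans (size_polyC_leq1 _)) // andbT.
      by rewrite (leq_trans (size_scale_leq _ _)) ?size_polyX.
    by case: (size l) sl => // -[|[|]].
  by rewrite ltnS (leq_trans (leq_mul (leqnn _) s2)) // muln1; case: (size p) sp.
have qS : forall S : R, (forall k, (k < D.*2.+1)%N -> `|q.[cheb_node D k]| <= S) ->
  forall x y : R, 0 <= x <= N%:R^-1 -> 0 <= y <= N%:R^-1 ->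
  `|p.[x] - p.[y]| <= 4 * D.+1%:R ^+ 3 * N%:R * S * `|x - y|.
  move=> S hS x y hx hy.
  have tr (z : R) : 0 <= z <= N%:R^-1 -> -1 <= 2 * N%:R * z - 1 <= 1 /\ q.[2 * N%:R * z - 1] = p.[z].
    move=> /andP[z0 zN]; split; last first.
      by rewrite qE; congr p.[_]; field; rewrite gt_eqF.
    have h1 : 0 <= N%:R * z by rewrite mulr_ge0 // ltW.
    have h2 : N%:R * z <= 1 by rewrite mulrC -ler_pdivlMr // div1r.
    by rewrite -mulrA; lra.
  have [x1 x2] := tr x hx; have [y1 y2] := tr y hy.
  have := poly_lip sq hS x1 y1; rewrite x2 y2 => /le_trans; apply.
  have -> : 2 * N%:R * x - 1 - (2 * N%:R * y - 1) = (2 * N%:R) * (x - y) by ring.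
  rewrite normrM (ger0_norm (mulr_ge0 (ler0n _ 2) (ltW NR))).
  by rewrite le_eqVlt; apply/orP; left; apply/eqP; ring.
have M0 : 0 <= M by apply: le_trans (pM N _).
(* The largest value at the nodes is at most 2M, since each node is within
   N^-2 of some 1/n. *)
have node2M : forall k, (k < D.*2.+1)%N -> `|q.[cheb_node D k]| <= 2 * M.
  pose S : R := \big[Num.max/0]_(k < D.*2.+1) `|q.[cheb_node D k]|.
  have hS k : (k < D.*2.+1)%N -> `|q.[cheb_node D k]| <= S.
    by move=> kD; exact: (le_bigmax _ (fun k : 'I_ _ => `|q.[cheb_node D k]|) (Ordinal kD)).
  suff SM : S <= 2 * M by move=> k kD; apply: le_trans (hS k kD) SM.
  have S0 : 0 <= S by apply: le_trans (hS 0%N _).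
  (* Passing from a node to a nearby $1/n$ costs at most $4(D+1)^3 N S \cdot N^{-2} \le S/2$, which
     the finite maximum [S] absorbs. *)
  suff : S <= M + S / 2 by lra.
  apply: bigmax_le => [|k _]; first by lra.
  have /andP[c1 c2] := cheb_node_itv D k.
  rewrite qE; set x := (_ + 1) / _.
  have hx : 0 <= x <= N%:R^-1.
    rewrite /x invfM mulrA; apply/andP; split.
      by rewrite mulr_ge0 ?invr_ge0 ?ler0n // divr_ge0 //; lra.
    by rewrite -[leRHS]mul1r ler_pM2r ?invr_gt0 //; lra.
  have [n Nn xn] := near_invn N0 hx.
  have hn := invn_itv N0 Nn.
  rewrite -[p.[x]](subrK p.[n%:R^-1]) addrC (le_trans (ler_normD _ _)) // lerD ?pM //.
  apply: le_trans (qS S hS x _ hx hn) _.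
  apply: (@le_trans _ _ (4 * D.+1%:R ^+ 3 * N%:R * S * (N%:R^-1 ^+ 2))).
    by rewrite ler_wpM2l // !mulr_ge0 ?exprn_ge0 ?ler0n.
  have -> : 4 * D.+1%:R ^+ 3 * N%:R * S * N%:R^-1 ^+ 2 = (8 * D.+1%:R ^+ 3) * N%:R^-1 * (S / 2).
    by field; rewrite gt_eqF.
  rewrite -[leRHS]mul1r ler_wpM2r ?divr_ge0 // ler_pdivrMr // mul1r.
  by rewrite -natrX -natrM ler_nat.
move=> s hs; have h0 : (0 <= (0 : R)) && ((0 : R) <= N%:R^-1) by rewrite lexx invr_ge0 ltW.
have /andP[s0 _] := hs.
apply: le_trans (qS _ node2M _ _ hs h0) _; rewrite subr0 ger0_norm //.
by rewrite le_eqVlt; apply/orP; left; apply/eqP; ring.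
Qed.

(** [poly_lip0_invn] is used twice: for [p * 'X], which vanishes at 0, it bounds $p$ at the points
    $1/m$ by $CM$; for $p$ it then gives $|p(1/n) - p(0)| \le C^2 M/n$. *)
Lemma poly_taylor1_invn D p (N : nat) M : (size p <= D)%N ->
  (8 * D.+1 ^ 3 <= N)%N -> (forall n, (N <= n)%N -> `|(p * 'X).[n%:R^-1]| <= M) ->
  forall n, (N <= n)%N ->
  `|(p * 'X).[n%:R^-1]| <= `|p.[0]| / n%:R + (8 * D.+1%:R ^+ 3 * N%:R) ^+ 2 * M / n%:R ^+ 2.
Proof.
move=> sp DN pM n Nn; have N0 : (0 < N)%N by apply: leq_trans DN; rewrite muln_gt0 expn_gt0.
have NR : 0 < N%:R :> R by rewrite ltr0n.
have itv m : (N <= m)%N -> _ := @invn_itv N m N0.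
set C := 8 * D.+1%:R ^+ 3 * N%:R.
have spX : (size (p * 'X)%R <= D.+1)%N.
  by apply: leq_trans (size_polyMleq _ _) _; rewrite size_polyX addn2.
have pC m : (N <= m)%N -> `|p.[m%:R^-1]| <= C * M.
  move=> Nm; have m0 : 0 < m%:R^-1 :> R by rewrite invr_gt0 ltr0n (leq_trans N0).
  have := poly_lip0_invn spX DN pM (itv m Nm).
  by rewrite !hornerMX mulr0 subr0 normrM (gtr0_norm m0) -/C ler_pM2r.
have := poly_lip0_invn (leq_trans sp (leqnSn D)) DN pC (itv n Nn); rewrite -/C => h.
have n0 : 0 <= n%:R^-1 :> R by rewrite invr_ge0.
rewrite hornerMX normrM (ger0_norm n0).
have -> : C ^+ 2 * M / n%:R ^+ 2 = C * (C * M) * n%:R^-1 * n%:R^-1 by rewrite -exprVn; ring.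
rewrite -mulrDl ler_wpM2r //.
rewrite -[p.[n%:R^-1]](subrK p.[0]) addrC (le_trans (ler_normD _ _)) // lerD2l.
exact: h.
Qed.
End Markov.

(** * Averages over signed permutations *)

Section Edges.
Variable r : nat.

(** [v] is the starting vertex and [p] lists the later ones. An inverse letter is recorded in the
    direction of its generator, so a step and its reversal give the same triple. *)
Fixpoint edges (T : Type) (w : seq (letter r)) (v : T) (p : seq T) : seq ('I_r * (T * T)) :=
  match w, p with
  | l :: w', v' :: p' => (l.1, if l.2 then (v', v) else (v, v')) :: edges w' v' p'
  | _, _ => [::]
  end.

Definition gen_edges (T : Type) (es : seq ('I_r * (T * T))) (g : 'I_r) : seq (T * T) :=
  [seq e.2 | e <- es & e.1 == g].

(** The pairs form a partial injection; on a finite set this is the condition for some permutation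
    to extend them all. *)
Definition compat (T : eqType) (s : seq (T * T)) : bool :=
  all2rel (fun e f => (e.1 == f.1) == (e.2 == f.2)) s.

(** Edges are counted by their source because the sign of an entry depends on its row only. *)
Definition evenly (T : eqType) (s : seq (T * T)) : bool :=
  all (fun e => ~~ odd (count (fun f => f.1 == e.1) s)) s.

Definition map_edge (T U : Type) (h : T -> U) (e : 'I_r * (T * T)) := (e.1, (h e.2.1, h e.2.2)).

Lemma edges_map (T U : Type) (h : T -> U) w v p :
  edges w (h v) (map h p) = map (map_edge h) (edges w v p).
Proof. by elim: w v p => [|[g b] w IH] v [|v' p] //=; rewrite IH; case: b. Qed.

Lemma gen_edges_map (T U : Type) (h : T -> U) es g :
  gen_edges (map (map_edge h) es) g = map (fun e => (h e.1, h e.2)) (gen_edges es g).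
Proof. by rewrite /gen_edges filter_map -!map_comp. Qed.

Lemma compat_map (T U : eqType) (h : T -> U) (hi : injective h) s :
  compat (map (fun e => (h e.1, h e.2)) s) = compat s.
Proof. by rewrite /compat allrel_mapl allrel_mapr; apply: eq_allrel => e f /=; rewrite !(inj_eq hi). Qed.

Lemma evenly_map (T U : eqType) (h : T -> U) (hi : injective h) s :
  evenly (map (fun e => (h e.1, h e.2)) s) = evenly s.
Proof.
rewrite /evenly all_map; apply: eq_all => e /=; rewrite count_map; congr (~~ odd _).
by apply: eq_count => f /=; rewrite (inj_eq hi).
Qed.

End Edges.

Section Permutations.
Variables (T : finType).

Lemma perm_extension (s : seq (T * T)) : uniq (map fst s) -> uniq (map snd s) ->
  exists t : {perm T}, all (fun e => t e.1 == e.2) s.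
Proof.
elim: s => [|[i j] s IH] /=; first by exists 1%g.
move=> /andP[i_s us] /andP[j_s vs]; have [t /allP ht] := IH us vs.
exists (t * tperm (t i) j)%g; rewrite permM tpermL eqxx /=.
apply/allP => -[k l] kl /=; have /eqP /= tk := ht _ kl.
rewrite permM tpermD ?tk //; last by apply: contraNneq j_s => ->; apply: map_f kl.
by apply: contraNneq i_s => /esym; rewrite -tk => /perm_inj <-; apply: map_f kl.
Qed.

(** The extensions form the coset through one extension [t] of the permutations moving only points
    outside the sources of [s]. *)
Lemma card_perm_extension (s : seq (T * T)) : uniq (map fst s) -> uniq (map snd s) ->
  #|[set t : {perm T} | all (fun e => t e.1 == e.2) s]| = ((#|T| - size s)`!)%N.
Proof.
move=> us vs; have [t ht] := perm_extension us vs.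
pose A := [set x | x \notin map fst s].
have cA : #|A| = (#|T| - size s)%N.
  rewrite -(size_map fst) -(card_uniqP us) -[#|T|](cardC (mem (map fst s))) addKn.
  by apply: eq_card => x; rewrite !inE.
rewrite -cA -card_perm; symmetry.
rewrite -(card_imset (perm_on A) (mulIg t)); apply: eq_card => u; apply/finset.imsetP/idP.
  case=> p pA ->; rewrite inE; apply/allP => e es; rewrite permM (out_perm pA).
    by move/allP: ht => /(_ _ es).
  by rewrite inE negbK map_f.
rewrite inE => /allP hu; exists (u * t^-1)%g; last by rewrite mulgKV.
rewrite -topredE /= /perm_on; apply/fintype.subsetP => x; rewrite inE permM; apply: contraR; rewrite inE negbK => /mapP[e es ->].
move/allP: ht => /(_ _ es) /eqP te; move/eqP: (hu _ es) => ->.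
by rewrite -te permK.
Qed.

Lemma card_perm_compat (s : seq (T * T)) :
  #|[set t : {perm T} | all (fun e => t e.1 == e.2) s]| =
  if compat s then ((#|T| - size (undup s))`!)%N else 0%N.
Proof.
case: ifP => [cs|/negbT ncs].
  have cP e f : e \in s -> f \in s -> (e.1 == f.1) = (e.2 == f.2).
    by move=> es fs; move/allrelP: cs => /(_ e f es fs) /eqP.
  rewrite -card_perm_extension; first by apply: eq_card => t; rewrite !inE all_undup.
    rewrite map_inj_in_uniq ?undup_uniq // => e f; rewrite !mem_undup => es fs h.
    by move: (cP e f es fs) h; case: e f {es fs} => [a b] [c d] /= + ac; rewrite ac eqxx => /esym/eqP->.
  rewrite map_inj_in_uniq ?undup_uniq // => e f; rewrite !mem_undup => es fs h.
  by move: (cP e f es fs) h; case: e f {es fs} => [a b] [c d] /= + ac; rewrite ac eqxx => /eqP->.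
apply/eqP; rewrite cards_eq0; apply/eqP/setP => t; rewrite !inE; apply: contraNF ncs.
move=> /allP ht; apply/allrelP => e f es fs.
by rewrite -(eqP (ht _ es)) -(eqP (ht _ fs)) (inj_eq perm_inj).
Qed.
End Permutations.

Section Average.
Variables (R : realType) (n : nat).

(** [sg] selects signed or plain permutation matrices; the plain ones serve to count fixed points in
    the lower bound. *)
Definition entry (sg : bool) (x : SP n) (e : 'I_n * 'I_n) : R :=
  (-1) ^+ (sg && x.2 e.1) * (x.1 e.1 == e.2)%:R.

(** The mean of the product of the entries along [s], by [sum_entries]. The vertex type is arbitrary
    so that walks in ['I_n] and their patterns in [nat] share one weight. *)
Definition edge_weight (sg : bool) (T : eqType) (s : seq (T * T)) : R :=
  (compat s && (sg ==> evenly s))%:R * \prod_(j < size (undup s)) (n%:R - j%:R)^-1.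

(** The sum factors over the rows: row $i$ gives $1 + (-1)^c$, where $c$ is the number of edges of
    [s] leaving $i$. *)
Lemma sum_signs (s : seq ('I_n * 'I_n)) :
  \sum_(f : {ffun 'I_n -> bool}) \prod_(e <- s) (-1) ^+ (f e.1) = (evenly s)%:R * 2 ^+ n :> R.
Proof.
have e1 (f : {ffun 'I_n -> bool}) : \prod_(e <- s) (-1) ^+ (f e.1) =
    \prod_i ((-1) ^+ (f i)) ^+ count (fun e => e.1 == i) s :> R.
  elim: s => [|e s IH]; first by rewrite big_nil big1 // => i _; rewrite expr0.
  rewrite big_cons IH [RHS](eq_bigr (fun i => (if i == e.1 then (-1) ^+ f i else 1) *
     ((-1) ^+ f i) ^+ count (fun e => e.1 == i) s)).
    by rewrite big_split /= -big_mkcond big_pred1_eq.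
  by move=> i _ /=; rewrite eq_sym; case: eqP => _; rewrite ?add1n ?exprS ?mul1r.
under eq_bigr do rewrite e1.
rewrite -(bigA_distr_bigA (fun i (b : bool) => ((-1) ^+ b) ^+ count (fun e => e.1 == i) s)).
rewrite (eq_bigr (fun i => (~~ odd (count (fun e => e.1 == i) s))%:R * 2)).
  rewrite big_split /= prodr_const card_ord; congr (_ * _).
  rewrite -natr_prod /evenly; congr (_%:R).
  case: (boolP (all _ s)) => [/allP hs|/allPn[e es]].
    rewrite big1 // => i _; case: (boolP (has (fun e => e.1 == i) s)) => [/hasP[e es /eqP <-]|].
      by rewrite hs.
    by rewrite has_count -leqNgt leqn0 => /eqP ->.
  by rewrite negbK => o; rewrite (bigD1 e.1) //= o mul0n.
move=> i _; rewrite big_bool /= expr1 expr0 expr1n -signr_odd.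
by case: (odd _); rewrite ?mul0r ?mul1r ?expr0 ?expr1 // addNr.
Qed.

Lemma fact_ratio k : (k <= n)%N ->
  ((n - k)`!)%:R = (n`!)%:R * \prod_(j < k) (n%:R - j%:R)^-1 :> R.
Proof.
elim: k => [|k IH] kn; first by rewrite subn0 big_ord0 mulr1.
have := IH (ltnW kn); rewrite big_ord_recr /= mulrA => <-.
rewrite (_ : (n - k = (n - k.+1).+1)%N); last by rewrite subnSK.
have h : n%:R - k%:R = (n - k.+1).+1%:R :> R by rewrite subnSK // natrB // ltnW.
by rewrite factS natrM h mulrC mulrA mulVf ?mul1r // pnatr_eq0.
Qed.

Lemma size_undup_compat (s : seq ('I_n * 'I_n)) : compat s -> (size (undup s) <= n)%N.
Proof.
move=> cs; rewrite -(size_map fst) -[leqRHS]card_ord -(card_uniqP _) ?max_card //.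
rewrite map_inj_in_uniq ?undup_uniq // => e f; rewrite !mem_undup => es fs h.
move/allrelP: cs => /(_ e f es fs); case: e f h {es fs} => [a b] [c d] /= ->.
by rewrite eqxx => /eqP /esym /eqP ->.
Qed.

Lemma sum_entries sg (s : seq ('I_n * 'I_n)) :
  \sum_(x : SP n) \prod_(e <- s) entry sg x e = (#|{: SP n}|)%:R * edge_weight sg s.
Proof.
rewrite -(pair_big xpredT xpredT (fun t f => \prod_(e <- s) entry sg (t, f) e)) /=.
rewrite (eq_bigr (fun t : 'S_n => (all (fun e => t e.1 == e.2) s)%:R *
   \sum_(f : {ffun 'I_n -> bool}) \prod_(e <- s) (-1) ^+ (sg && f e.1))); last first.
  move=> t _; rewrite mulr_sumr; apply: eq_bigr => f _; rewrite big_split /= mulrC.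
  congr (_ * _); elim: s => [|e s IH] /=; first by rewrite big_nil.
  by rewrite big_cons IH; case: (_ == _); rewrite ?mul1r ?mul0r.
rewrite -mulr_suml.
have -> : \sum_(t : 'S_n) (all (fun e => t e.1 == e.2) s)%:R =
   (compat s)%:R * ((n - size (undup s))`!)%:R :> R.
  rewrite -natr_sum -(@big_mkcond _ _ _ _ _ _ (fun=> 1%N)) /= sum1dep_card card_perm_compat.
  by rewrite card_ord; case: ifP; rewrite ?mul1r ?mul0r.
have -> : \sum_(f : {ffun 'I_n -> bool}) \prod_(e <- s) (-1) ^+ (sg && f e.1) =
    (sg ==> evenly s)%:R * 2 ^+ n :> R.
  case: sg => /=; first exact: sum_signs.
  rewrite (eq_bigr (fun=> 1)) ?sumr_const; last by move=> f _; rewrite big1.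
  by rewrite card_ffun card_bool card_ord mul1r natrX.
rewrite /edge_weight card_prod card_Sn card_ffun card_bool card_ord.
case: (boolP (compat s)) => [/size_undup_compat h|_]; last by rewrite /= !mul0r mulr0.
by rewrite fact_ratio //= natrM natrX; ring.
Qed.

End Average.

(* Restricted growth strings: the walks whose vertices are numbered in the
   order of their first visit, the vertices below V being already visited. *)
Fixpoint rgs (m V : nat) : seq (seq nat) :=
  if m is m'.+1 then
    [seq i :: t | i <- iota 0 V, t <- rgs m' V] ++ [seq V :: t | t <- rgs m' V.+1]
  else [:: [::]].

Definition nvert (V : nat) (t : seq nat) : nat := foldl (fun V v => maxn V v.+1) V t.

Lemma nvert_ge V t : (V <= nvert V t)%N.
Proof.
by elim: t V => //= v t IH V; apply: leq_trans (IH _); rewrite leq_maxl.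
Qed.

(** * Sums over walks, grouped by pattern *)

Section WalkSums.
Variables (R : realType) (n : nat).

Fixpoint wsum m (F : seq 'I_n -> R) : R :=
  if m is m'.+1 then \sum_i wsum m' (fun s => F (i :: s)) else F [::].

Lemma eq_wsum m F F' : (forall s, F s = F' s) -> wsum m F = wsum m F'.
Proof. by elim: m F F' => [|m IH] F F' h //=; apply: eq_bigr => i _; apply: IH. Qed.

Lemma wsum_sum m (I : Type) (s : seq I) (P : pred I) F :
  \sum_(x <- s | P x) wsum m (F x) = wsum m (fun p => \sum_(x <- s | P x) F x p).
Proof. by elim: m F => //= m IH F; rewrite exchange_big; apply: eq_bigr => i _; apply: IH. Qed.

Lemma wsumZ m c F : c * wsum m F = wsum m (fun s => c * F s).
Proof. by elim: m F => //= m IH F; rewrite mulr_sumr; apply: eq_bigr => i _; apply: IH. Qed.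

Lemma wsum_perm m F (s : 'S_n) : wsum m F = wsum m (fun t => F (map s t)).
Proof.
elim: m F => //= m IH F; rewrite (reindex_inj (@perm_inj _ s)) /=.
by apply: eq_bigr => i _; rewrite IH.
Qed.

Section Pattern.
Variable G : seq nat -> R.
Hypothesis G_inj : forall f : nat -> nat, injective f -> forall s, G (map f s) = G s.

Let swap (a b x : nat) := if x == a then b else if x == b then a else x.

Let swapK a b : involutive (swap a b).
Proof.
move=> x; rewrite /swap; case: (x =P a) => [->|xa]; first by rewrite eqxx; case: eqP.
by case: (x =P b) => [->|xb]; rewrite ?eqxx //; do 2 case: eqP => //.
Qed.

(** Induction on the next vertex: either it is one of the $V$ vertices already named, or it is one
    of the $n - V$ others, which contribute equally and may be renamed $V$. The product collects
    these multiplicities. *)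
Lemma wsum_rgs m V pre : all (fun v => (v < V)%N) pre -> (V <= n)%N ->
  wsum m (fun s => G (pre ++ map val s)) =
  \sum_(t <- rgs m V) (\prod_(V <= j < nvert V t) (n%:R - j%:R)) * G (pre ++ t).
Proof.
elim: m V pre => [|m IH] V pre preV Vn /=.
  by rewrite big_seq1 cats0 big_geq // mul1r.
have catE i s : pre ++ i :: s = rcons pre i ++ s by rewrite cat_rcons.
rewrite (bigID (fun i : 'I_n => (i < V)%N)) /= big_cat /= big_allpairs_dep big_map.
congr (_ + _).
  rewrite -(big_ord_widen n (fun i : nat => wsum m (fun s => G (pre ++ i :: map val s)))) //.
  rewrite -(big_mkord xpredT (fun i : nat => wsum m (fun s => G (pre ++ i :: map val s)))).
  rewrite /index_iota subn0 big_seq [RHS]big_seq; apply: eq_bigr => i.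
  rewrite mem_iota /= add0n => iV; rewrite (eq_wsum _ (fun s => congr1 G (catE i (map val s)))).
  rewrite (IH V) //; last by rewrite all_rcons iV.
  by apply: eq_bigr => t _; rewrite -catE (maxn_idPl iV).
(* Once all $n$ vertices are named, the left side has no new vertex and the product on the right
   contains $n - n$. *)
case: (ltnP V n) => [ltVn|nV]; last first.
  rewrite big_pred0; last by move=> i; rewrite (leq_trans (ltn_ord i) nV).
  rewrite big1 // => t _; rewrite big_ltn; last first.
    by rewrite /= (maxn_idPr (leqnSn V)); exact: nvert_ge.
  by rewrite (_ : V = n) ?subrr ?mul0r //; apply/eqP; rewrite eqn_leq Vn.
rewrite (eq_bigr (fun=> wsum m (fun s => G (pre ++ V :: map val s)))); last first.
  move=> i; rewrite -leqNgt => Vi.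
  (* Exchanging $i$ and $V$, in the walk by [wsum_perm] and in the pattern by [G_inj], fixes the
     prefix, whose vertices are all below $V$. *)
  rewrite (wsum_perm _ _ (tperm i (Ordinal ltVn))); apply: eq_wsum => s.
  rewrite -[RHS](@G_inj (swap i V)); last exact: can_inj (swapK _ _).
  congr G; rewrite map_cat /=; congr (_ ++ _).
    rewrite -[LHS]map_id; apply/eq_in_map => x /(allP preV) xV; rewrite /swap.
    by rewrite !ifN_eq // neq_ltn ?xV // (leq_trans xV).
  congr (_ :: _); first by rewrite /swap eqxx; case: eqP.
  rewrite -!map_comp; apply: eq_map => x /=; rewrite /swap.
  by case: tpermP => [->|->|xi xV] /=; rewrite ?eqxx //; [case: eqP|rewrite !ifN_eq //; apply/eqP => h; [case: xV|case: xi]; exact: val_inj].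
rewrite sumr_const.
have -> : #|[pred i : 'I_n | ~~ (i < V)%N]| = (n - V)%N.
  have cV : #|[pred i : 'I_n | (i < V)%N]| = V.
    transitivity (\sum_(i < V) 1)%N; last by rewrite sum1_card card_ord.
    by rewrite -sum1_card (big_ord_widen n (fun=> 1%N)).
  by apply: (@addnI V); rewrite subnKC // -[RHS](card_ord n) -(cardC [pred i : 'I_n | (i < V)%N]) cV.
rewrite (eq_wsum _ (fun s => congr1 G (catE V (map val s)))) (IH V.+1) //; last first.
  by rewrite all_rcons ltnSn /=; apply: sub_all preV => x /ltnW.
rewrite -sumrMnl; apply: eq_bigr => t _.
rewrite /= (maxn_idPr (leqnSn V)) -catE [in RHS]big_ltn ?nvert_ge //.
by rewrite -[LHS]mulr_natr natrB //; ring.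
Qed.
End Pattern.

Variable r : nat.

Definition lmx sg (x : 'I_r -> SP n) (l : letter r) : 'M[R]_n :=
  \matrix_(i, j) entry R sg (x l.1) (if l.2 then (j, i) else (i, j)).

Definition wmx sg (x : 'I_r -> SP n) (w : seq (letter r)) : 'M[R]_n :=
  foldr (fun l M => lmx sg x l *m M) 1%:M w.

Lemma wmxE sg x w i j : wmx sg x w i j =
  wsum (size w) (fun p => (last i p == j)%:R * \prod_(e <- edges w i p) entry R sg (x e.1) e.2).
Proof.
elim: w i => [|l w IH] i /=; first by rewrite big_nil mulr1 mxE.
rewrite mxE; apply: eq_bigr => k _; rewrite IH wsumZ; apply: eq_wsum => s.
by rewrite big_cons mxE; case: l => g [] /=; ring.
Qed.

(** The generators are chosen independently, so the mean factors over the labels. *)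
Lemma sum_prod_entries sg (es : seq ('I_r * ('I_n * 'I_n))) :
  \sum_(x : {ffun 'I_r -> SP n}) \prod_(e <- es) entry R sg (x e.1) e.2 =
  (#|{: {ffun 'I_r -> SP n}}|)%:R * \prod_g edge_weight R n sg (gen_edges es g).
Proof.
have e1 (x : {ffun 'I_r -> SP n}) : \prod_(e <- es) entry R sg (x e.1) e.2 =
    \prod_g \prod_(e <- gen_edges es g) entry R sg (x g) e.
  under [RHS]eq_bigr => g _.
    rewrite big_map big_filter. over.
  rewrite (exchange_big_dep xpredT) //=; apply: eq_bigr => e _.
  by rewrite (big_pred1 e.1) // => g; rewrite eq_sym.
rewrite (eq_bigr _ (fun x _ => e1 x)).
rewrite -(bigA_distr_bigA (fun g y => \prod_(e <- gen_edges es g) entry R sg y e)).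
under eq_bigr do rewrite sum_entries.
by rewrite big_split /= prodr_const card_ord card_ffun card_ord natrX.
Qed.

Definition walk_weight sg (w : seq (letter r)) (t : seq nat) : R :=
  if t is v :: p then
    (last v p == v)%:R * \prod_g edge_weight R n sg (gen_edges (edges w v p) g)
  else 0.

Lemma edge_weight_map sg (T U : eqType) (h : T -> U) (hi : injective h) s :
  edge_weight R n sg (map (fun e => (h e.1, h e.2)) s) = edge_weight R n sg s.
Proof.
rewrite /edge_weight compat_map // evenly_map // undup_map_inj ?size_map //.
by move=> [a b] [c d] [] /hi -> /hi ->.
Qed.

Lemma walk_weight_map sg w (f : nat -> nat) : injective f ->
  forall t, walk_weight sg w (map f t) = walk_weight sg w t.
Proof.
move=> fi [|v p] //=; rewrite last_map inj_eq // edges_map; congr (_ * _).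
by apply: eq_bigr => g _; rewrite gen_edges_map edge_weight_map.
Qed.

(** The weight of a walk depends on its pattern only, and the falling factorial counts the walks in
    ['I_n] with a given pattern. *)
Lemma sum_trace sg w :
  \sum_(x : {ffun 'I_r -> SP n}) \tr (wmx sg x w) =
  (#|{: {ffun 'I_r -> SP n}}|)%:R *
  \sum_(t <- rgs (size w).+1 0) (\prod_(0 <= j < nvert 0 t) (n%:R - j%:R)) * walk_weight sg w t.
Proof.
rewrite -(@wsum_rgs _ (walk_weight_map sg w) (size w).+1 0 [::]) //= mulr_sumr.
transitivity (\sum_i wsum (size w) (fun p => \sum_(x : {ffun 'I_r -> SP n})
   (last i p == i)%:R * \prod_(e <- edges w i p) entry R sg (x e.1) e.2)).
  rewrite exchange_big; apply: eq_bigr => i _.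
  by rewrite -wsum_sum; apply: eq_bigr => x _; rewrite wmxE.
apply: eq_bigr => i _; rewrite wsumZ; apply: eq_wsum => p.
rewrite -mulr_sumr sum_prod_entries last_map edges_map (inj_eq val_inj) mulrCA.
congr (_ * (_ * _)); apply: eq_bigr => g _.
by rewrite gen_edges_map edge_weight_map //; exact: val_inj.
Qed.
End WalkSums.

(** * Closed walks with as many edges as vertices *)

Local Close Scope ring_scope.

Lemma mem_rgs_cons m V v t :
  (v :: t \in rgs m.+1 V) = (v <= V)%N && (t \in rgs m (maxn V v.+1)).
Proof.
rewrite /= mem_cat; case: (ltngtP v V) => [vV|vV|vV] /=.
- rewrite (maxn_idPl vV); apply/orP/idP => [ []|h].
  + by case/allpairsPdep => i [s [_ sr [_ ->]]].
  + by case/mapP => s _ [e]; rewrite e ltnn in vV.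
  by left; apply/allpairsPdep; exists v, t; rewrite mem_iota.
- apply/negP => /orP[].
  + case/allpairsPdep => i [s []]; rewrite mem_iota /= add0n => iV _ [e _].
    by rewrite e ltnNge ltnW in vV.
  + by case/mapP => s _ [e]; rewrite e ltnn in vV.
- subst V; rewrite (maxn_idPr (leqnSn v)); apply/orP/idP => [ []|h].
  + by case/allpairsPdep => i [s []]; rewrite mem_iota /= add0n => iV _ [e _]; rewrite -e ltnn in iV.
  + by case/mapP => s sr [->].
  by right; apply/mapP; exists t.
Qed.

Lemma rgs_uniq m V : uniq (rgs m V).
Proof.
elim: m V => //= m IH V; rewrite cat_uniq; apply/and3P; split.
- apply: allpairs_uniq_dep => //; first exact: iota_uniq.
  by move=> [i s] [j t] _ _ /= [-> ->].
- apply/hasPn => s /mapP[t _ ->]; apply/allpairsPdep => -[i [u []]].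
  by rewrite mem_iota /= add0n => iV _ [e _]; rewrite e ltnn in iV.
- by rewrite map_inj_uniq // => s t [].
Qed.

Lemma mem_rgsP m V t : reflect (size t = m /\ forall i, (i < m)%N -> (nth 0 t i <= nvert V (take i t))%N)
  (t \in rgs m V).
Proof.
apply: (iffP idP); elim: m V t => [|m IH] V [|v t].
- by [].
- by rewrite inE.
- by rewrite /= mem_cat => /orP[/allpairsPdep[i [s [_ _]]]|/mapP[s _]].
- rewrite mem_rgs_cons => /andP[vV /IH[<- h]]; split=> // -[|i] //= ilh.
  exact: h.
- by rewrite inE.
- by case.
- by case.
- case=> -[sz] h; rewrite mem_rgs_cons (h 0%N) //=; apply: IH; split=> // i ilm.
  exact: (h i.+1).
Qed.

Lemma modnS_lt x c : ((x %% c).+1 < c)%N -> (x.+1 %% c = (x %% c).+1)%N.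
Proof. by move=> h; rewrite -addn1 -modnDml addn1 modn_small. Qed.

Lemma modnS_eq x c : ((x %% c).+1 = c)%N -> (x.+1 %% c = 0)%N.
Proof. by move=> h; rewrite -addn1 -modnDml addn1 h modnn. Qed.

(* w = u c^D u^-1 with |u| = a and |uc| = b, on the level of letters. *)
Definition lolli r m (l : nat -> letter r) a b D : bool :=
  [&& (a < b)%N, (0 < D)%N, m == (a + D * (b - a) + a)%N,
    all (fun i => l i == l (a + (i - a) %% (b - a))%N) (iota a (D * (b - a))) &
    all (fun i => l i == letter_inv (l (m.-1 - i)%N)) (iota (a + D * (b - a)) a)].

(* The walk along such a word, vertices being numbered in the order of their
   first visit. *)
Definition lolli_walk a b D i : nat :=
  if (i < b)%N then i else if (i < a + D * (b - a))%N then a + (i - a) %% (b - a)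
  else a + D * (b - a) + a - i.

Section Walk.
Variables (r : nat) (l : nat -> letter r) (v : nat -> nat).

Definition step_edge i := ((l i).1, if (l i).2 then (v i.+1, v i) else (v i, v i.+1)).
Local Notation e := step_edge.
(** For a walk numbered by first visits, the number of distinct vertices among its first $i$
    ones. *)
Definition walk_nv i := nvert 0 (mkseq v i).
Local Notation N := walk_nv.

Lemma step_edge_eq i j : e i = e j ->
  [/\ l i = l j, v i = v j & v i.+1 = v j.+1] \/
  [/\ l i = letter_inv (l j), v i = v j.+1 & v i.+1 = v j].
Proof.
rewrite /e /letter_inv; case: (l i) (l j) => [g []] [h []] /= [-> -> ->]; by [left|right].
Qed.

Lemma walk_nvS i : N i.+1 = maxn (N i) (v i).+1.
Proof. by rewrite /N /nvert /mkseq -{1}addn1 iotaD map_cat foldl_cat. Qed.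

Lemma walk_nv_le i j : (i <= j)%N -> (N i <= N j)%N.
Proof.
move=> /subnK <-; elim: (j - i)%N => //= k IH.
by rewrite addSn walk_nvS; apply: leq_trans IH _; rewrite leq_maxl.
Qed.

Lemma walk_lt_nv i j : (i < j)%N -> (v i < N j)%N.
Proof. by move/walk_nv_le; apply: leq_trans; rewrite walk_nvS leq_maxr. Qed.

(* A step along a new edge to an old vertex: it adds one to (edges - vertices). *)
Definition excess i := (e i \notin mkseq e i) && (v i.+1 != N i.+1).

Lemma mem_mkseqP (T : eqType) (f : nat -> T) m x :
  reflect (exists2 i, (i < m)%N & x = f i) (x \in mkseq f m).
Proof.
apply: (iffP mapP) => [ [k]|[i ilm ->]]; first by rewrite mem_iota => h ->; exists k.
by exists i => //; rewrite mem_iota.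
Qed.

Lemma mkseqS (T : Type) (f : nat -> T) m : mkseq f m.+1 = rcons (mkseq f m) (f m).
Proof. by rewrite /mkseq -{1}addn1 iotaD map_cat cats1. Qed.

Lemma new_vertex_new_edge i : v i.+1 = N i.+1 -> e i \notin mkseq e i.
Proof.
move=> vN; apply/mem_mkseqP => -[j ji /step_edge_eq[ [_ _]|[_ _]]]; rewrite vN => h.
  by have := @walk_lt_nv j.+1 i.+1 ji; rewrite -h ltnn.
by have := @walk_lt_nv j i.+1 (leqW ji); rewrite -h ltnn.
Qed.

Lemma size_undup_rcons (T : eqType) (s : seq T) x :
  size (undup (rcons s x)) = (size (undup s) + (x \notin s))%N.
Proof.
rewrite (perm_size (perm_undup (_ : rcons s x =i x :: s))); last first.
  by move=> y; rewrite mem_rcons.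
by rewrite /=; case: (x \in s); rewrite /= ?addn0 ?addn1.
Qed.

(** Euler count: a step to a new vertex uses a new edge, so vertices and edges grow together except
    at the excess steps. The successor on the left accounts for the starting vertex. *)
Lemma edges_excess m : (forall i, (i <= m)%N -> (v i <= N i)%N) ->
  ((size (undup (mkseq e m))).+1 = N m.+1 + \sum_(i < m) excess i)%N.
Proof.
elim: m => [|m IH] h.
  by rewrite big_ord0 walk_nvS; have := h 0%N isT; rewrite leqn0 => /eqP ->.
rewrite mkseqS size_undup_rcons -addSn IH => [|i ilm]; last by rewrite h // ltnW.
rewrite big_ord_recr /= (walk_nvS m.+1) /excess.
have := h m.+1 (leqnn _); rewrite leq_eqVlt => /predU1P[vN|vN].
  by rewrite (new_vertex_new_edge vN) vN eqxx (maxn_idPr (leqnSn _)) addn0 addn1 addSn.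
by rewrite (maxn_idPl vN) neq_ltn vN andbT addnA.
Qed.

Section Closed.
Variable m : nat.
Hypothesis v_le : forall i, (i <= m)%N -> (v i <= N i)%N.
Hypothesis l_red : forall i, (i.+1 < m)%N -> l i.+1 != letter_inv (l i).
Hypothesis m_gt0 : (0 < m)%N.
Hypothesis closed : v m = 0%N.

(** Before this time $b$ each step discovers a vertex; at time $b$ the first cycle closes, at the
    vertex [v b]. *)
Definition first_return := find (fun i => v i != i) (iota 0 m.+1).
Local Notation b := first_return.

Lemma first_return_le : (b <= m)%N.
Proof.
have : has (fun i => v i != i) (iota 0 m.+1).
  apply/hasP; exists m; first by rewrite mem_iota ltnSn.
  by rewrite closed neq_ltn m_gt0.
by rewrite has_find size_iota.
Qed.

Lemma walk_id i : (i < b)%N -> v i = i.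
Proof.
move=> ib; have := before_find 0%N ib; rewrite nth_iota; first by move/negbFE/eqP.
exact: leq_trans ib (leqW first_return_le).
Qed.

Lemma walk_nv_id i : (i <= b)%N -> N i = i.
Proof.
elim: i => // i IH ib; rewrite walk_nvS (IH (ltnW ib)) walk_id //.
by rewrite (maxn_idPr (leqnSn i)).
Qed.

Lemma first_return_lt : (v b < b)%N.
Proof.
have : has (fun i => v i != i) (iota 0 m.+1).
  apply/hasP; exists m; first by rewrite mem_iota ltnSn.
  by rewrite closed neq_ltn m_gt0.
move/(nth_find 0%N); rewrite nth_iota ?ltnS ?first_return_le // add0n => h.
rewrite ltn_neqAle h /=; have := v_le first_return_le.
by rewrite walk_nv_id.
Qed.

Lemma first_return_gt0 : (0 < b)%N.
Proof. exact: leq_ltn_trans first_return_lt. Qed.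

(** If the closing edge had been used before, it would be the edge of the preceding step traversed
    backwards, a backtrack excluded by reducedness. *)
Lemma excess_first_return : excess b.-1.
Proof.
have b0 := first_return_gt0; have b1 : (b.-1 < b)%N by rewrite prednK.
rewrite /excess prednK // walk_nv_id // neq_ltn first_return_lt andbT.
apply/mem_mkseqP => -[j jb h]; have jb1 : (j.+1 < b)%N by lia.
case/step_edge_eq: h => [ [_ h _]|[hl h _] ]; move: h; rewrite (walk_id b1).
  by rewrite (walk_id (ltnW jb1)); lia.
rewrite (walk_id jb1) => bj; have : (j.+1 < m)%N by have := first_return_le; lia.
by move/l_red; rewrite -bj hl eqxx.
Qed.

Lemma nv_le_edges : (N m.+1 <= size (undup (mkseq e m)))%N.
Proof.
have bm : (b.-1 < m)%N by have := first_return_le; have := first_return_gt0; lia.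
rewrite -ltnS edges_excess // (bigD1 (Ordinal bm)) //= excess_first_return.
by rewrite addnA addn1 ltnS leq_addr.
Qed.

Section Unicyclic.
Hypothesis unicyclic : N m.+1 = size (undup (mkseq e m)).

Lemma excess_only i : (i < m)%N -> excess i -> i = b.-1.
Proof.
move=> ilm ei; apply/eqP; apply/negPn/negP => ib.
have bm : (b.-1 < m)%N by have := first_return_le; have := first_return_gt0; lia.
have := edges_excess v_le; rewrite -unicyclic (bigD1 (Ordinal bm)) //= excess_first_return.
by rewrite (bigD1 (Ordinal ilm)) /= ?ei; [lia | rewrite -val_eqE].
Qed.

(** After a late new vertex the walk could neither backtrack nor reach an old vertex by a new edge,
    since the only excess step is spent. It would discover new vertices forever and never return to
    0. *)
Lemma old_vertex i : (b <= i < m)%N -> v i.+1 != N i.+1.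
Proof.
move=> /andP[bi ilm]; apply/eqP => vN.
suff h k : (i + k < m)%N -> v (i + k).+1 = N (i + k).+1.
  have := h (m.-1 - i)%N; rewrite (_ : (i + (m.-1 - i) = m.-1)%N); last by lia.
  rewrite prednK // closed => /(_ _) h0; have := walk_lt_nv m_gt0; rewrite -h0 //; lia.
elim: k => [|k IH] ik; first by rewrite addn0.
have {}IH : v (i + k).+1 = N (i + k).+1 by apply: IH; lia.
rewrite addnS; apply/eqP; apply: contraTT isT => vN'.
suff ex : excess (i + k).+1 by have := excess_only _ ex; lia.
rewrite /excess vN' andbT; apply/mem_mkseqP => -[j jik /step_edge_eq[ [_ h _]|[hl h _]]].
  by have := @walk_lt_nv j (i + k).+1 jik; rewrite -IH h ltnn.
move: jik; rewrite ltnS leq_eqVlt => /predU1P[jE|jik].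
  by have := @l_red (i + k); rewrite hl jE eqxx; lia.
by have := @walk_lt_nv j.+1 (i + k).+1 jik; rewrite -IH h ltnn.
Qed.

Lemma old_edge i : (i < m)%N -> exists2 j, (j < b)%N & e i = e j.
Proof.
elim/ltn_ind: i => i IH ilm; case: (ltnP i b) => [ib|bi]; first by exists i.
have : ~~ excess i by apply/negP => /(excess_only ilm); have := first_return_gt0; lia.
rewrite /excess old_vertex ?bi // andbT negbK => /mem_mkseqP[j ji ->].
by apply: IH => //; apply: ltn_trans ilm.
Qed.

Local Notation a := (v b).

Let v_cut j : (j < b)%N -> v j.+1 = if (j.+1 < b)%N then j.+1 else a.
Proof.
move=> jb; case: ifP => [/walk_id //|/negbT]; rewrite -leqNgt => bj.
by have -> : j.+1 = b by lia.
Qed.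

Let step_cases i : (i < m)%N -> exists2 j, (j < b)%N &
  [/\ l i = l j, v i = j & v i.+1 = v j.+1] \/
  [/\ l i = letter_inv (l j), v i = v j.+1 & v i.+1 = j].
Proof.
move=> /old_edge[j jb /step_edge_eq h]; exists j => //.
by move: h; rewrite (walk_id jb).
Qed.

(** The graph is a path from 0 to $a$ with a cycle attached at $a$. Inside the cycle reducedness
    leaves one continuation; back at $a$ it leaves two, another turn or the descent along the
    path. *)
Lemma forward_step i j : (i.+1 < m)%N -> (a <= j < b)%N -> l i = l j -> v i.+1 = v j.+1 ->
  ((j.+1 < b)%N /\ [/\ l i.+1 = l j.+1, v i.+1 = j.+1 & v i.+2 = v j.+2]) \/
  (j.+1 = b /\ ([/\ l i.+1 = l a, v i.+1 = a & v i.+2 = v a.+1] \/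
     [/\ (0 < a)%N, l i.+1 = letter_inv (l a.-1), v i.+1 = a & v i.+2 = a.-1])).
Proof.
move=> im /andP[aj jb] lij vij; have ab := first_return_lt.
have ni := l_red im; have [j' jb' h] := step_cases im.
move: vij; rewrite (v_cut jb); case: ifP => [jb1|/negbT jb1] vij.
  left; split=> //; case: h => [ [lj vj vj2]|[lj vj vj2] ].
    by move: vj lj vj2; rewrite vij => <-.
  move: vj; rewrite vij (v_cut jb'); case: ifP => _ h; last by lia.
  by case: h => h; move: ni; rewrite lj -h lij eqxx.
right; split; first by lia.
case: h => [ [lj vj vj2]|[lj vj vj2] ].
  by left; move: vj lj vj2; rewrite vij => <-.
right; move: vj; rewrite vij (v_cut jb'); case: ifP => h' h.
  by rewrite h /=; split=> //; rewrite vj2.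
have jj : j' = j by lia.
by move: ni; rewrite lj jj lij eqxx.
Qed.

Lemma backward_step i j : (i.+1 < m)%N -> (j < a)%N -> l i = letter_inv (l j) -> v i.+1 = j ->
  [/\ (0 < j)%N, l i.+1 = letter_inv (l j.-1), v i.+1 = j & v i.+2 = j.-1].
Proof.
move=> im ja lij vij; have ab := first_return_lt.
have ni := l_red im; have [j' jb' [ [lj vj vj2]|[lj vj vj2] ] ] := step_cases im.
  by move: ni; rewrite lij letter_invK lj -vj vij eqxx.
move: vj; rewrite vij (v_cut jb'); case: ifP => _ h; last by lia.
by rewrite h /=; split=> //; rewrite vj2.
Qed.

(** Vertex reached at time $i$ while still turning. In [bwd T], $T$ is the time at which the walk
    leaves the cycle for the path down to 0. *)
Let pos i := (a + (i - a) %% (b - a))%N.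
Let fwd i := [/\ l i = l (pos i), v i = pos i & v i.+1 = v (pos i).+1].
Let bwd T i := [/\ (i - T < a)%N, l i = letter_inv (l (a.-1 - (i - T))), v i = (a - (i - T))%N &
  v i.+1 = (a.-1 - (i - T))%N].

Let phases i : (b <= i <= m)%N ->
  (forall k, (a <= k < i)%N -> fwd k) \/
  exists D, [/\ (b <= a + D * (b - a) < i)%N, forall k, (a <= k < a + D * (b - a))%N -> fwd k &
     forall k, (a + D * (b - a) <= k < i)%N -> bwd (a + D * (b - a)) k].
Proof.
have ab := first_return_lt; have c0 : (0 < b - a)%N by rewrite subn_gt0.
elim: i => [|i IH] /andP[bi im]; first by lia.
move: bi; rewrite leq_eqVlt => /predU1P[bi|bi].
  left=> k /andP[ak ki]; have kb : (k < b)%N by rewrite bi.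
  by rewrite /fwd /pos modn_small ?ltn_sub2r // subnKC // walk_id.
have ltS k n : (k < n.+1)%N -> k = n \/ (k < n)%N.
  by rewrite ltnS leq_eqVlt => /predU1P.
case: IH => [|h|[D [Dlt hf hb] ] ]; first by rewrite -ltnS bi ltnW.
  case: i im bi h => [|i] im bi h; first by lia.
  have ai : (a <= i < i.+1)%N by lia.
  have [li vi vi1] := h i ai.
  have jb : (a <= pos i < b)%N.
    by rewrite /pos leq_addr -ltn_subRL ltn_mod.
  have sub1 : (i.+1 - a = (i - a).+1)%N by lia.
  have [ [jb1 ls]|[jb1 [ls|[a0 ls1 ls2 ls3] ] ] ] := forward_step im jb li vi1.
  - left=> k /andP[ak] /ltS[->|ki]; last by apply: h; rewrite ak.
    suff pE : pos i.+1 = (pos i).+1 by rewrite /fwd pE.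
    by rewrite /pos sub1 modnS_lt ?addnS //; move: jb1; rewrite /pos; lia.
  - left=> k /andP[ak] /ltS[->|ki]; last by apply: h; rewrite ak.
    suff pE : pos i.+1 = a by rewrite /fwd pE.
    by rewrite /pos sub1 modnS_eq ?addn0 //; move: jb1; rewrite /pos; lia.
  - have m0 : (i.+1 - a) %% (b - a) = 0%N.
      by rewrite sub1 modnS_eq //; move: jb1; rewrite /pos; lia.
    have TE : (a + (i.+1 - a) %/ (b - a) * (b - a) = i.+1)%N.
      by have := divn_eq (i.+1 - a) (b - a); rewrite m0 addn0 => <-; lia.
    right; exists ((i.+1 - a) %/ (b - a)); rewrite TE; split; first by lia.
      by move=> k; exact: h.
    move=> k ki; have -> : k = i.+1 by lia.
    by rewrite /bwd subnn !subn0.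
set T := (a + D * (b - a))%N in Dlt hf hb *.
right; exists D; rewrite -/T; split=> //; first by lia.
case: i im bi Dlt hf hb => [|i] im bi Dlt hf hb; first by lia.
have Ti : (T <= i < i.+1)%N by lia.
move=> k /andP[Tk] /ltS[->|ki]; last by apply: hb; rewrite Tk.
have [iT li vi vi1] := hb i Ti.
have ja : (a.-1 - (i - T) < a)%N by lia.
have [j0 ls vs vs1] := backward_step im ja li vi1.
have e1 : (a.-1 - (i - T)).-1 = (a.-1 - (i.+1 - T))%N by lia.
by split; [lia | rewrite ls e1 | lia | rewrite vs1 e1].
Qed.

(** A walk that is still turning at the end stops at 0 after a full turn, so $a = 0$. Otherwise the
    descent, which takes $a$ steps, ends exactly at time $m$. *)
Lemma unicyclic_lolli :
  exists D, lolli m l a b D /\ forall i, (i <= m)%N -> v i = lolli_walk a b D i.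
Proof.
have ab := first_return_lt; have c0 : (0 < b - a)%N by rewrite subn_gt0.
have bm := first_return_le; have b0 := first_return_gt0.
suff [D [D0 mE hf hb] ] : exists D, [/\ (b <= a + D * (b - a))%N, m = (a + D * (b - a) + a)%N,
    forall k, (a <= k < a + D * (b - a))%N -> fwd k &
    forall k, (a + D * (b - a) <= k < m)%N -> bwd (a + D * (b - a)) k].
  exists D; set T := (a + D * (b - a))%N in D0 mE hf hb *; split.
    have D1 : (0 < D)%N by move: D0; rewrite /T; case: (D) => //; lia.
    apply/and5P; split=> //; first exact/eqP.
      by apply/allP => i; rewrite mem_iota -/T => /hf[-> _ _].
    apply/allP => i; rewrite mem_iota -/T => hi.
    have [|hi1 -> _ _] := hb i; first by lia.
    by apply/eqP; congr (letter_inv (l _)); lia.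
  move=> i im; rewrite /lolli_walk -/T; case: ifP => [/walk_id //|ib].
  case: ifP => [iT|iT]; first by have [|_ -> _] := hf i; [lia|].
  move: im; rewrite leq_eqVlt => /predU1P[->|im]; first by rewrite closed mE; lia.
  by have [|hi _ -> _] := hb i; lia.
have m1 : (m.-1 < m)%N by lia.
have [|hf|[D [Dlt hf hb] ] ] := phases (i := m); first by rewrite bm leqnn.
  have am : (a <= m.-1 < m)%N by lia.
  have [_ _] := hf _ am; rewrite prednK // closed => v0.
  have pb : (pos m.-1 < b)%N by rewrite /pos -ltn_subRL ltn_mod.
  move: v0; rewrite (v_cut pb); case: ifP => // pb1 a0.
  have pE : (pos m.-1).+1 = b by move: pb pb1; lia.
  have m0 : (m - a) %% (b - a) = 0%N.
    rewrite (_ : m - a = (m.-1 - a).+1)%N; last by lia.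
    by rewrite modnS_eq //; move: pE; rewrite /pos; lia.
  have TE : (a + (m - a) %/ (b - a) * (b - a) = m)%N.
    by have := divn_eq (m - a) (b - a); rewrite m0 addn0 => <-; lia.
  exists ((m - a) %/ (b - a))%N; rewrite TE; split=> //; first by lia.
  by move=> k; lia.
exists D; split=> //; first by lia.
have hm : (a + D * (b - a) <= m.-1 < m)%N by lia.
by have [h1 _ _] := hb _ hm; rewrite prednK // closed; lia.
Qed.

End Unicyclic.
End Closed.
End Walk.

(** * Converse: the walk of a word $u c^D u^{-1}$ is unicyclic *)

Section Lollipop.
Variables (r m a b D : nat) (l : nat -> letter r) (v : nat -> nat).
Hypothesis L : lolli m l a b D.
Hypothesis vE : forall i, (i <= m)%N -> v i = lolli_walk a b D i.
Local Notation e := (step_edge l v).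
Let T := (a + D * (b - a))%N.

Let Lab : (a < b)%N. Proof. by case/and5P: L. Qed.
Let LD : (0 < D)%N. Proof. by case/and5P: L. Qed.
Let Lm : m = (T + a)%N. Proof. by case/and5P: L => _ _ /eqP. Qed.
Let Lf i : (a <= i < T)%N -> l i = l (a + (i - a) %% (b - a))%N.
Proof. by case/and5P: L => _ _ _ /allP h _ hi; apply/eqP/h; rewrite mem_iota. Qed.
Let Lb i : (T <= i < m)%N -> l i = letter_inv (l (m.-1 - i)%N).
Proof. by case/and5P: L => _ _ _ _ /allP h hi; apply/eqP/h; rewrite mem_iota -/T -Lm. Qed.
Lemma lolli_cut_le : (b <= T)%N.
Proof. by rewrite /T; case: (D) LD => // k _; rewrite mulSn; lia. Qed.

Let bT := lolli_cut_le.

Lemma lolli_walk_id i : (i < b)%N -> v i = i.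
Proof. by move=> ib; rewrite vE /lolli_walk ?ib //; lia. Qed.

Lemma lolli_walk_cut : v b = a.
Proof.
rewrite vE /lolli_walk ?ltnn -/T; last by lia.
case: ifP => h; first by rewrite modnn addn0.
by lia.
Qed.

Let vmid i : (a <= i < T)%N -> v i = (a + (i - a) %% (b - a))%N.
Proof.
move=> hi; rewrite vE /lolli_walk -/T; last by lia.
case: ifP => ib; last by case: ifP => //; lia.
by rewrite modn_small; lia.
Qed.

Let vT i : (T <= i <= m)%N -> v i = (m - i)%N.
Proof.
move=> hi; rewrite vE /lolli_walk -/T -?Lm; last by lia.
by case: ifP => [|_]; [lia | case: ifP => //; lia].
Qed.

Lemma lolli_edge_fwd i : (a <= i < T)%N -> e i = e (a + (i - a) %% (b - a))%N.
Proof.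
move=> hi; have jm : ((i - a) %% (b - a) < b - a)%N by rewrite ltn_mod subn_gt0.
set j := (a + _)%N; have jb : (j < b)%N by rewrite /j; lia.
have vi : v i = v j by rewrite vmid // (lolli_walk_id jb).
suff vi1 : v i.+1 = v j.+1 by rewrite /step_edge (Lf hi) -/j vi vi1.
have sub1 : (i.+1 - a = (i - a).+1)%N by lia.
have [jb1|jb1] := ltnP j.+1 b.
  have iT : (i.+1 < T)%N.
    rewrite ltn_neqAle; apply/andP; split; last by lia.
    apply/eqP => iT; have := modnS_lt (x := i - a) (c := b - a).
    by rewrite -sub1 iT /T addKn modnMl; move: jb1; rewrite /j; lia.
  rewrite (lolli_walk_id jb1) vmid; last by lia.
  by rewrite sub1 modnS_lt ?addnS //; move: jb1; rewrite /j; lia.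
have -> : j.+1 = b by lia.
rewrite lolli_walk_cut; have [iT|iT] := ltnP i.+1 T.
  rewrite vmid; last by lia.
  by rewrite sub1 modnS_eq ?addn0 //; move: jb1 jb; rewrite /j; lia.
by rewrite vT; lia.
Qed.

Lemma lolli_edge_bwd i : (T <= i < m)%N -> e i = e (m.-1 - i)%N.
Proof.
move=> hi; rewrite /step_edge (Lb hi) vT; last by lia.
rewrite vT; last by lia.
rewrite !lolli_walk_id; try lia.
have -> : (m.-1 - i).+1 = (m - i)%N by lia.
have -> : (m - i.+1)%N = (m.-1 - i)%N by lia.
by rewrite /letter_inv; case: (l _) => g [].
Qed.

Lemma lolli_edges i : (i < m)%N -> exists2 j, (j < b)%N & e i = e j.
Proof.
move=> im; have [ia|ai] := ltnP i a; first by exists i => //; lia.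
have [iT|Ti] := ltnP i T.
  have jm : ((i - a) %% (b - a) < b - a)%N by rewrite ltn_mod subn_gt0.
  by exists (a + (i - a) %% (b - a))%N; [lia | apply: lolli_edge_fwd; lia].
by exists (m.-1 - i)%N; [lia | apply: lolli_edge_bwd; lia].
Qed.

(** The path is traversed once in each direction and the cycle $D$ times in the same direction. *)
Lemma count_lolli_edges P : count P (mkseq e m) =
  ((count P (mkseq e a)).*2 + D * count P (map e (iota a (b - a))))%N.
Proof.
rewrite /mkseq Lm /T !iotaD !map_cat !count_cat add0n -/T.
have -> : count P (map e (iota T a)) = count P (map e (iota 0 a)).
  rewrite -[RHS]count_rev -map_rev; congr count.
  apply: (@eq_from_nth _ (e 0%N)); first by rewrite !size_map size_rev !size_iota.
  rewrite size_map size_iota => i ia.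
  rewrite !(nth_map 0%N) ?size_rev ?size_iota // nth_iota // nth_rev ?size_iota // nth_iota; last by lia.
  by rewrite lolli_edge_bwd; [congr e; lia | lia].
rewrite addnAC addnn; congr (_ + _)%N.
suff h k : (k <= D)%N -> count P (map e (iota a (k * (b - a)))) = (k * count P (map e (iota a (b - a))))%N.
  by apply: h.
elim: k => [//|k IH] kD.
rewrite mulSnr iotaD map_cat count_cat IH; last by lia.
rewrite mulSnr; congr (_ + count _ _)%N.
have io x : iota x (b - a) = map (addn x) (iota 0 (b - a)) by rewrite -iotaDl addn0.
rewrite (io (a + _)%N) (io a) -!map_comp.
apply/eq_in_map => i; rewrite mem_iota /= add0n => ic /=.
have kDc : ((k * (b - a) + (b - a)) <= D * (b - a))%N by rewrite -mulSnr leq_mul2r kD orbT.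
rewrite -addnA lolli_edge_fwd; last first.
  by rewrite leq_addr ltn_add2l (leq_trans _ kDc) // ltn_add2l.
by rewrite addKn modnMDl modn_small.
Qed.

Hypothesis l_red : forall i, (i.+1 < m)%N -> l i.+1 != letter_inv (l i).

Lemma lolli_edge_inj i j : (i < b)%N -> (j < b)%N -> e i = e j -> i = j.
Proof.
wlog ij : i j / (i <= j)%N => [h ib jb eij|ib jb].
  by case: (leqP i j) => [/h->//|/ltnW/h h']; apply/esym/h'.
case/step_edge_eq => [ [_ h _]|[hl h h1] ]; move: h; rewrite (lolli_walk_id ib); first by rewrite lolli_walk_id.
have [->//|ij1] : i = j \/ (i < j)%N by lia.
move: h1; rewrite (lolli_walk_id jb) lolli_walk_id; last by lia.
move=> ji _; have := l_red (i := i); rewrite ji hl letter_invK eqxx; lia.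
Qed.

Lemma size_undup_lolli : size (undup (mkseq e m)) = b.
Proof.
have ub : uniq (mkseq e b).
  by rewrite map_inj_in_uniq ?iota_uniq // => i j; rewrite !mem_iota; apply: lolli_edge_inj.
rewrite -(size_mkseq e b); apply/perm_size/uniq_perm => //; first exact: undup_uniq.
move=> x; rewrite mem_undup; apply/mem_mkseqP/mem_mkseqP => -[i ib ->].
  by have [j jb ->] := lolli_edges ib; exists j.
by exists i => //; lia.
Qed.

(** The closing edge $b-1$ is traversed exactly $D$ times, and compatibility shows that no other
    edge of the cycle has its label and source; path edges contribute an even number anyway. *)
Lemma lolli_even_turns :
  (forall i j, (i < m)%N -> (j < m)%N -> (e i).1 = (e j).1 ->
     ((e i).2.1 == (e j).2.1) = ((e i).2.2 == (e j).2.2)) ->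
  (forall i, (i < m)%N ->
     ~~ odd (count (fun y => (y.1 == (e i).1) && (y.2.1 == (e i).2.1)) (mkseq e m))) ->
  ~~ odd D.
Proof.
move=> hc /(_ b.-1) he; have b1 : (b.-1 < m)%N by lia.
move: (he b1); rewrite count_lolli_edges oddD odd_double addFb oddM.
rewrite (_ : count _ _ = 1%N) ?andbT //.
rewrite (eq_in_count (a2 := pred1 (e b.-1))); last first.
  move=> _ /mapP[i + ->]; rewrite mem_iota [RHS]/= => hi.
  apply/andP/eqP => [ [/eqP h1 h2]|->]; last by rewrite !eqxx.
  have im : (i < m)%N by lia.
  have /esym := hc i b.-1 im b1 h1; rewrite h2 => /eqP.
  by case: (e i) (e b.-1) h1 (eqP h2) => [g [s t] ] [g' [s' t'] ] /= -> -> ->.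
rewrite count_uniq_mem; last first.
  rewrite map_inj_in_uniq ?iota_uniq // => i j; rewrite !mem_iota => hi hj.
  by apply: lolli_edge_inj; lia.
by rewrite map_f // mem_iota; lia.
Qed.

Lemma lolli_walk_lt i : (i <= m)%N -> (v i < b)%N.
Proof.
move=> im; have [ib|bi] := ltnP i b; first by rewrite lolli_walk_id.
have [iT|Ti] := ltnP i T; last by rewrite vT; lia.
have jm : ((i - a) %% (b - a) < b - a)%N by rewrite ltn_mod subn_gt0.
by rewrite vmid; lia.
Qed.

Lemma lolli_nv_id i : (i <= b)%N -> walk_nv v i = i.
Proof.
elim: i => // i IH ib; rewrite walk_nvS (IH (ltnW ib)) lolli_walk_id //.
by rewrite (maxn_idPr (leqnSn i)).
Qed.

Lemma lolli_walk_le i : (i <= m)%N -> (v i <= walk_nv v i)%N.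
Proof.
move=> im; have [ib|bi] := leqP i b; last first.
  rewrite (leq_trans (ltnW (lolli_walk_lt im))) // -[X in (X <= _)%N](lolli_nv_id (leqnn b)).
  by apply: walk_nv_le; rewrite ltnW.
rewrite lolli_nv_id //; move: ib; rewrite leq_eqVlt => /predU1P[->|ib]; last by rewrite lolli_walk_id.
by rewrite lolli_walk_cut ltnW.
Qed.

Lemma lolli_nv : walk_nv v m.+1 = b.
Proof.
apply/eqP; rewrite eqn_leq; apply/andP; split; last first.
  by rewrite -[X in (X <= _)%N](lolli_nv_id (leqnn b)); apply: walk_nv_le; lia.
suff h k : (k <= m.+1)%N -> (walk_nv v k <= b)%N by apply: h.
elim: k => // k IH km; rewrite walk_nvS geq_max IH ?(ltnW km) //=.
by rewrite lolli_walk_lt.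
Qed.

Lemma lolli_closed : v m = 0%N.
Proof. by rewrite vT ?subnn //; lia. Qed.

Lemma lolli_evenly P : ~~ odd D -> ~~ odd (count P (mkseq e m)).
Proof. by move=> D2; rewrite count_lolli_edges oddD odd_double addFb oddM negb_and D2. Qed.

(** A conflict can only occur at the vertex $a$. Equal letters entering $a$ from the path and from
    the cycle would make the word backtrack when $u^{-1}$ begins; opposite letters at the two ends
    of $c$ would make it backtrack between two turns, and with $D > 1$ this junction does occur in
    the word. *)
Lemma lolli_compat i j : (1 < D)%N -> (i < m)%N -> (j < m)%N -> (e i).1 = (e j).1 ->
  ((e i).2.1 == (e j).2.1) = ((e i).2.2 == (e j).2.2).
Proof.
move=> D2; move=> /lolli_edges[i' ib ->] /lolli_edges[j' jb ->] {i j}.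
have bT1 : (b < T)%N by rewrite /T; case: (D) D2 => [|[|k]] // _; rewrite !mulSn; lia.
wlog ij : i' j' ib jb / (i' <= j')%N => [h g|].
  case: (leqP i' j') => [ij|/ltnW ji]; first exact: h.
  by rewrite eq_sym [RHS]eq_sym; apply: h.
have [->|{}ij] : i' = j' \/ (i' < j')%N by lia.
  by rewrite !eqxx.
move=> g.
have vi1 : v i'.+1 = i'.+1 by rewrite lolli_walk_id //; lia.
have vj1 : v j'.+1 = if (j'.+1 < b)%N then j'.+1 else a.
  by case: ifP => h; [rewrite lolli_walk_id | have -> : j'.+1 = b; [lia | exact: lolli_walk_cut] ].
have same : l i' = l j' -> i'.+1 != v j'.+1.
  move=> hl; rewrite vj1; case: ifP => h; first by lia.
  apply/eqP => ia; have jb1 : j' = b.-1 by lia.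
  have := l_red (i := T.-1); rewrite prednK; last by lia.
  rewrite (Lb (i := T)); last by lia.
  rewrite (Lf (i := T.-1)); last by lia.
  have -> : (a + (T.-1 - a) %% (b - a))%N = j'.
    have := modnS_lt (x := T.-1 - a) (c := b - a).
    have jm : ((T.-1 - a) %% (b - a) < b - a)%N by rewrite ltn_mod subn_gt0.
    rewrite (_ : (T.-1 - a).+1 = (D * (b - a))%N); last by rewrite /T; lia.
    by rewrite modnMl; lia.
  have -> : (m.-1 - T = i')%N by lia.
  by rewrite hl eqxx; lia.
have opp : l i' = letter_inv (l j') -> (i'.+1 != j') /\ (i' != v j'.+1).
  move=> hl; split.
    apply/eqP => ij1; have := l_red (i := i'); rewrite ij1 hl letter_invK eqxx; lia.
  rewrite vj1; case: ifP => h; first by lia.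
  apply/eqP => ia; have := l_red (i := b.-1); rewrite prednK; last by lia.
  rewrite (Lf (i := b)); last by lia.
  rewrite modnn addn0 -ia hl (_ : b.-1 = j'); last by lia.
  by rewrite eqxx; lia.
move: g same opp; rewrite /step_edge /letter_inv vi1 (lolli_walk_id ib) (lolli_walk_id jb).
have nij : (i' == j') = false by lia.
case: (l i') (l j') => [g1 []] [g2 []] /= -> same opp.
- by rewrite nij (negbTE (same erefl)).
- by have [h1 h2] := opp erefl; rewrite (negbTE h1) (negbTE h2).
- by have [h1 h2] := opp erefl; rewrite (negbTE h1) (negbTE h2).
- by rewrite nij (negbTE (same erefl)).
Qed.

End Lollipop.

(** * Valid patterns of a reduced word *)

Section Patterns.
Variable r : nat.
Implicit Types (w : seq (letter r)) (t : seq nat).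

Definition walk_edges w t := if t is v :: p then edges w v p else [::].

Definition valid_walk (sg : bool) w t : bool :=
  (last (head 0 t) t == head 0 t) &&
  [forall g, compat (gen_edges (walk_edges w t) g) && (sg ==> evenly (gen_edges (walk_edges w t) g))].

Definition nedges w t : nat := size (undup (walk_edges w t)).

Lemma edges_mkseq l0 w v p : size p = size w ->
  edges w v p = mkseq (step_edge (nth l0 w) (nth 0 (v :: p))) (size w).
Proof.
elim: w v p => [|l w IH] v [|v' p] //= [sp].
by rewrite IH // -add1n /mkseq iotaD map_cat /= (iotaDl 1 0) -map_comp.
Qed.

Lemma compatP (T : eqType) (es : seq ('I_r * (T * T))) :
  reflect (forall x y, x \in es -> y \in es -> x.1 = y.1 -> (x.2.1 == y.2.1) = (x.2.2 == y.2.2))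
    [forall g, compat (gen_edges es g)].
Proof.
apply: (iffP forallP) => [h x y xs ys g|h g].
  have /allrelP/(_ x.2 y.2) := h x.1; rewrite /gen_edges !map_f ?mem_filter ?eqxx ?g ?eqxx //.
  by move=> /(_ isT isT) /eqP.
apply/allrelP => _ _ /mapP[x + ->] /mapP[y + ->]; rewrite !mem_filter.
by move=> /andP[/eqP xg xs] /andP[/eqP yg ys]; apply/eqP/h; rewrite ?xg ?yg.
Qed.

Lemma evenlyP (T : eqType) (es : seq ('I_r * (T * T))) :
  reflect (forall x, x \in es ->
     ~~ odd (count (fun y => (y.1 == x.1) && (y.2.1 == x.2.1)) es))
    [forall g, evenly (gen_edges es g)].
Proof.
have cE x : count (fun f => f.1 == x.2.1) (gen_edges es x.1) =
            count (fun y => (y.1 == x.1) && (y.2.1 == x.2.1)) es.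
  by rewrite count_map count_filter; apply: eq_count => y /=; rewrite andbC.
apply: (iffP forallP) => [h x xs|h g].
  by rewrite -cE; move/allP: (h x.1); apply; rewrite map_f // mem_filter eqxx.
by apply/allP => _ /mapP[x + ->]; rewrite mem_filter => /andP[/eqP <- xs]; rewrite cE h.
Qed.

Lemma valid_walkE sg w t : valid_walk sg w t =
  [&& last (head 0 t) t == head 0 t, [forall g, compat (gen_edges (walk_edges w t) g)]
    & sg ==> [forall g, evenly (gen_edges (walk_edges w t) g)] ].
Proof.
congr (_ && _); apply/forallP/andP => [h|[/forallP h1 h2] g].
  split; first by apply/forallP => g; case/andP: (h g).
  by apply/implyP => hs; apply/forallP => g; case/andP: (h g) => _ /implyP; apply.
by rewrite h1; move: h2; case: sg => //= /forallP.
Qed.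

Lemma sum_gen_edges (T : eqType) (es : seq ('I_r * (T * T))) :
  (\sum_g size (undup (gen_edges es g)) = size (undup es))%N.
Proof.
have e1 g : size (undup (gen_edges es g)) = size [seq e <- undup es | e.1 == g].
  rewrite -(size_map snd); apply/perm_size/uniq_perm; first exact: undup_uniq.
    rewrite map_inj_in_uniq ?filter_uniq ?undup_uniq // => -[g1 x] [g2 y].
    by rewrite !mem_filter /= => /andP[/eqP -> _] /andP[/eqP -> _] ->.
  move=> x; rewrite mem_undup; apply/mapP/mapP => -[e +->]; rewrite !mem_filter ?mem_undup => h;
  by exists e; rewrite // mem_filter ?mem_undup.
under eq_bigr do rewrite e1 size_filter -sum1_count.
rewrite (exchange_big_dep xpredT) //= -sum1_size; apply: eq_bigr => e _.
by rewrite (big_pred1 e.1) // => g; rewrite eq_sym.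
Qed.

Section Word.
Variables (w : seq (letter r)) (l0 : letter r).
Hypotheses (w_red : reduced w) (w_gt0 : (0 < size w)%N).
Local Notation m := (size w).
Local Notation l := (nth l0 w).

Lemma reduced_nth i : (i.+1 < m)%N -> l i.+1 != letter_inv (l i).
Proof. by move: w_red => /(sortedP l0); apply. Qed.

Lemma rgs_mkseq t : t \in rgs m.+1 0 -> let v := nth 0 t in
  [/\ t = mkseq v m.+1, forall i, (i <= m)%N -> (v i <= walk_nv v i)%N,
      walk_edges w t = mkseq (step_edge l v) m, nvert 0 t = walk_nv v m.+1 &
      (last (head 0 t) t == head 0 t) = (v m == 0)].
Proof.
move=> /mem_rgsP[st ht] v; have tE : t = mkseq v m.+1 by rewrite -st mkseq_nth.
have v0 : v 0%N = 0%N by have := ht 0%N isT; rewrite take0 /= leqn0 => /eqP.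
split=> //.
- move=> i im; have := ht i im; rewrite /walk_nv; congr (_ <= nvert _ _)%N.
  apply: (@eq_from_nth _ 0%N); first by rewrite size_take size_mkseq st ltnS im.
  by move=> j; rewrite size_take st ltnS im => ji; rewrite nth_take // nth_mkseq.
- by rewrite /v; case: (t) st => // x p [sp]; rewrite /= (edges_mkseq l0).
- by rewrite /walk_nv -tE.
have hd : head 0 t = 0%N by rewrite -nth0 -/(v 0%N) v0.
by rewrite hd (last_nth 0) st.
Qed.

Lemma nvert_le_nedges sg t : t \in rgs m.+1 0 -> valid_walk sg w t ->
  (nvert 0 t <= nedges w t)%N.
Proof.
move=> /rgs_mkseq[tE vle eE nE hE] /andP[+ _]; rewrite hE => /eqP v0.
by rewrite /nedges nE eE; apply: nv_le_edges => //; apply: reduced_nth.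
Qed.

(** The map from triples to their walks is a bijection onto the counted patterns. It is injective
    because $b$ is the first time the walk leaves the identity numbering, $a$ is the vertex reached
    then, and $D$ follows from the length. [Q] only bounds the three indices. *)
Lemma count_unicyclic Q : (m <= Q)%N ->
  count (fun t => valid_walk true w t && (nvert 0 t == nedges w t)) (rgs m.+1 0) =
  (\sum_(a < Q.+1) \sum_(b < Q.+1) \sum_(D < Q.+1) (lolli m l a b D && ~~ odd D))%N.
Proof.
move=> mQ; pose TT := ('I_Q.+1 * 'I_Q.+1 * 'I_Q.+1)%type.
pose P (x : TT) := lolli m l x.1.1 x.1.2 x.2 && ~~ odd x.2.
pose f (x : TT) := mkseq (lolli_walk x.1.1 x.1.2 x.2) m.+1.
transitivity (size (map f [seq x <- enum {: TT} | P x])); last first.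
  rewrite size_map size_filter -sum1_count big_enum_cond /= big_mkcond /=.
  by rewrite pair_big pair_big /=; apply: eq_bigr => -[[a b] D] _; rewrite /P /=; case: (_ && _).
rewrite -size_filter; apply/perm_size/uniq_perm; first by rewrite filter_uniq // rgs_uniq.
  rewrite map_inj_in_uniq ?filter_uniq -?enumT ?enum_uniq // => -[ [a b] D] [ [a' b'] D'].
  rewrite !mem_filter /P /f /= => /andP[/andP[L _] _] /andP[/andP[L' _] _] e.
  have vE i : (i <= m)%N -> lolli_walk a b D i = lolli_walk a' b' D' i.
    by move=> im; have := congr1 (fun s => nth 0 s i) e; rewrite !nth_mkseq.
  have cut (a1 b1 D1 : nat) : lolli m l a1 b1 D1 ->
      [/\ (b1 <= m)%N, (a1 < b1)%N, m = (a1 + D1 * (b1 - a1) + a1)%N, lolli_walk a1 b1 D1 b1 = a1 &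
          forall i, (i < b1)%N -> lolli_walk a1 b1 D1 i = i].
    move=> L1; have := lolli_cut_le L1; case/and5P: (L1) => h1 h2 /eqP h3 _ _ h4.
    split=> //; first by lia.
      exact: (lolli_walk_cut L1 (fun _ _ => erefl)).
    exact: (lolli_walk_id L1 (fun _ _ => erefl)).
  have [bm ab mE vb vi] := cut _ _ _ L; have [bm' ab' mE' vb' vi'] := cut _ _ _ L'.
  have bb : (b : nat) = b'.
    case: (ltngtP (b : nat) b') => // h.
      by have := vi' _ h; rewrite -vE // vb; lia.
    by have := vi _ h; rewrite vE // vb'; lia.
  have aa : (a : nat) = a' by rewrite -vb -vb' vE // bb.
  have DD : (D : nat) = D'.
    apply/eqP; rewrite -(eqn_pmul2r (_ : 0 < b - a)%N) ?subn_gt0 //; apply/eqP.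
    by move: mE mE'; rewrite -aa -bb; lia.
  by congr (_, _, _); apply/val_inj.
move=> t; rewrite mem_filter; apply/andP/mapP => [ [/andP[ok /eqP VE] tr]|[ [ [a b] D] + ->] ].
  have [tE vle eE nE hE] := rgs_mkseq tr.
  move: ok; rewrite valid_walkE hE => /and3P[/eqP v0 /compatP cp /evenlyP ev].
  rewrite eE in cp ev.
  have uni : walk_nv (nth 0 t) m.+1 = size (undup (mkseq (step_edge l (nth 0 t)) m)).
    by rewrite -nE VE /nedges eE.
  have [D [L vE] ] := unicyclic_lolli vle reduced_nth w_gt0 v0 uni.
  set b := first_return _ _ in L vE; set a := nth 0 t b in L vE.
  have inE i : (i < m)%N -> step_edge l (nth 0 t) i \in mkseq (step_edge l (nth 0 t)) m.
    by move=> im; rewrite map_f // mem_iota.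
  have D2 : ~~ odd D.
    apply: (lolli_even_turns L vE reduced_nth) => [i j im jm|i im].
      by apply: cp; apply: inE.
    by apply: ev; apply: inE.
  have ab : (a < b)%N by case/and5P: L.
  have D0 : (0 < D)%N by case/and5P: L.
  have mE : m = (a + D * (b - a) + a)%N by case/and5P: L => _ _ /eqP.
  have bm := lolli_cut_le L.
  have Dm : (D <= D * (b - a))%N by rewrite leq_pmulr // subn_gt0.
  have aQ : (a < Q.+1)%N by lia.
  have bQ : (b < Q.+1)%N by lia.
  have DQ : (D < Q.+1)%N by lia.
  exists (Ordinal aQ, Ordinal bQ, Ordinal DQ).
    by rewrite mem_filter /P /= L D2 mem_enum.
  rewrite tE; apply: (@eq_from_nth _ 0%N); first by rewrite !size_mkseq.
  by move=> i; rewrite size_mkseq ltnS => im; rewrite !nth_mkseq // vE.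
rewrite mem_filter /P /f /= => /andP[/andP[L D2] _].
set v := lolli_walk a b D.
have tvE i : (i <= m)%N -> nth 0 (mkseq v m.+1) i = lolli_walk a b D i.
  by move=> im; rewrite nth_mkseq.
have tr : mkseq v m.+1 \in rgs m.+1 0.
  apply/mem_rgsP; split; first by rewrite size_mkseq.
  move=> i im; rewrite nth_mkseq //; have := lolli_walk_le L (fun _ _ => erefl) (i := i) im.
  congr (_ <= nvert _ _)%N; apply: (@eq_from_nth _ 0%N).
    by rewrite size_take !size_mkseq im.
  by move=> j; rewrite size_mkseq => ji; rewrite nth_take // !nth_mkseq // (ltn_trans ji).
have [tE vle eE nE hE] := rgs_mkseq tr.
have D1 : (1 < D)%N by move: D2; case/and5P: (L); case: (D : nat) => [|[|k] ].
split; last exact: tr.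
apply/andP; split; last first.
  by rewrite -[nvert _ _]/(nvert 0 (mkseq v m.+1)) nE /nedges eE (lolli_nv L tvE) (size_undup_lolli L tvE reduced_nth).
rewrite valid_walkE hE (lolli_closed L tvE) eqxx eE /=; apply/andP; split.
  apply/compatP => x y /mem_mkseqP[i im ->] /mem_mkseqP[j jm ->].
  exact: (lolli_compat L tvE reduced_nth).
by apply/evenlyP => x _; apply: (lolli_evenly L tvE).
Qed.
End Word.
End Patterns.

Local Open Scope ring_scope.

Local Notation normc := Normc.normc.

(** * Random walk kernels and sums over the words u c^D u^-1 *)

Section SquareSummable.
Variable R : realType.
Local Notation C := (R[i]).

Lemma normc_ge0 (x : C) : 0 <= normc x.
Proof. by case: x => a b; exact: sqrtr_ge0. Qed.

Lemma normc_sum (I : Type) (s : seq I) (P : pred I) (F : I -> C) :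
  normc (\sum_(i <- s | P i) F i) <= \sum_(i <- s | P i) normc (F i).
Proof.
elim/big_rec2: _ => [|i y x _ h]; first by rewrite Normc.normc0.
by rewrite (le_trans (le_normcD _ _)) // lerD2l.
Qed.

Lemma sum_mul_sqr_le (I : Type) (s : seq I) (a b : I -> R) :
  (\sum_(i <- s) a i * b i) ^+ 2 <= (\sum_(i <- s) a i ^+ 2) * (\sum_(i <- s) b i ^+ 2).
Proof.
elim: s => [|i s IH]; first by rewrite !big_nil expr0n mulr0.
rewrite !big_cons; set A := \sum_(j <- s) a j ^+ 2 in IH *; set B := \sum_(j <- s) b j ^+ 2 in IH *.
set S := \sum_(j <- s) _ in IH *; set x := a i; set y := b i.
have A0 : 0 <= A by apply: sumr_ge0 => j _; exact: sqr_ge0.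
have B0 : 0 <= B by apply: sumr_ge0 => j _; exact: sqr_ge0.
suff : 2 * (x * y * S) <= A * y ^+ 2 + x ^+ 2 * B by nra.
apply: le_trans (ler_norm _) _.
rewrite -(@ler_pXn2r _ 2) ?nnegrE ?normr_ge0 ?(addr_ge0 (mulr_ge0 A0 (sqr_ge0 _)) (mulr_ge0 (sqr_ge0 _) B0)) //.
rewrite real_normK ?num_real //.
have : 4 * (x ^+ 2 * y ^+ 2 * S ^+ 2) <= 4 * (x ^+ 2 * y ^+ 2 * (A * B)).
  by rewrite ler_wpM2l // ler_wpM2l // (mulr_ge0 (sqr_ge0 _) (sqr_ge0 _)).
have := sqr_ge0 (A * y ^+ 2 - x ^+ 2 * B); nra.
Qed.

(** The $\ell^2$ norm of [f] is at most [B], stated through finite partial sums so that infinite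
    groups are handled with finite sums only. *)
Definition l2le (I : eqType) (f : I -> C) (B : R) : Prop :=
  0 <= B /\ forall s : seq I, uniq s -> \sum_(i <- s) normc (f i) ^+ 2 <= B ^+ 2.

Lemma l2le_restrict (I : eqType) (P : pred I) (f : I -> C) B :
  l2le f B -> l2le (fun i => if P i then f i else 0) B.
Proof.
move=> [B0 h]; split=> // s us; apply: le_trans (h s us); apply: ler_sum => i _.
by case: ifP => _ //; rewrite Normc.normc0 expr0n sqr_ge0.
Qed.

Lemma l2le_delta (I : eqType) (x : I) : l2le (fun i => (i == x)%:R) 1.
Proof.
split=> // s us; rewrite expr1n.
rewrite (eq_bigr (fun i => (i == x)%:R)) => [|i _]; last first.
  by case: eqP => _; rewrite ?Normc.normc1 ?Normc.normc0 ?expr1n ?expr0n.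
case: (boolP (x \in s)) => xs; last first.
  rewrite big_seq big1 // => i ix; case: eqP => // e; by rewrite -e ix in xs.
by rewrite (bigD1_seq x) //= eqxx big1 ?addr0 // => i /negbTE ->.
Qed.

Lemma l2le_inj (I J : eqType) (h : J -> I) (f : I -> C) B :
  injective h -> l2le f B -> l2le (f \o h) B.
Proof.
move=> hi [B0 H]; split=> // s us.
by have := H (map h s); rewrite big_map; apply; rewrite map_inj_uniq.
Qed.

Lemma l2le_eq (I : eqType) (f g : I -> C) B : f =1 g -> l2le f B -> l2le g B.
Proof. by move=> fg [B0 h]; split=> // s us; under eq_bigr do rewrite -fg; exact: h. Qed.

(** Cauchy-Schwarz; injectivity makes each factor a partial sum without repetitions. *)
Lemma l2le_dot (I J : eqType) (s : seq J) (phi psi : J -> I) (f g : I -> C) B B' :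
  uniq s -> {in s &, injective phi} -> {in s &, injective psi} ->
  l2le f B -> l2le g B' -> normc (\sum_(j <- s) f (phi j) * g (psi j)) <= B * B'.
Proof.
move=> us hphi hpsi [B0 hf] [B'0 hg]; apply: le_trans (normc_sum _ _ _) _.
under eq_bigr do rewrite Normc.normcM.
rewrite -(@ler_pXn2r _ 2) ?nnegrE ?mulr_ge0 //; last first.
  by apply: sumr_ge0 => j _; rewrite mulr_ge0 ?normc_ge0.
apply: le_trans (sum_mul_sqr_le _ _ _) _; rewrite exprMn.
have ge0 (F : J -> C) : 0 <= \sum_(j <- s) normc (F j) ^+ 2 by apply: sumr_ge0 => j _; exact: sqr_ge0.
apply: ler_pM => //.
  by have := hf (map phi s); rewrite big_map; apply; rewrite map_inj_in_uniq.
by have := hg (map psi s); rewrite big_map; apply; rewrite map_inj_in_uniq.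
Qed.

Lemma l2le_eq0 (I : eqType) (f : I -> C) : l2le f 0 -> forall i, f i = 0.
Proof.
move=> [_ h] i; have := h [:: i] isT; rewrite big_seq1 expr0n /= => h0.
apply: Normc.eq0_normc; apply/eqP; rewrite -sqrf_eq0 eq_le h0 sqr_ge0 //.
Qed.
End SquareSummable.

Section Kernels.
Variables (R : realType) (G : groupType).
Local Notation C := (R[i]).
Implicit Types (xs : seq (C * G)) (f : G -> C) (A : pred G).
Local Open Scope group_scope.

(* The walk moves a to a * g with weight k, for (k, g) in xs; functions of the
   starting point are averaged over the first step. *)
Definition step_op xs f : G -> C := fun a => (\sum_(p <- xs) p.1 * f (a * p.2)%g)%R.

(** Total weight of the $m$-step paths from [a] to [b]; the target comes first so that the kernel is
    a function of the starting point. *)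
Fixpoint free_kernel xs m (b a : G) : C :=
  if m is m'.+1 then step_op xs (free_kernel xs m' b) a else ((a == b)%:R)%R.

(* First entrance at s into the complement of A after t steps. *)
Fixpoint hit_kernel xs A t (s a : G) : C :=
  if t is t'.+1 then (if A a then step_op xs (hit_kernel xs A t' s) a else 0)%R
  else ((a == s)%:R)%R.

(** A power in the group algebra, with equal group elements left uncollected. *)
Fixpoint group_pow xs m : seq (C * G) :=
  if m is m'.+1 then [seq ((p.1 * p'.1)%R, p.2 * p'.2) | p <- xs, p' <- group_pow xs m']
  else [:: (1%R, 1)].

Lemma eq_step_op xs f f' : f =1 f' -> step_op xs f =1 step_op xs f'.
Proof. by move=> h a; apply: eq_bigr => p _; rewrite h. Qed.

Lemma sum_group_pow xs m phi a :
  (\sum_(p <- group_pow xs m) p.1 * phi (a * p.2)%g = iter m (step_op xs) phi a)%R.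
Proof.
elim: m phi a => [|m IH] phi a; first by rewrite big_seq1 mul1r mulg1.
rewrite /= big_allpairs_dep /=; apply: eq_bigr => p _.
by rewrite -IH mulr_sumr; apply: eq_bigr => p' _ /=; rewrite mulrA mulgA.
Qed.

Lemma free_kernelE xs m b a : free_kernel xs m b a = iter m (step_op xs) (fun c => ((c == b)%:R)%R) a.
Proof. by elim: m a => //= m IH a; apply: eq_step_op. Qed.

Lemma sum_group_pow_delta xs m b : (\sum_(p <- group_pow xs m) p.1 * (p.2 == b)%:R = free_kernel xs m b 1)%R.
Proof. by rewrite free_kernelE -sum_group_pow; apply: eq_bigr => p _; rewrite mul1g. Qed.

Lemma iter_step_sum xs m (I : Type) (s : seq I) (F : I -> G -> C) a :
  (iter m (step_op xs) (fun c => \sum_(i <- s) F i c) a = \sum_(i <- s) iter m (step_op xs) (F i) a)%R.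
Proof.
elim: m a => //= m IH a; rewrite /step_op exchange_big /=; apply: eq_bigr => p _.
by rewrite IH mulr_sumr.
Qed.

Lemma iter_step_scale xs m c f a :
  (iter m (step_op xs) (fun b => c * f b) a = c * iter m (step_op xs) f a)%R.
Proof.
elim: m a => //= m IH a; rewrite /step_op mulr_sumr; apply: eq_bigr => p _.
by rewrite IH mulrCA.
Qed.

Lemma free_kernel_transl xs m c b a : free_kernel xs m (c * b) (c * a) = free_kernel xs m b a.
Proof.
elim: m a => [|m IH] a /=; first by rewrite (inj_eq (@mulgI _ c)).
by apply: eq_bigr => p _; rewrite -mulgA IH.
Qed.

(** Every path from [a] to [b] leaves $A$; it is split at the time $t$ and the place $s$ where it
    does so first. Jumps out of $A$ land in the finite set [S], and a start already outside $A$ must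
    lie in [S], where only $t = 0$ contributes. *)
Lemma first_entrance xs A (S : seq G) b :
  uniq S -> {in S, forall s, ~~ A s} ->
  (forall a p, A a -> p \in xs -> ~~ A (a * p.2) -> a * p.2 \in S) -> ~~ A b ->
  forall m a, A a || (a \in S) ->
  (free_kernel xs m b a =
   \sum_(t < m.+1) \sum_(s <- S) hit_kernel xs A t s a * free_kernel xs (m - t) b s)%R.
Proof.
move=> uS SA bdry nAb; elim=> [|m IH] a; case: (boolP (A a)) => [Aa _|nAa /= aS].
- rewrite big_ord1 big_seq big1 => [|s sS] /=.
    by case: eqP => // e; rewrite -e Aa in nAb.
  by case: eqP => [e|_]; rewrite ?mul0r //; move: (SA _ sS); rewrite -e Aa.
- rewrite big_ord1 (bigD1_seq a) //= eqxx mul1r big1 ?addr0 // => s /negbTE sa.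
  by rewrite eq_sym sa mul0r.
- rewrite big_ord_recl [X in _ = (X + _)%R]big_seq big1 ?add0r => [|s sS]; last first.
    rewrite /=; case: eqP => [e|]; rewrite ?mul0r //.
    by move: (SA _ sS); rewrite -e Aa.
  rewrite [LHS]/= /step_op big_seq.
  rewrite (eq_bigr (fun p => \sum_(t < m.+1) \sum_(s <- S)
       p.1 * (hit_kernel xs A t s (a * p.2) * free_kernel xs (m - t) b s))%R); last first.
    move=> p px; rewrite IH; last by case: (boolP (A _)) => //= h; apply: bdry.
    by rewrite mulr_sumr; apply: eq_bigr => t _; rewrite mulr_sumr.
  rewrite -big_seq exchange_big /=; apply: eq_bigr => t _.
  rewrite exchange_big /=; apply: eq_bigr => s _.
  rewrite Aa subSS /step_op mulr_suml; apply: eq_bigr => p _; exact: mulrA.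
rewrite big_ord_recl [X in _ = (_ + X)%R]big1 ?addr0 => [|t _]; last first.
  by rewrite big1 // => s _ /=; rewrite (negbTE nAa) mul0r.
rewrite (bigD1_seq a) //= eqxx mul1r big1 ?addr0 ?subn0 // => s /negbTE sa.
by rewrite eq_sym sa mul0r.
Qed.

Section Norm.
Variables (xs : seq (C * G)) (rho : R).
Hypothesis rho_ge0 : (0 <= rho)%R.
Hypothesis step_bound : forall f B, l2le f B -> l2le (step_op xs f) (rho * B)%R.

Lemma l2le_iter_step m f B : l2le f B -> l2le (iter m (step_op xs) f) (rho ^+ m * B)%R.
Proof.
move=> hf; elim: m => [|m IH] /=; first by rewrite expr0 mul1r.
by rewrite exprS -mulrA; apply: step_bound.
Qed.

Lemma l2le_hit A t s : l2le (hit_kernel xs A t s) (rho ^+ t)%R.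
Proof.
elim: t => [|t IH]; first exact: l2le_delta.
by rewrite exprS; apply: l2le_restrict (step_bound IH).
Qed.

Lemma normc_free_kernel m b a : (normc (free_kernel xs m b a) <= rho ^+ m)%R.
Proof.
have [h0 h] := l2le_iter_step m (l2le_delta R b).
have := h [:: a] isT; rewrite big_seq1 mulr1 -free_kernelE.
by rewrite ler_pXn2r ?nnegrE ?normc_ge0 // exprn_ge0.
Qed.
End Norm.
End Kernels.

Local Close Scope ring_scope.

(** * Reduced words, cones and powers in the free group *)

Section Words.
Variable r : nat.
Implicit Types (l : letter r) (u v w : seq (letter r)) (g h : free_group r).

Lemma reduced_cat l0 u v : reduced (u ++ v) =
  [&& reduced u, reduced v & [|| u == [::], v == [::] | head l0 v != letter_inv (last l0 u)]].
Proof.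
case: u => [|a u]; first by rewrite /= andbT.
case: v => [|b v]; first by rewrite cats0 /= !andbT.
by rewrite /reduced /= cat_path /=; case: (path _ a u); rewrite //= andbC.
Qed.

Lemma word_mul_cat u v : reduced (u ++ v) -> word_mul u v = u ++ v.
Proof.
elim: u => //= a u IH rauv; rewrite IH ?(reduced_behead rauv) //.
exact: letter_cons_path.
Qed.

Lemma word_mul_cancel u v : reduced u -> reduced v ->
  exists k, [/\ (k <= size u)%N, (k <= size v)%N &
    word_mul u v = take (size u - k) u ++ drop k v].
Proof.
elim: u => [|a u IH] ru rv; first by exists 0; rewrite drop0.
have [k [ku kv e] ] := IH (reduced_behead ru) rv; rewrite /= e.
move: ku; rewrite leq_eqVlt => /predU1P[kE|ku].
  rewrite kE subnn take0 /= in kv *; case dE : (drop (size u) v) => [|b v'].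
    by exists (size u); rewrite subSnn /= take0 dE.
  rewrite /letter_cons; case: eqP => [_|_].
    exists (size u).+1; have -> : drop (size u).+1 v = v' by rewrite -add1n -drop_drop dE /= drop0.
    rewrite subnn; split=> //.
    by rewrite ltnNge; apply/negP => vu; rewrite drop_oversize in dE.
  by exists (size u); rewrite subSnn /= take0 dE.
exists k; rewrite (subSn (ltnW ku)); split=> //; first exact: leqW (ltnW ku).
case: u ru ku {IH e} => [//|b u] ru ku.
have [j jE] : exists j, (size (b :: u) - k = j.+1)%N by exists (size (b :: u) - k).-1; lia.
rewrite jE /=.
by move: ru; rewrite /reduced /= => /andP[/negbTE ->].
Qed.

Definition cone l g : bool := if word g is a :: _ then a == l else false.

Lemma wordM g h : word (g * h)%g = word_mul (word g) (word h). Proof. by []. Qed.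
Lemma wordV g : word (g^-1)%g = word_inv (word g). Proof. by []. Qed.
Lemma size_wordV g : size (word (g^-1)%g) = size (word g).
Proof. by rewrite wordV /word_inv size_rev size_map. Qed.

Lemma cone_mul l h g : cone l h -> (size (word g) < size (word h))%N -> cone l (h * g)%g.
Proof.
rewrite /cone wordM => + gh; have [k [kh kg ->] ] := word_mul_cancel (word_reduced h) (word_reduced g).
have : (0 < size (word h) - k)%N by lia.
by case: (word h) (size _ - k)%N => [//|a s] [|m] //=.
Qed.

(** If $hg$ were longer than $g$, multiplying back by $g^{-1}$ could not erase its first letter, and
    $h$ would already lie in the cone. Hence bounded steps enter a cone through a finite set. *)
Lemma cone_boundary l h g : ~~ cone l h -> cone l (h * g)%g -> (size (word (h * g)%g) <= size (word g))%N.
Proof.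
move=> nh hg; rewrite leqNgt; apply: contra nh => lt.
by rewrite -(mulgK g h); apply: cone_mul; rewrite ?size_wordV.
Qed.

Lemma size_wordM g h : (size (word (g * h)%g) <= size (word g) + size (word h))%N.
Proof.
rewrite wordM; have [k [kh kg ->] ] := word_mul_cancel (word_reduced g) (word_reduced h).
by rewrite size_cat size_take size_drop; case: ifP; lia.
Qed.

Fixpoint words_upto n : seq (seq (letter r)) :=
  if n is n'.+1 then [::] :: [seq l :: w | l <- enum {: 'I_r * bool}, w <- words_upto n'] else [:: [::] ].

Lemma mem_words_upto n w : (size w <= n)%N -> w \in words_upto n.
Proof.
elim: n w => [|n IH] [|l w] //= wn; rewrite ?inE ?eqxx //.
by apply/allpairsP; exists (l, w); rewrite mem_enum; split=> //; exact: IH.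
Qed.

Definition word_ball n : seq (free_group r) := pmap insub (undup (words_upto n)).

Lemma word_ball_uniq n : uniq (word_ball n).
Proof. exact: pmap_sub_uniq (undup_uniq _). Qed.

Lemma mem_word_ball n g : (size (word g) <= n)%N -> g \in word_ball n.
Proof. by move=> gn; rewrite mem_pmap_sub mem_undup mem_words_upto. Qed.

Lemma size_mem_word_ball n g : g \in word_ball n -> (size (word g) <= n)%N.
Proof.
rewrite mem_pmap_sub mem_undup -[\val g]/(word g); elim: n (word g) => [|n IH] w /=.
  by rewrite inE => /eqP ->.
rewrite inE => /predU1P[->//|/allpairsP[ [l' w'] [_ /= hw ->] ] ] /=; exact: IH.
Qed.

Lemma nth_flatten_nseq (T : Type) (x0 : T) D s i : (i < D * size s)%N ->
  nth x0 (flatten (nseq D s)) i = nth x0 s (i %% size s).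
Proof.
elim: D i => [|D IH] i //=; rewrite mulSn nth_cat => iD.
case: ltnP => si; first by rewrite modn_small.
rewrite IH; last by lia.
by rewrite -[in RHS](subnK si) modnDr.
Qed.

Lemma size_flatten_nseq (T : Type) D (s : seq T) : size (flatten (nseq D s)) = (D * size s)%N.
Proof. by rewrite size_flatten /shape map_nseq sumn_nseq mulnC. Qed.

Lemma lolli_cat l0 w a b D : (a < b)%N -> (0 < D)%N -> (b <= size w)%N ->
  lolli (size w) (nth l0 w) a b D =
  (w == take a w ++ flatten (nseq D (drop a (take b w))) ++ word_inv (take a w)).
Proof.
move=> ab D0 bw; set u := take a w; set c := drop a (take b w).
have su : size u = a by rewrite size_take; case: ltnP => //; lia.
have sc : size c = (b - a)%N by rewrite size_drop size_take; case: ltnP => //; lia.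
have nu i : (i < a)%N -> nth l0 u i = nth l0 w i by move=> ia; rewrite nth_take.
have nc i : (i < b - a)%N -> nth l0 c i = nth l0 w (a + i).
  by move=> ic; rewrite nth_drop nth_take //; lia.
have sv : size (word_inv u) = a by rewrite /word_inv size_rev size_map.
have nv i : (i < a)%N -> nth l0 (word_inv u) i = letter_inv (nth l0 w (a.-1 - i)).
  move=> ia; rewrite /word_inv nth_rev ?size_map ?su // (nth_map l0) ?su; last by lia.
  by rewrite nu; [congr (letter_inv (nth _ _ _)); lia | lia].
have c0 : (0 < b - a)%N by lia.
pose w' := u ++ flatten (nseq D c) ++ word_inv u.
have sw' : size w' = (a + D * (b - a) + a)%N.
  by rewrite !size_cat su sv size_flatten_nseq sc addnA.
have nw1 i : (i < a)%N -> nth l0 w' i = nth l0 w i.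
  by move=> ia; rewrite nth_cat su ia nu.
set T := (a + D * (b - a))%N in sw' *.
have nw2 i : (a <= i < T)%N -> nth l0 w' i = nth l0 w (a + (i - a) %% (b - a)).
  move=> hi; rewrite nth_cat su ltnNge (_ : (a <= i)%N) /=; last by lia.
  rewrite nth_cat size_flatten_nseq sc (_ : (i - a < D * (b - a))%N); last by lia.
  by rewrite nth_flatten_nseq ?sc; [rewrite nc // ltn_mod | lia].
have nw3 i : (T <= i < T + a)%N -> nth l0 w' i = letter_inv (nth l0 w ((T + a).-1 - i)).
  move=> hi; rewrite nth_cat su ltnNge (_ : (a <= i)%N) /=; last by lia.
  rewrite nth_cat size_flatten_nseq sc ltnNge (_ : (D * (b - a) <= i - a)%N) /=; last by lia.
  by rewrite nv; [congr (letter_inv (nth _ _ _)); lia | lia].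
apply/idP/eqP => [/and5P[_ _ /eqP mE /allP f1 /allP f2]|wE].
  apply: (@eq_from_nth _ l0); first by rewrite mE sw'.
  move=> i iw; case: (ltnP i a) => ia; first by rewrite nw1.
  case: (ltnP i T) => iT.
    by rewrite nw2 ?ia //; apply/eqP/f1; rewrite mem_iota ia.
  rewrite nw3; last by rewrite iT -mE.
  by rewrite -mE; apply/eqP/f2; rewrite mem_iota iT -mE.
have mE : size w = (T + a)%N by rewrite -sw' /w' -wE.
have nE i : nth l0 w i = nth l0 w' i by rewrite /w' -wE.
apply/and5P; split=> //; first exact/eqP.
  by apply/allP => i; rewrite mem_iota => hi; apply/eqP; rewrite nE nw2.
by apply/allP => i; rewrite mem_iota => hi; apply/eqP; rewrite nE nw3 ?mE.
Qed.

Lemma wordM_cat g h : reduced (word g ++ word h) -> word (g * h)%g = word g ++ word h.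
Proof. exact: word_mul_cat. Qed.

Section Root.
Variables (l0 : letter r) (c : free_group r).
Local Notation c1 := (head l0 (word c)).
Local Notation c2 := (last l0 (word c)).
Hypotheses (c_gt0 : (0 < size (word c))%N) (c_cyc : c1 != letter_inv c2).

Lemma word_power_cat k v : reduced v -> (v == [::]) || (head l0 v != letter_inv c2) ->
  reduced (flatten (nseq k (word c)) ++ v) /\
  ((0 < k)%N -> head l0 (flatten (nseq k (word c)) ++ v) = c1).
Proof.
have cn : word c != [::] by case: (word c) c_gt0.
move=> rv hv; elim: k => [//|k [IH1 IH2] ]; split=> [|_] /=; last first.
  by rewrite -catA; case: (word c) c_gt0.
rewrite -catA (reduced_cat l0) word_reduced IH1 (negbTE cn) /=.
case: (posnP k) => [k0|kp]; first by rewrite k0 /=.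
by rewrite IH2 // c_cyc orbT.
Qed.

Lemma word_power k : word (c ^+ k)%g = flatten (nseq k (word c)).
Proof.
elim: k => // k IH; rewrite expgS wordM_cat IH //.
by have [h _] := @word_power_cat k.+1 [::] isT isT; rewrite cats0 in h.
Qed.

Lemma word_powerM k h : (word h == [::]) || (head l0 (word h) != letter_inv c2) ->
  word (c ^+ k * h)%g = flatten (nseq k (word c)) ++ word h.
Proof.
move=> hh; rewrite wordM_cat word_power //.
by have [] := word_power_cat k (word_reduced h) hh.
Qed.
End Root.
End Words.

(** * The words $u c^D u^{-1}$ and their total weight *)

Section LollipopSums.
Variables (r : nat) (l0 : letter r) (a b D : nat).
Hypotheses (ab : (a < b)%N) (D_gt1 : (1 < D)%N).
Implicit Types (u c g : free_group r).
Local Notation first g := (head l0 (word g)).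
Local Notation final g := (last l0 (word g)).

Definition lolli_word (w : seq (letter r)) : bool := lolli (size w) (nth l0 w) a b D.

Definition ok_root c := (size (word c) == b - a)%N && (first c != letter_inv (final c)).
(** The condition involves the root only through its end letters, so that [u] and [c] range
    independently once these letters are fixed. *)
Definition ok_tail (c1 c2 : letter r) u := (size (word u) == a) &&
  ((word u == [::]) || (final u != letter_inv c1) && (final u != c2)).
Definition ok_pair u c := ok_root c && ok_tail (first c) (final c) u.

Lemma head_word_inv u : word u != [::] -> head l0 (word_inv (word u)) = letter_inv (final u).
Proof.
by case/lastP: (word u) => // s x _; rewrite /word_inv map_rcons rev_rcons last_rcons.
Qed.

Lemma ok_pair_root c : ok_root c -> (0 < size (word c))%N /\ first c != letter_inv (final c).
Proof. by move=> /andP[/eqP-> h]; split=> //; rewrite subn_gt0. Qed.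

Lemma ok_tail_inv c u : ok_tail (first c) (final c) u ->
  (word (u^-1)%g == [::]) || (head l0 (word (u^-1)%g) != letter_inv (final c)).
Proof.
move=> /andP[_ h]; rewrite wordV; case: (boolP (word u == [::])) h => [/eqP->//|u0] /= /andP[_ h].
by rewrite head_word_inv // (inj_eq (can_inj (@letter_invK r))) h orbT.
Qed.

Lemma word_ok_pair u c : ok_pair u c ->
  word (u * (c ^+ D * u^-1))%g = word u ++ flatten (nseq D (word c)) ++ word_inv (word u).
Proof.
move=> /andP[hc hu]; have [c0 cc] := ok_pair_root hc; have hi := ok_tail_inv hu.
have wp := word_powerM c0 cc D hi; rewrite wordV in wp.
rewrite wordM_cat wp //.
have [h1 h2] := word_power_cat c0 cc D (word_reduced (u^-1)%g) hi.
rewrite wordV in h1 h2.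
rewrite (reduced_cat l0) word_reduced h1 /= h2; last by lia.
move/andP: hu => [_]; case: (boolP (word u == [::])) => //= u0 /andP[h _].
apply/orP; right; apply: contraNneq h => ->; by rewrite letter_invK.
Qed.

(** At most one pair contributes: no letter cancels in the product, so $u$ is the prefix of length
    $a$ of [g] and $c$ the block that follows. *)
Lemma lolli_word_sum Q g : (size (word g) <= Q)%N ->
  (lolli_word (word g) : nat) =
  (\sum_(u <- word_ball r Q) \sum_(c <- word_ball r Q | ok_pair u c) (g == u * (c ^+ D * u^-1))%g)%N.
Proof.
move=> gQ.
have ru : reduced (take a (word g)) by exact: take_sorted (word_reduced g).
have rc : reduced (drop a (take b (word g))).
  by apply: drop_sorted; apply: take_sorted; exact: word_reduced.
pose u0 := FreeGroup ru; pose c0 := FreeGroup rc.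
have E u c : ok_pair u c -> (g == u * (c ^+ D * u^-1))%g ->
    [/\ u = u0, c = c0 & lolli_word (word g)].
  move=> ok /eqP ge; have := word_ok_pair ok; rewrite -ge => wE.
  move/andP: (ok) => [/andP[/eqP sc _] /andP[/eqP su _] ].
  have tE : take a (word g) = word u by rewrite wE -su take_size_cat.
  have sw : (b <= size (word g))%N.
    rewrite wE size_cat size_cat size_flatten_nseq su sc; case: (D) D_gt1 => // k _; rewrite mulSn; lia.
  have dE : drop a (take b (word g)) = word c.
    rewrite wE take_cat su ltnNge (ltnW ab) /= drop_cat su ltnn subnn drop0.
    by case: (D) D_gt1 => // k _; rewrite /= -catA -sc take_size_cat.
  split; [exact/val_inj | exact/val_inj |].
  rewrite /lolli_word lolli_cat //; last by lia.
  by rewrite tE dE -wE.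
have [lg|nlg] := boolP (lolli_word (word g)); last first.
  rewrite big1 // => u _; rewrite big1 // => c ok; case: (boolP (g == _)) => // h.
  by have [_ _] := E _ _ ok h; rewrite (negbTE nlg).
have D0 : (0 < D)%N by lia.
have bw : (b <= size (word g))%N.
  case/and5P: lg => _ _ /eqP -> _ _; case: (D) D_gt1 => // k _; rewrite mulSn; lia.
have su : size (word u0) = a by rewrite /= size_take; case: ltnP => //; lia.
have sc : size (word c0) = (b - a)%N by rewrite /= size_drop size_take; case: ltnP => //; lia.
have wE : word g = word u0 ++ flatten (nseq D (word c0)) ++ word_inv (word u0).
  by move: lg; rewrite /lolli_word lolli_cat // => /eqP.
have cn : word c0 != [::] by rewrite -size_eq0 sc; lia.
have ok : ok_pair u0 c0.
  have := word_reduced g; rewrite wE.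
  (* Exposing two copies of $c$ shows the junction $cc$, which makes $c$ cyclically reduced; moving
     the remaining copies in front of one copy ([zE2]) shows the junction $c u^{-1}$. *)
  have -> : flatten (nseq D (word c0)) = word c0 ++ word c0 ++ flatten (nseq D.-2 (word c0)).
    by case: (D) D_gt1 => [|[|k] ].
  set z := flatten (nseq D.-2 _).
  have zE2 : word c0 ++ z = z ++ word c0.
    by rewrite -[LHS]/(flatten (nseq D.-2.+1 (word c0))) -addn1 nseqD flatten_cat /= cats0.
  rewrite (reduced_cat l0) -!catA => /and3P[_ h1 h2].
  have hd x : head l0 (word c0 ++ x) = first c0 by case: (word c0) cn.
  have cx x : (word c0 ++ x == [::]) = false by case: (word c0) cn.
  move: (h1); rewrite (reduced_cat l0) => /and3P[_ h3 h4].
  rewrite hd cx (negbTE cn) /= in h4.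
  have h5 : reduced (word c0 ++ word_inv (word u0)).
    by move: h3; rewrite catA zE2 -catA (reduced_cat l0) => /and3P[].
  rewrite /ok_pair /ok_root /ok_tail sc su !eqxx h4 /=.
  case: (boolP (word u0 == [::])) => //= un.
  rewrite cx (negbTE un) hd /= in h2.
  apply/andP; split.
    by apply: contraNneq h2 => h; rewrite h letter_invK.
  move: h5; rewrite (reduced_cat l0) (negbTE cn) /= => /and3P[_ _].
  have vn : (word_inv (word u0) == [::]) = false by rewrite -size_eq0 /word_inv size_rev size_map size_eq0; apply/negbTE.
  by rewrite [_ == [::] ]vn orFb (head_word_inv (u := u0) un) (inj_eq (can_inj (@letter_invK r))).
have ge : (g == u0 * (c0 ^+ D * u0^-1))%g.
  by apply/eqP/val_inj; transitivity (word (u0 * (c0 ^+ D * u0^-1))%g); [rewrite word_ok_pair | ].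
have ub : u0 \in word_ball r Q by apply: mem_word_ball; rewrite su; lia.
have cb : c0 \in word_ball r Q by apply: mem_word_ball; rewrite sc; lia.
rewrite (bigD1_seq u0) ?word_ball_uniq //= big_mkcond (bigD1_seq c0) ?word_ball_uniq //= ok ge.
rewrite big1 => [|c cc0]; last first.
  case: ifP => // ok'; case: (boolP (g == _)) => // h.
  by have [_ e _] := E _ _ ok' h; rewrite e eqxx in cc0.
rewrite big1 ?addn0 // => u uu0; rewrite big1 // => c ok'; case: (boolP (g == _)) => // h.
by have [e _ _] := E _ _ ok' h; rewrite e eqxx in uu0.
Qed.
End LollipopSums.

Local Open Scope ring_scope.

Section LollipopBound.
Variables (R : realType) (r : nat) (l0 : letter r) (xs : seq (R[i] * free_group r)) (rho : R) (L : nat).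
Hypotheses (rho_ge0 : 0 <= rho) (xs_le : forall p, p \in xs -> (size (word p.2) <= L)%N).
Hypothesis step_bound : forall f B, l2le f B -> l2le (step_op xs f) (rho * B).
Variables (a b D : nat).
Hypotheses (ab : (a < b)%N) (D_gt1 : (1 < D)%N).

Lemma size_group_pow m p : p \in group_pow xs m -> (size (word p.2) <= m * L)%N.
Proof.
elim: m p => [|m IH] p /=; first by rewrite inE => /eqP ->.
case/allpairsP => -[q q'] [/= hq hq' ->]; rewrite (leq_trans (size_wordM _ _)) // mulSn.
by rewrite leq_add ?xs_le ?IH.
Qed.

Let cone_ball (l : letter r) := [seq s <- word_ball r L | cone l s].

(* Two first-entrance cuts at the cone of the words starting with c1 separate c
   from u. The sum over u is then an iterate of step_op, and the sum over c is
   the inner product of two l2 functions along translates. *)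
Lemma sum_root_class (Us Cs : seq (free_group r)) (c1 c2 : letter r) P :
  uniq Us -> uniq Cs ->
  (forall u, u \in Us -> ok_tail l0 a c1 c2 u) ->
  (forall c, c \in Cs -> [/\ ok_root l0 a b c, head l0 (word c) = c1 & last l0 (word c) = c2]) ->
  normc (\sum_(c <- Cs) \sum_(u <- Us) free_kernel xs P (u * (c ^+ D * u^-1))%g 1%g) <=
  (P.+1 * P.+1 * size (word_ball r L) * size (word_ball r L))%:R * rho ^+ P.
Proof.
move=> uU uC hU hC; set S := cone_ball c1; set A := fun g => ~~ cone c1 g.
have uS : uniq S by rewrite filter_uniq // word_ball_uniq.
have SA s : s \in S -> ~~ A s by rewrite mem_filter negbK => /andP[].
have sS s : s \in S -> (size (word s) <= L)%N.
  by rewrite mem_filter => /andP[_ /size_mem_word_ball].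
have inS h g : ~~ cone c1 h -> (size (word g) <= L)%N -> A (h * g)%g || ((h * g)%g \in S).
  move=> nh gL; rewrite /A; case: (boolP (cone c1 _)) => //= ch.
  by rewrite mem_filter ch mem_word_ball // (leq_trans (cone_boundary nh ch)).
have bdry h p : A h -> p \in xs -> ~~ A (h * p.2)%g -> (h * p.2)%g \in S.
  by move=> Ah /xs_le pL nA; have := inS h p.2 Ah pL; rewrite (negbTE nA).
(* The word of $c^{-1}$ starts with the inverse of the last letter of $c$, which is not [c1]. With
   [inS] this lets the second cut start at $c^{-1}s$. *)
have rV c : c \in Cs -> ~~ cone c1 (c^-1)%g.
  move=> /hC[hc h1 h2]; have [c0 cc] := ok_pair_root ab hc.
  rewrite /cone wordV; have cn : word c != [::] by rewrite -size_eq0 -lt0n.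
  have := head_word_inv l0 cn; case: (word_inv _) => //= x s ->.
  by rewrite -h1 eq_sym.
have uV u : u \in Us -> ~~ cone c1 (u^-1)%g.
  move=> /hU/andP[_ hu]; rewrite /cone wordV; case: (boolP (word u == [::])) hu => [/eqP -> //|un] /= /andP[h _].
  have := head_word_inv l0 un; case: (word_inv _) => //= x s ->.
  by apply: contraNneq h => <-; rewrite letter_invK.
have rC c u k : c \in Cs -> u \in Us -> (0 < k)%N -> ~~ A (c ^+ k * u^-1)%g.
  move=> /hC[hc h1 h2] /hU hu k0; rewrite negbK /cone; have [c0 cc] := ok_pair_root ab hc.
  rewrite -h1 -h2 in hu; have hi := ok_tail_inv hu.
  rewrite (word_powerM c0 cc k hi); have [_ /(_ k0)] := word_power_cat c0 cc k (word_reduced _) hi.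
  rewrite h1; case: k k0 => // k _ /=; case: (word c) c0 => //= x s _ ->; exact: eqxx.
(* After translation by $u$ the path goes from $u^{-1}$ to $c^D u^{-1}$ and is cut at $s$.
   Translation by $c^{-1}$ makes the rest a path from $c^{-1}s$ to $c^{D-1}u^{-1}$, cut at $s'$;
   what remains is translated to run from $c^{-(D-1)}s'$ to $u^{-1}$. *)
have cut1 c u : c \in Cs -> u \in Us -> free_kernel xs P (u * (c ^+ D * u^-1))%g 1%g =
  \sum_(t < P.+1) \sum_(s <- S) \sum_(t' < (P - t).+1) \sum_(s' <- S)
    hit_kernel xs A t' s' (c^-1 * s)%g * (hit_kernel xs A t s (u^-1)%g *
       free_kernel xs (P - t - t') (u^-1)%g (c ^- D.-1 * s')%g).
  move=> hc hu; rewrite -[1%g](mulgV u) free_kernel_transl.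
  rewrite (first_entrance uS SA bdry (rC c u D hc hu (ltnW D_gt1))); last by rewrite /A uV.
  apply: eq_bigr => t _; rewrite big_seq [RHS]big_seq; apply: eq_bigr => s sIn.
  have -> : free_kernel xs (P - t) (c ^+ D * u^-1)%g s = free_kernel xs (P - t) (c ^+ D.-1 * u^-1)%g (c^-1 * s)%g.
    by rewrite -[RHS](free_kernel_transl _ _ c) mulVKg mulgA -expgS prednK // ltnW.
  have D1 : (0 < D.-1)%N by case: (D) D_gt1 => [|[|k] ].
  rewrite (first_entrance uS SA bdry (rC c u D.-1 hc hu D1)); last by apply: inS; [exact: rV | exact: sS].
  rewrite mulr_sumr; apply: eq_bigr => t' _; rewrite mulr_sumr; apply: eq_bigr => s' _.
  by rewrite mulrCA; congr (_ * (_ * _)); rewrite -[RHS](free_kernel_transl _ _ (c ^+ D.-1)%g) mulVKg.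
(* The factors containing $u$ are the hitting weight at $u^{-1}$ and the free kernel towards
   $u^{-1}$. Summed over $u$ they form an iterate of [step_op] on the truncated hitting kernel. *)
pose V t s := fun h => if h \in map (fun u => u^-1)%g Us then hit_kernel xs A t s h else 0.
have VE t s m h : \sum_(u <- Us) hit_kernel xs A t s (u^-1)%g * free_kernel xs m (u^-1)%g h =
    iter m (step_op xs) (V t s) h.
  rewrite (eq_bigr (fun u => iter m (step_op xs) (fun h => hit_kernel xs A t s (u^-1)%g * (h == u^-1)%g%:R) h)).
    rewrite -iter_step_sum; elim: m h => [|m IH] h /=; last by apply: eq_step_op.
    rewrite /V -(big_map (fun u => u^-1)%g xpredT (fun v => hit_kernel xs A t s v * (h == v)%:R)).
    have uV' : uniq (map (fun u => u^-1)%g Us) by rewrite map_inj_uniq //; exact: invg_inj.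
    case: ifP => hV; last first.
      rewrite big_seq big1 // => v vIn; case: eqP => [e|_]; last by rewrite mulr0.
      by rewrite e vIn in hV.
    rewrite (bigD1_seq h) //= eqxx mulr1 big1 ?addr0 // => v /negbTE vh.
    by rewrite eq_sym vh mulr0.
  by move=> u _; rewrite iter_step_scale free_kernelE.
have -> : \sum_(c <- Cs) \sum_(u <- Us) free_kernel xs P (u * (c ^+ D * u^-1))%g 1%g =
   \sum_(t < P.+1) \sum_(s <- S) \sum_(t' < (P - t).+1) \sum_(s' <- S) \sum_(c <- Cs)
     hit_kernel xs A t' s' (c^-1 * s)%g * iter (P - t - t') (step_op xs) (V t s) (c ^- D.-1 * s')%g.
  rewrite big_seq (eq_bigr (fun c => \sum_(t < P.+1) \sum_(s <- S) \sum_(t' < (P - t).+1) \sum_(s' <- S)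
     hit_kernel xs A t' s' (c^-1 * s)%g * iter (P - t - t') (step_op xs) (V t s) (c ^- D.-1 * s')%g)).
    rewrite -big_seq exchange_big; apply: eq_bigr => t _.
    rewrite exchange_big; apply: eq_bigr => s _.
    rewrite exchange_big; apply: eq_bigr => t' _.
    by rewrite exchange_big.
  move=> c hc; rewrite big_seq (eq_bigr _ (fun u hu => cut1 c u hc hu)) -big_seq.
  rewrite exchange_big; apply: eq_bigr => t _.
  rewrite exchange_big; apply: eq_bigr => s _.
  rewrite exchange_big; apply: eq_bigr => t' _.
  rewrite exchange_big; apply: eq_bigr => s' _.
  by rewrite -mulr_sumr VE.
(* The word of $c^{D-1}$ is a plain concatenation of copies of $c$, and $D > 1$, so its first $b -
   a$ letters recover $c$. *)
have injp s' : {in Cs &, injective (fun c : free_group r => (c ^- D.-1 * s')%g)}.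
  move=> c c' hc hc' /mulIg/invg_inj e.
  have [h1 _ _] := hC _ hc; have [h1' _ _] := hC _ hc'.
  have [c0 cc] := ok_pair_root ab h1; have [c0' cc'] := ok_pair_root ab h1'.
  have := congr1 (@word r) e; rewrite (word_power c0 cc) (word_power c0' cc').
  move/andP: h1 => [/eqP h1 _]; move/andP: h1' => [/eqP h1' _].
  case: (D) D_gt1 => [|[|k] ] //= _ /(congr1 (take (b - a))).
  by rewrite -{1}h1 take_size_cat // -h1' take_size_cat // => ?; exact/val_inj.
(* The three stretches have total length $P$, so the exponents $t'$, $P - t - t'$ and $t$ of [rho]
   add up to $P$. *)
have term t s t' s' : (t' <= P - t)%N -> (t <= P)%N -> normc (\sum_(c <- Cs) hit_kernel xs A t' s' (c^-1 * s)%g *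
    iter (P - t - t') (step_op xs) (V t s) (c ^- D.-1 * s')%g) <= rho ^+ P.
  move=> ht' ht.
  have := @l2le_dot R _ _ Cs (fun c => c^-1 * s)%g (fun c => c ^- D.-1 * s')%g _ _ _ _ uC _ (injp s')
    (l2le_hit step_bound A t' s')
    (l2le_iter_step step_bound (P - t - t') (l2le_restrict _ (l2le_hit step_bound A t s))).
  rewrite -exprD -exprD (_ : t' + (P - t - t' + t) = P)%N; last by lia.
  by apply=> c c' _ _ /mulIg/invg_inj.
have Sb : (size S <= size (word_ball r L))%N by rewrite size_filter count_size.
have rP : 0 <= rho ^+ P by exact: exprn_ge0.
have csum (T : Type) (s : seq T) (x : R) : \sum_(i <- s) x = (size s)%:R * x.
  by rewrite big_const_seq count_predT iter_addr addr0 mulr_natl.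
have cord k (x : R) : \sum_(i < k) x = k%:R * x by rewrite sumr_const card_ord mulr_natl.
apply: (@le_trans _ _ (\sum_(t < P.+1) \sum_(s <- S) (P.+1 * size (word_ball r L))%:R * rho ^+ P)).
  apply: le_trans (normc_sum _ _ _) _; apply: ler_sum => t _.
  apply: le_trans (normc_sum _ _ _) _; apply: ler_sum => s _.
  apply: le_trans (normc_sum _ _ _) _.
  apply: (@le_trans _ _ (\sum_(t' < (P - t).+1) (size (word_ball r L))%:R * rho ^+ P)).
    apply: ler_sum => t' _; apply: le_trans (normc_sum _ _ _) _.
    apply: (@le_trans _ _ (\sum_(s' <- S) rho ^+ P)).
      by apply: ler_sum => s' _; apply: term; rewrite -ltnS.
    by rewrite csum ler_wpM2r // ler_nat.
  rewrite cord mulrA -natrM ler_wpM2r // ler_nat leq_mul2r ltnS leq_subr orbT //.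
rewrite cord csum !mulrA -!natrM ler_wpM2r // ler_nat.
by rewrite [leqRHS](_ : _ = P.+1 * size (word_ball r L) * (P.+1 * size (word_ball r L)))%N;
  [rewrite mulnA -!mulnA !leq_mul | lia].
Qed.

(** Roots are sorted by their first and last letters, which gives the squared number of letters as a
    factor; [sum_root_class] bounds each class. *)
Lemma lolli_sum_bound P :
  normc (\sum_(p <- group_pow xs P) p.1 * (lolli_word l0 a b D (word p.2))%:R) <=
  (#|{: 'I_r * bool}| ^ 2 * (P.+1 * P.+1 * size (word_ball r L) * size (word_ball r L)))%:R * rho ^+ P.
Proof.
set Q := (P * L)%N; set W := word_ball r Q.
have -> : \sum_(p <- group_pow xs P) p.1 * (lolli_word l0 a b D (word p.2))%:R =
   \sum_(c <- W) \sum_(u <- W | ok_pair l0 a b u c) free_kernel xs P (u * (c ^+ D * u^-1))%g 1%g.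
  rewrite big_seq (eq_bigr (fun p => \sum_(u <- W) \sum_(c <- W | ok_pair l0 a b u c)
      p.1 * (p.2 == u * (c ^+ D * u^-1))%g%:R)); last first.
    move=> p hp; rewrite (lolli_word_sum l0 ab D_gt1 (size_group_pow hp)) natr_sum mulr_sumr.
    by apply: eq_bigr => u _; rewrite natr_sum mulr_sumr.
  rewrite -big_seq exchange_big /= [RHS](exchange_big_dep xpredT) //=; apply: eq_bigr => u _.
  rewrite exchange_big /=; apply: eq_bigr => c _.
  exact: sum_group_pow_delta.
have -> : \sum_(c <- W) \sum_(u <- W | ok_pair l0 a b u c) free_kernel xs P (u * (c ^+ D * u^-1))%g 1%g =
  \sum_(e : ('I_r * bool) * ('I_r * bool))
    \sum_(c <- [seq c <- W | ok_root l0 a b c && ((head l0 (word c), last l0 (word c)) == e)])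
    \sum_(u <- [seq u <- W | ok_tail l0 a e.1 e.2 u]) free_kernel xs P (u * (c ^+ D * u^-1))%g 1%g.
  rewrite (bigID (fun c => ok_root l0 a b c)) /= addrC big1 ?add0r; last first.
    by move=> c /negbTE hc; rewrite big_pred0 // => u; rewrite /ok_pair hc.
  rewrite (partition_big (fun c => (head l0 (word c), last l0 (word c)) : ('I_r * bool) * ('I_r * bool)) xpredT) //=.
  apply: eq_bigr => e _; rewrite big_filter; apply: eq_bigr => c /andP[hc /eqP ce].
  by rewrite big_filter; apply: eq_bigl => u; rewrite /ok_pair hc -ce.
apply: le_trans (normc_sum _ _ _) _.
set B := (P.+1 * P.+1 * _ * _)%N.
apply: (@le_trans _ _ (\sum_(e : ('I_r * bool) * ('I_r * bool)) B%:R * rho ^+ P)).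
  apply: ler_sum => e _; apply: (@sum_root_class _ _ e.1 e.2); rewrite ?filter_uniq ?word_ball_uniq //.
    by move=> u; rewrite mem_filter => /andP[].
  by move=> c; rewrite mem_filter => /andP[/andP[hc /eqP <-] _].
by rewrite sumr_const card_prod -mulnn -[leLHS]mulr_natl mulrA -natrM.
Qed.
End LollipopBound.

(** * Expansion of the mean trace in 1/n *)

Section TracePoly.
Variables (R : realType) (r : nat).
Implicit Types (w : seq (letter r)) (t : seq nat).

(** Falling factorials in the variable $X = 1/n$, normalised by powers of $n$. *)
Definition fall (i j : nat) : {poly R} := \prod_(i <= k < j) (1 - k%:R *: 'X).

(** Common denominator for all words of length at most $q$, since a pattern then has at most $q$
    edges per generator. *)
Definition trace_den q : {poly R} := \prod_(g < r) fall 0 q.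

(** The numerator over [trace_den]; the order in $1/n$ is the number of edges minus the number of
    vertices. *)
Definition walk_poly q w t : {poly R} :=
  'X^(nedges w t - nvert 0 t) * fall 0 (nvert 0 t) *
  \prod_g fall (size (undup (gen_edges (walk_edges w t) g))) q.

Definition trace_poly q w : {poly R} :=
  \sum_(t <- rgs (size w).+1 0 | valid_walk true w t) walk_poly q w t.

Definition unicyclic_walks w : nat :=
  count (fun t => valid_walk true w t && (nvert 0 t == nedges w t)) (rgs (size w).+1 0).

Lemma size_fall i j : (size (fall i j) <= (j - i).+1)%N.
Proof.
rewrite /fall /index_iota; move: (j - i)%N => k; elim: k i => [|k IH] i.
  by rewrite big_nil size_poly1.
rewrite big_cons (leq_trans (size_polyMleq _ _)) //.
have h : (size (1 - i%:R *: 'X : {poly R})%R <= 2)%N.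
  rewrite (leq_trans (size_polyD _ _)) // geq_max size_poly1 size_polyN.
  by rewrite (leq_trans (size_scale_leq _ _)) ?size_polyX.
by rewrite -subn1 leq_subLR (leq_trans (leq_add h (IH _))) // addnC addn2.
Qed.

Lemma horner_fall i j x : (fall i j).[x] = \prod_(i <= k < j) (1 - k%:R * x).
Proof. by rewrite horner_prod; apply: eq_bigr => k _; rewrite !hornerE. Qed.

Lemma size_edges T w v (p : seq T) : (size (edges w v p) <= size w)%N.
Proof. by elim: w v p => [|l w IH] v [|v' p] //=; rewrite ltnS; exact: IH. Qed.

Lemma gen_nedges_le w t g : (size (undup (gen_edges (walk_edges w t) g)) <= size w)%N.
Proof.
rewrite (leq_trans (size_undup _)) // size_map size_filter (leq_trans (count_size _ _)) //.
by case: t => [|v p] //=; exact: size_edges.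
Qed.

Lemma size_prod_seq_leq (I : Type) (s : seq I) (F : I -> {poly R}) (c : I -> nat) :
  (forall i, (size (F i) <= (c i).+1)%N) ->
  (size (\prod_(i <- s) F i)%R <= (\sum_(i <- s) c i).+1)%N.
Proof.
move=> h; elim: s => [|i s IH]; first by rewrite !big_nil size_poly1.
rewrite !big_cons (leq_trans (size_polyMleq _ _)) //.
by rewrite -subn1 leq_subLR (leq_trans (leq_add (h i) IH)) // addSn addnS.
Qed.

(** With $E$ edges and $V$ vertices the three factors have degrees at most $E - V$, $V$ and $rq -
    E$. *)
Lemma size_walk_poly q w t : (size w <= q)%N -> (nvert 0 t <= nedges w t)%N ->
  (size (walk_poly q w t) <= (r * q).+1)%N.
Proof.
move=> wq VE.
have E : (nedges w t <= r * q)%N.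
  rewrite /nedges -sum_gen_edges -[r in (r * q)%N]card_ord -sum_nat_const leq_sum // => g _.
  by rewrite (leq_trans (gen_nedges_le _ _ _)).
have h : (size (\prod_g fall (size (undup (gen_edges (walk_edges w t) g))) q)%R
          <= (r * q - nedges w t).+1)%N.
  apply: leq_trans (size_prod_seq_leq _ (c := fun g => (q - size (undup (gen_edges (walk_edges w t) g)))%N) _) _.
    by move=> g; exact: size_fall.
  rewrite ltnS leq_subRL // /nedges -sum_gen_edges -big_split /=.
  rewrite (eq_bigr (fun=> q)) ?sum_nat_const ?card_ord // => g _.
  by rewrite subnKC // (leq_trans (gen_nedges_le _ _ _)).
have s1 := size_fall 0 (nvert 0 t).
rewrite /walk_poly (leq_trans (size_polyMleq _ _)) // -subn1 leq_subLR.
apply: leq_trans (leq_add (size_polyMleq _ _) h) _; rewrite size_polyXn.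
by lia.
Qed.

Lemma size_trace_poly q w (l0 : letter r) : reduced w -> (0 < size w)%N -> (size w <= q)%N ->
  (size (trace_poly q w) <= (r * q).+1)%N.
Proof.
move=> rw w0 wq; rewrite /trace_poly big_seq_cond.
apply: (big_ind (fun p : {poly R} => size p <= (r * q).+1)%N); first by rewrite size_poly0.
  by move=> p1 p2 h1 h2; rewrite (leq_trans (size_polyD _ _)) // geq_max h1.
move=> t /andP[tr tv]; apply: size_walk_poly => //.
exact: (nvert_le_nedges l0 rw w0 tr tv).
Qed.

(** At 0 each [fall] equals 1 and the power of ['X] keeps only the patterns with as many edges as
    vertices. *)
Lemma trace_poly0 q w (l0 : letter r) : reduced w -> (0 < size w)%N ->
  (trace_poly q w).[0] = (unicyclic_walks w)%:R.
Proof.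
move=> rw w0; rewrite /trace_poly horner_sum /unicyclic_walks.
have fall0 i j : (fall i j).[0] = 1 by rewrite horner_fall big1 // => k _; rewrite mulr0 subr0.
rewrite -sum1_count natr_sum big_seq_cond [RHS]big_seq_cond.
rewrite [RHS](eq_bigl (fun t => [&& t \in rgs (size w).+1 0, valid_walk true w t & nvert 0 t == nedges w t])); last first.
  by [].
rewrite [RHS](eq_bigl (fun t => ((t \in rgs (size w).+1 0) && valid_walk true w t) && (nvert 0 t == nedges w t))); last first.
  by move=> t; rewrite andbA.
rewrite [RHS]big_mkcondr; apply: eq_bigr => t /andP[tr tv].
have VE := nvert_le_nedges l0 rw w0 tr tv.
rewrite /walk_poly !hornerM fall0 horner_prod big1 ?mulr1 // hornerXn expr0n subn_eq0.
by rewrite eqn_leq VE /=; case: leqP.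
Qed.

Lemma prod_nat_forall (I : finType) (P : pred I) : (\prod_i (P i) = [forall i, P i])%N.
Proof.
case: (boolP [forall i, P i]) => [/forallP h|/forallPn[i /negbTE h] ].
  by rewrite big1 // => i _; rewrite h.
by rewrite (bigD1 i) //= h mul0n.
Qed.

Lemma invn_fall (n i j : nat) : (0 < n)%N ->
  \prod_(i <= k < j) (n%:R - k%:R) = n%:R ^+ (j - i) * (fall i j).[n%:R^-1] :> R.
Proof.
move=> n0; rewrite horner_fall -prodr_const_nat -big_split /=; apply: eq_bigr => k _.
by field; rewrite pnatr_eq0 -lt0n.
Qed.

Lemma fall_gt0 (n i j : nat) : (j <= n)%N -> 0 < (fall i j).[n%:R^-1].
Proof.
move=> jn; rewrite horner_fall big_seq; apply: prodr_gt0 => k; rewrite mem_index_iota => /andP[_ kj].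
have n0 : 0 < n%:R :> R by rewrite ltr0n; lia.
by rewrite subr_gt0 ltr_pdivrMr // mul1r ltr_nat; lia.
Qed.

(** The factors $n$ and ['X] cancel at $1/n$; they are displayed so that the normalised trace has
    the form [p * 'X] required by [poly_taylor1_invn]. *)
Lemma trace_polyE q w (l0 : letter r) (n : nat) : reduced w -> (0 < size w)%N -> (size w <= q)%N ->
  (q < n)%N ->
  \sum_(x : {ffun 'I_r -> SP n}) \tr (wmx R true x w) =
  (#|{: {ffun 'I_r -> SP n}}|)%:R * n%:R *
  ((trace_poly q w * 'X).[n%:R^-1] / (trace_den q).[n%:R^-1]).
Proof.
move=> rw w0 wq qn; have n0 : (0 < n)%N by lia.
have nR : n%:R != 0 :> R by rewrite pnatr_eq0 -lt0n.
rewrite sum_trace -!mulrA; congr (_ * _).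
rewrite hornerMX /trace_poly horner_sum !mulr_suml mulr_sumr [RHS]big_mkcond.
rewrite big_seq [RHS]big_seq; apply: eq_bigr => t tr.
have -> : walk_weight R n true w t = (valid_walk true w t)%:R *
   \prod_g \prod_(j < size (undup (gen_edges (walk_edges w t) g))) (n%:R - j%:R)^-1.
  move: (tr); rewrite mem_cat => _; rewrite /walk_weight /edge_weight /valid_walk.
  case: t tr => [|v p] tr; first by have [] := mem_rgsP _ _ _ tr.
  rewrite big_split /= -natr_prod -mulnb natrM -mulrA; congr (_ * (_%:R * _)).
  exact: prod_nat_forall.
case: ifP => tv; last by rewrite mul0r mulr0.
have VE := nvert_le_nedges l0 rw w0 tr tv.
rewrite mul1r invn_fall // subn0.
have -> : \prod_g \prod_(j < size (undup (gen_edges (walk_edges w t) g))) (n%:R - j%:R)^-1 =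
   (n%:R ^+ nedges w t)^-1 * \prod_g (fall 0 (size (undup (gen_edges (walk_edges w t) g)))).[n%:R^-1]^-1 :> R.
  rewrite /nedges -sum_gen_edges -prodrXr -prodfV -big_split /=; apply: eq_bigr => g _.
  by rewrite prodfV -(big_mkord xpredT (fun j => n%:R - j%:R)) invn_fall // subn0 invfM.
have -> : (trace_den q).[n%:R^-1] = \prod_g (fall 0 (size (undup (gen_edges (walk_edges w t) g)))).[n%:R^-1]
    * \prod_g (fall (size (undup (gen_edges (walk_edges w t) g))) q).[n%:R^-1].
  rewrite /trace_den horner_prod -big_split /=; apply: eq_bigr => g _.
  rewrite !horner_fall -big_cat_nat //=.
  by rewrite (leq_trans (gen_nedges_le _ _ _)).
rewrite /walk_poly !hornerM hornerXn.
set A := (fall 0 (nvert 0 t)).[_]; rewrite horner_prod prodfV; set B := \prod_g (fall 0 _).[_]; set C := \prod_g (fall _ q).[_].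
have B0 : B != 0.
  rewrite gt_eqF //; apply: prodr_gt0 => g _; apply: fall_gt0.
  by have := gen_nedges_le w t g; lia.
have C0 : C != 0 by rewrite gt_eqF //; apply: prodr_gt0 => g _; apply: fall_gt0; lia.
rewrite exprVn; have -> : nedges w t = ((nedges w t - nvert 0 t) + nvert 0 t)%N by rewrite subnK.
rewrite addnK exprD; field.
by rewrite B0 C0 nR !expf_neq0.
Qed.

(** The Weierstrass product inequality. *)
Lemma prod_ge_subsum (I : Type) (s : seq I) (x : I -> R) : (forall i, 0 <= x i <= 1) ->
  1 - \sum_(i <- s) x i <= \prod_(i <- s) (1 - x i) <= 1.
Proof.
move=> h; elim: s => [|i s /andP[h1 h2]]; first by rewrite !big_nil subr0 lexx.
rewrite !big_cons; have /andP[x0 x1] := h i; have s0 : 0 <= \sum_(j <- s) x j.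
  by apply: sumr_ge0 => j _; case/andP: (h j).
have p0 : 0 <= \prod_(j <- s) (1 - x j).
  by apply: prodr_ge0 => j _; rewrite subr_ge0; case/andP: (h j).
apply/andP; split; nra.
Qed.
End TracePoly.

Section MeanTrace.
Variables (R : realType) (r : nat).
Implicit Types (w : seq (letter r)).

Definition mean_trace sg n w : R :=
  (\sum_(x : Omega r n) \tr (wmx R sg x w)) / (#|{:Omega r n}|)%:R.

Lemma card_Omega_gt0 n : (0 < #|{:Omega r n}|)%N.
Proof. by apply/card_gt0P; exists [ffun=> (1%g, [ffun=> false])]. Qed.

Lemma mean_trace_nil sg n : mean_trace sg n [::] = n%:R.
Proof.
rewrite /mean_trace (eq_bigr (fun=> n%:R)) => [|x _]; last by rewrite /wmx /= mxtrace1.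
by rewrite sumr_const -[X in X / _]mulr_natr mulfK // pnatr_eq0 -lt0n card_Omega_gt0.
Qed.

(** There are $rq$ factors, each within $q/n$ of 1, and $r q^2/n \le 1/2$. *)
Lemma trace_den_bounds q (n : nat) : (0 < n)%N -> (2 * (r * q ^ 2) <= n)%N ->
  1 / 2 <= (trace_den R r q).[n%:R^-1] <= 1.
Proof.
move=> n0 rqn; have [/eqP r0|r0] := boolP (r == 0%N).
  by rewrite /trace_den big1 ?hornerE; [apply/andP; split; lra | case=> g; rewrite r0].
have [/eqP q0|q0] := boolP (q == 0%N).
  rewrite /trace_den big1 ?hornerE; first by apply/andP; split; lra.
  by move=> g _; rewrite /fall q0 big_geq.
have nR : 0 < n%:R :> R by rewrite ltr0n.
have qn : (q <= n)%N by apply: leq_trans rqn; rewrite -mulnn !mulnA; apply: leq_pmull; nia.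
pose x (p : 'I_r * 'I_q) : R := (p.2 : nat)%:R * n%:R^-1.
have -> : (trace_den R r q).[n%:R^-1] = \prod_(p <- enum {: 'I_r * 'I_q}) (1 - x p).
  rewrite big_enum -(pair_big xpredT xpredT (fun (g : 'I_r) (j : 'I_q) => 1 - j%:R * n%:R^-1)) /=.
  by rewrite /trace_den horner_prod; apply: eq_bigr => g _; rewrite horner_fall big_mkord.
have hx p : 0 <= x p <= 1.
  rewrite /x mulr_ge0 ?invr_ge0 ?ler0n //= ler_pdivrMr // mul1r ler_nat.
  by rewrite (leq_trans _ qn) // ltnW.
have /andP[h1 ->] := prod_ge_subsum (enum {: 'I_r * 'I_q}) hx; rewrite andbT.
apply: le_trans h1; rewrite big_enum /=.
suff : \sum_p x p <= 1 / 2 by lra.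
apply: (@le_trans _ _ (\sum_(p : 'I_r * 'I_q) (q%:R * n%:R^-1))).
  by apply: ler_sum => p _; rewrite /x ler_wpM2r ?invr_ge0 // ler_nat ltnW.
rewrite sumr_const card_prod !card_ord -[leLHS]mulr_natr mulrAC ler_pdivrMr //.
by rewrite -natrM mul1r ler_pdivlMl // -natrM ler_nat; move: rqn; rewrite -mulnn; lia.
Qed.

(** Empty words contribute the constant [tau]; for the others [p * 'X] at $1/n$ is the denominator
    times $\Psi(n) - \tau$, hence at most 2 in modulus. The denominator is at least $1/2$, which
    gives the outer factor 2. The degree bound $rq$ explains $(rq+2)^3$. *)
Lemma mean_trace_expansion (ks : seq (R * seq (letter r))) q N :
  (forall k, k \in ks -> reduced k.2 && (size k.2 <= q)%N) ->
  (8 * (r * q).+2 ^ 3 <= N)%N ->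
  let Psi n := \sum_(k <- ks) k.1 * (mean_trace true n k.2 / n%:R) in
  let tau := \sum_(k <- ks | k.2 == [::]) k.1 in
  let U := \sum_(k <- ks | k.2 != [::]) k.1 * (unicyclic_walks k.2)%:R in
  (forall n, (N <= n)%N -> `|Psi n| <= 1) -> `|tau| <= 1 ->
  forall n, (N <= n)%N ->
  `|Psi n| <= `|tau| + 2 * (`|U| / n%:R + (8 * (r * q).+2%:R ^+ 3 * N%:R) ^+ 2 * 2 / n%:R ^+ 2).
Proof.
move=> hk hN Psi tau U hPsi htau.
pose p : {poly R} := \sum_(k <- ks | k.2 != [::]) k.1 *: trace_poly R q k.2.
have N0 n : (N <= n)%N -> (0 < n)%N.
  by apply: leq_trans; apply: leq_trans hN; rewrite muln_gt0 expn_gt0.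
have hq n : (N <= n)%N -> (2 * (r * q ^ 2) <= n)%N.
  move=> Nn; apply: leq_trans Nn; apply: leq_trans hN.
  have h1 : (r * q ^ 2 <= (r * q) ^ 2)%N by rewrite expnMn leq_mul2r orbC -mulnn; case: (r) => // r'; rewrite leq_pmulr.
  have h2 : ((r * q) ^ 2 <= (r * q).+2 ^ 3)%N.
    by apply: (@leq_trans ((r * q).+2 ^ 2)); [rewrite leq_sqr; lia | rewrite leq_exp2l].
  by rewrite (leq_trans (leq_mul (leqnn 2) (leq_trans h1 h2))) // leq_mul2r orbT.
have l0P w : w != [::] -> exists l0 : letter r, (0 < size w)%N by case: w => // l w _; exists l.
(* The alternative $r = 0$ is the case without letters, where every word is empty and $N$ does not
   control $q$. *)
have pE n : (N <= n)%N -> (q < n)%N \/ r = 0%N -> (p * 'X).[n%:R^-1] = (trace_den R r q).[n%:R^-1] * (Psi n - tau).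
  move=> Nn qn; have n0 := N0 n Nn; have nR : n%:R != 0 :> R by rewrite pnatr_eq0 -lt0n.
  have /andP[g1 _] := trace_den_bounds n0 (hq n Nn).
  have g0 : (trace_den R r q).[n%:R^-1] != 0 by rewrite gt_eqF //; lra.
  rewrite /Psi (bigID (fun k => k.2 == [::])) /=.
  have -> : \sum_(k <- ks | k.2 == [::]) k.1 * (mean_trace true n k.2 / n%:R) = tau.
    by apply: eq_bigr => k /eqP ->; rewrite mean_trace_nil divff ?mulr1.
  rewrite addrC addrK hornerMX /p horner_sum mulr_suml mulr_sumr.
  rewrite big_seq_cond [RHS]big_seq_cond; apply: eq_bigr => k /andP[/hk/andP[kr kq] k0].
  have [l0 w0] := l0P _ k0.
  have qn' : (q < n)%N by case: qn => // r0; case: (l0) => [ [g hg] _]; rewrite r0 in hg.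
  rewrite /mean_trace (trace_polyE _ l0 kr w0 kq qn') hornerZ hornerMX.
  have O0 : (#|{:Omega r n}|)%:R != 0 :> R by rewrite pnatr_eq0 -lt0n card_Omega_gt0.
  by field; rewrite O0 nR g0.
have qnr n : (N <= n)%N -> (q < n)%N \/ r = 0%N.
  move=> Nn; have [/eqP|r0] := boolP (r == 0%N); [by right|left].
  apply: leq_trans Nn; apply: leq_trans hN.
  have h1 : (q <= r * q)%N by rewrite leq_pmull // lt0n.
  have h2 : ((r * q).+2 <= (r * q).+2 ^ 3)%N by rewrite -{1}(expn1 (r * q).+2) leq_exp2l.
  by lia.
have sp : (size p <= (r * q).+1)%N.
  rewrite /p big_seq_cond; apply: (big_ind (fun p : {poly R} => size p <= (r * q).+1)%N).
  - by rewrite size_poly0.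
  - by move=> p1 p2 h1 h2; rewrite (leq_trans (size_polyD _ _)) // geq_max h1.
  move=> k /andP[/hk/andP[kr kq] k0]; have [l0 w0] := l0P _ k0.
  by rewrite (leq_trans (size_scale_leq _ _)) // (size_trace_poly _ l0).
have p0 : p.[0] = U.
  rewrite /p horner_sum /U big_seq_cond [RHS]big_seq_cond; apply: eq_bigr => k /andP[/hk/andP[kr kq] k0].
  by have [l0 w0] := l0P _ k0; rewrite hornerZ (trace_poly0 _ _ l0).
have p2 n : (N <= n)%N -> `|(p * 'X).[n%:R^-1]| <= 2.
  move=> Nn; rewrite (pE n Nn (qnr n Nn)) normrM.
  have /andP[g1 g2] := trace_den_bounds (N0 n Nn) (hq n Nn).
  have h1 := hPsi n Nn; have h2 : `|Psi n - tau| <= 2 by rewrite (le_trans (ler_normB _ _)) //; lra.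
  rewrite ger0_norm; last by lra.
  by rewrite -[leRHS]mul1r ler_pM //; lra.
move=> n Nn; have := poly_taylor1_invn sp hN p2 Nn.
rewrite (pE n Nn (qnr n Nn)) p0 normrM.
have /andP[g1 g2] := trace_den_bounds (N0 n Nn) (hq n Nn).
rewrite ger0_norm; last by lra.
set B := _ / _ + _ => hB; have h0 := normr_ge0 (Psi n - tau).
have h2 : `|Psi n - tau| <= 2 * B by nra.
by rewrite -{1}[Psi n](subrK tau) addrC (le_trans (ler_normD _ _)) // lerD2l.
Qed.

(** A pattern with $V$ vertices and $E \ge V$ edges weighs at most $n^V (2/n)^E \le 2^E$, since each
    factor $1/(n-j)$ is at most $2/n$. *)
Lemma mean_trace_unsigned_le w (l0 : letter r) (n : nat) : reduced w -> (0 < size w)%N ->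
  (2 * size w <= n)%N ->
  mean_trace false n w <= (size (rgs (size w).+1 0) * 2 ^ size w)%:R.
Proof.
move=> rw w0 wn; have n0 : (0 < n)%N by lia.
have nR : 0 < n%:R :> R by rewrite ltr0n.
rewrite /mean_trace sum_trace mulrC mulrA mulVf ?mul1r; last first.
  by rewrite pnatr_eq0 -lt0n card_Omega_gt0.
apply: (@le_trans _ _ (\sum_(t <- rgs (size w).+1 0) (2 ^ size w)%:R)); last first.
  by rewrite big_const_seq count_predT iter_addr addr0 -mulrnA mulnC.
rewrite big_seq [leRHS]big_seq; apply: ler_sum => t tr.
have [tv|tv] := boolP (valid_walk false w t); last first.
  suff -> : walk_weight R n false w t = 0 by rewrite mulr0 ler0n.
  move: tv; rewrite /walk_weight /valid_walk; case: t tr => [//|v p] tr /=.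
  rewrite negb_and => /orP[/negbTE ->|]; first by rewrite mul0r.
  by move/forallPn => [g /negbTE h]; rewrite (bigD1 g) //= /edge_weight h mul0r mul0r mulr0.
have VE := nvert_le_nedges l0 rw w0 tr tv.
have E : (nedges w t <= size w)%N.
  rewrite /nedges (leq_trans (size_undup _)) //; case: (t) => [|v p] //; exact: size_edges.
have st : size t = (size w).+1 by have [] := mem_rgsP _ _ _ tr.
have h1 : `|\prod_(0 <= j < nvert 0 t) (n%:R - j%:R)| <= n%:R ^+ nvert 0 t :> R.
  rewrite normr_prod -[nvert 0 t in leRHS]subn0 -prodr_const_nat.
  rewrite big_nat [leRHS]big_nat; apply: ler_prod => j /andP[_ jV]; rewrite normr_ge0 /=.
  rewrite ger0_norm ?subr_ge0 ?ler_nat; last by lia.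
  by rewrite lerBlDr lerDl.
have h2 : `|walk_weight R n false w t| <= (2 / n%:R) ^+ nedges w t.
  rewrite /nedges -sum_gen_edges -prodrXr /walk_weight; case: t tr tv VE E st h1 => [|v p] // tr tv VE E st h1.
  rewrite normrM normr_prod -[leRHS]mul1r ler_pM ?normr_ge0 //.
    by apply: prodr_ge0 => g _.
    by case: (_ == _); rewrite ?normr1 ?normr0.
  apply: ler_prod => g _; rewrite normr_ge0 /= /edge_weight normrM -[leRHS]mul1r ler_pM //.
    by case: (_ && _); rewrite ?normr1 ?normr0.
  set k := size _; have kw : (k <= size w)%N := gen_nedges_le w (v :: p) g.
  rewrite normr_prod -[k in leRHS]card_ord -prodr_const; apply: ler_prod => j _.
  rewrite normr_ge0 /= normfV -[2 / _]invrK invf_div lef_pV2 ?posrE ?divr_gt0 //; last first.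
    by rewrite normr_gt0 subr_eq0 eqr_nat; have := ltn_ord j; lia.
  rewrite ger0_norm ?subr_ge0 ?ler_nat; last by have := ltn_ord j; lia.
  rewrite -natrB; last by have := ltn_ord j; lia.
  by rewrite ler_pdivrMr // -natrM ler_nat; have := ltn_ord j; lia.
apply: le_trans (ler_norm _) _; rewrite normrM.
apply: le_trans (ler_pM (normr_ge0 _) (normr_ge0 _) h1 h2) _.
rewrite expr_div_n mulrCA natrX.
apply: (@le_trans _ _ (2 ^+ nedges w t * 1)).
  rewrite ler_wpM2l ?exprn_ge0 // ler_pdivrMr ?exprn_gt0 // mul1r.
  by apply: ler_weXn2l => //; rewrite ler1n.
by rewrite mulr1 ler_weXn2l // ler1n.
Qed.

End MeanTrace.

(** * Spectra and operator norms *)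

Section Spectral.
Variables (R : realType) (n : nat).
Local Notation C := (R[i]).
Local Open Scope sesquilinear_scope.
Local Open Scope complex_scope.

Definition sqnorm (v : 'cV[C]_n) : R := \sum_i normc (v i 0) ^+ 2.

Lemma normc_sqrE (x : C) : (normc x ^+ 2)%:C = x^* * x.
Proof.
case: x => a b; rewrite /normc sqr_sqrtr ?addr_ge0 ?sqr_ge0 //.
by apply/eqP; rewrite eq_complex /=; apply/andP; split; apply/eqP; ring.
Qed.

Lemma adj_mul_diag m (B : 'M[C]_(n, m)) i :
  (B^t* *m B) i i = (\sum_k normc (B k i) ^+ 2)%:C.
Proof.
by rewrite mxE rmorph_sum; apply: eq_bigr => k _; rewrite /= normc_sqrE !mxE.
Qed.

Lemma adj_mul m1 m2 m3 (B : 'M[C]_(m1, m2)) (B' : 'M[C]_(m2, m3)) : (B *m B')^t* = B'^t* *m B^t*.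
Proof. by rewrite trmx_mul map_mxM. Qed.

(** [lam] lists the eigenvalues of the Gram matrix of [A], each written as the squared length of the
    image of a unit eigenvector; this makes them real and bounded by any norm estimate for [A]. *)
Lemma gram_spectrum (A : 'M[C]_n) : exists lam : 'I_n -> R,
  [/\ forall j, \tr ((A^t* *m A) ^+ j) = (\sum_i lam i ^+ j)%:C,
      forall i, exists2 u : 'cV[C]_n, sqnorm u = 1 & sqnorm (A *m u) = lam i
    & forall M v, (forall i, lam i <= M) -> sqnorm (A *m v) <= M * sqnorm v].
Proof.
set X := A^t* *m A; have Xn : X \is normalmx.
  by apply/normalmxP; rewrite /X adj_mul trmxCK.
have XE : X = invmx (spectralmx X) *m diag_mx (spectral_diag X) *m spectralmx X.
  exact/orthomx_spectralP.
set P := spectralmx X in XE.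
set d := spectral_diag X in XE; have Pu : P \is unitarymx := spectral_unitarymx X.
rewrite invmx_unitary // in XE.
have PP : P *m P^t* = 1%:M by apply/unitarymxP.
have PP' : P^t* *m P = 1%:M by exact: mulmx1C.
pose lam i : R := \sum_k normc ((A *m P^t*) k i) ^+ 2.
have dE i : d 0 i = (lam i)%:C.
  rewrite -adj_mul_diag adj_mul trmxCK -mulmxA (mulmxA (A^t*)) -/X XE.
  rewrite !mulmxA PP mul1mx -mulmxA PP mulmx1 mxE eqxx mulr1n //.
have XjE j : X ^+ j = P^t* *m diag_mx (\row_i (lam i ^+ j)%:C) *m P.
  elim: j => [|j IH].
    rewrite expr0 (_ : diag_mx _ = 1%:M) ?mulmx1 ?PP' //.
    by apply/matrixP => i k; rewrite !mxE expr0.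
  rewrite exprS IH -[_ * _]/(X *m _) {1}XE !mulmxA -(mulmxA _ P) PP mulmx1 -(mulmxA _ (diag_mx d)).
  congr (_ *m _ *m _); apply/matrixP => i k; rewrite mul_diag_mx !mxE dE.
  by case: eqP => [->|_]; rewrite ?mulr0n ?mulr0 // !mulr1n -rmorphM exprS.
exists lam; split.
- move=> j; rewrite XjE mxtrace_mulC mulmxA PP mul1mx mxtrace_diag rmorph_sum.
  by apply: eq_bigr => i _; rewrite mxE.
- move=> i; exists (col i (P^t*)).
    have : (P *m P^t*) i i = 1 by rewrite PP mxE eqxx.
    rewrite -{1}(trmxCK P) adj_mul_diag => /complexI <-.
    by apply: eq_bigr => k _; rewrite !mxE.
  apply: eq_bigr => k _; congr (normc _ ^+ 2); rewrite !mxE.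
  by apply: eq_bigr => q _; rewrite !mxE.
move=> M v hM.
have sqE (B : 'cV[C]_n) : (sqnorm B)%:C = (B^t* *m B) 0 0 by rewrite adj_mul_diag.
have vE : sqnorm v = sqnorm (P *m v).
  by apply: complexI; rewrite !sqE adj_mul mulmxA -(mulmxA _ _ P) PP' mulmx1.
have -> : sqnorm (A *m v) = \sum_i lam i * normc ((P *m v) i 0) ^+ 2.
  apply: complexI; rewrite sqE adj_mul mulmxA -(mulmxA _ _ A) -/X XE.
  rewrite !mulmxA -adj_mul -!mulmxA mxE rmorph_sum.
  apply: eq_bigr => k _; rewrite mul_diag_mx !mxE dE rmorphM /= normc_sqrE mulrCA.
  by [].
rewrite vE /sqnorm mulr_sumr; apply: ler_sum => i _.
by rewrite ler_wpM2r ?sqr_ge0.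
Qed.
End Spectral.

Local Open Scope classical_set_scope.
Local Open Scope ring_scope.

Section OperatorNorm.
Variable R : realType.
Local Notation C := (R[i]).

Lemma l2norm_leP (I : choiceType) (f : I -> C) (B : R) : 0 <= B ->
  (l2norm (f : I -> R[i]^o) <= B%:E)%E <-> l2le f B.
Proof.
move=> B0; have -> : B%:E = sqrte (B ^+ 2)%:E :> \bar R by rewrite /= sqrtr_sqr ger0_norm.
rewrite /l2norm lee_sqrt ?lee_fin ?sqr_ge0 //.
split=> [h|[_ h] ].
  split=> // s us; rewrite -lee_fin; apply: le_trans h; apply: ereal_sup_ubound.
  exists [set` s]; first by split => //; exact: finite_seq.
  by rewrite -fsbig_seq // sumEFin.
apply: ge_ereal_sup => _ [A [/finite_seqP[s As] _] <-].
have -> : A = [set` undup s] by rewrite As; apply/seteqP; split=> x /=; rewrite mem_undup.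
by rewrite -fsbig_seq ?undup_uniq // sumEFin lee_fin; apply: h; exact: undup_uniq.
Qed.

Lemma l2norm_ge0 (I : choiceType) (f : I -> C) : (0%:E <= l2norm (f : I -> R[i]^o))%E.
Proof. exact: sqrte_ge0. Qed.

Lemma opnorm_leP (I J : choiceType) (T : (I -> C) -> (J -> C)) (B : R) : 0 <= B ->
  (opnorm (T : (I -> R[i]^o) -> (J -> R[i]^o)) <= B%:E)%E <->
  forall f, l2le f 1 -> l2le (T f) B.
Proof.
move=> B0; split=> [h f hf|h].
  apply/(l2norm_leP _ B0); apply: le_trans h; apply: ereal_sup_ubound.
  by exists f => //; apply/l2norm_leP.
by apply: ge_ereal_sup => _ [f hf <-]; apply/(l2norm_leP _ B0)/h/l2norm_leP.
Qed.

Lemma l2le0 (I : eqType) (f : I -> C) : (forall i, f i = 0) -> l2le f 0.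
Proof. by move=> h; split=> // s us; rewrite big1 ?expr0n // => i _; rewrite h Normc.normc0 expr0n. Qed.

Lemma opnorm_ge0 (I J : choiceType) (T : (I -> C) -> (J -> C)) :
  (0%:E <= opnorm (T : (I -> R[i]^o) -> (J -> R[i]^o)))%E.
Proof.
apply: le_trans (l2norm_ge0 (T (fun=> 0))) _; apply: ereal_sup_ubound; exists (fun=> 0) => //.
apply/l2norm_leP => //; have [_ h] := l2le0 (fun i : I => erefl (0 : C)).
by split=> // s us; apply: le_trans (h s us) _; rewrite expr0n expr1n.
Qed.

Lemma l2leZ (I : eqType) (f : I -> C) (k : C) B : l2le f B -> l2le (fun i => k * f i) (normc k * B).
Proof.
move=> [B0 h]; split=> [|s us]; first by rewrite mulr_ge0 ?normc_ge0.
under eq_bigr do rewrite Normc.normcM exprMn.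
by rewrite -mulr_sumr exprMn ler_wpM2l ?sqr_ge0 ?h.
Qed.

Lemma normc_real (x : R) : 0 <= x -> normc (x%:C)%C = x.
Proof. by move=> x0; rewrite /Normc.normc /= expr0n addr0 sqrtr_sqr ger0_norm. Qed.

(** Rescaling to the unit ball; for $B = 0$ the function vanishes and homogeneity with factor 0
    replaces the division. *)
Lemma homogeneous_bound (I J : eqType) (T : (I -> C) -> (J -> C)) (L : R) : 0 <= L ->
  (forall k f j, T (fun i => k * f i) j = k * T f j) ->
  (forall f g, f =1 g -> T f =1 T g) ->
  (forall f, l2le f 1 -> l2le (T f) L) ->
  forall f B, l2le f B -> l2le (T f) (L * B).
Proof.
move=> L0 TZ Text h f B hf; have [B0 _] := hf; move: B0; rewrite le_eqVlt => /predU1P[B0|B0].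
  rewrite -B0 mulr0; apply: l2le0 => j; rewrite -B0 in hf.
  have f0 : f =1 (fun i => 0 * f i) by move=> i; rewrite mul0r (l2le_eq0 hf).
  by rewrite (Text _ _ f0) TZ mul0r.
have h1 : l2le (T (fun i => (B^-1)%:C%C * f i)) L.
  apply: h; have := l2leZ (B^-1)%:C%C hf; rewrite normc_real ?invr_ge0 ?(ltW B0) //.
  by rewrite mulVf // gt_eqF.
have := l2leZ B%:C%C h1; rewrite normc_real ?(ltW B0) // mulrC.
apply: l2le_eq => j; rewrite TZ mulrA -rmorphM mulfV ?gt_eqF //.
by rewrite rmorph1 mul1r.
Qed.

Variable G : groupType.
Implicit Types zs : seq (C * G).

Definition adj_terms zs := [seq (conjc p.1, (p.2^-1)%g) | p <- zs].

(** The product $z^* z$ in the group algebra. *)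
Definition gram_terms zs := [seq (conjc p.1 * q.1, (p.2^-1 * q.2)%g) | p <- zs, q <- zs].

Lemma conjcM_normc (x : C) : conjc x * x = ((normc x ^+ 2)%:C)%C.
Proof.
case: x => a b; rewrite /Normc.normc sqr_sqrtr ?addr_ge0 ?sqr_ge0 //.
by apply/eqP; rewrite eq_complex /=; apply/andP; split; apply/eqP; ring.
Qed.

Lemma normc_conjc (x : C) : normc (conjc x) = normc x.
Proof. by case: x => a b; rewrite /Normc.normc /= sqrrN. Qed.

(** An operator and its adjoint have the same norm. With [F] the image of [f] under the adjoint cut
    down to the finite set [s], duality gives $\|F\|^2 = \langle TF, f\rangle \le L \|F\| B$. *)
Lemma adj_step_bound zs (L : R) : 0 <= L ->
  (forall f B, l2le f B -> l2le (step_op zs f) (L * B)) ->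
  forall f B, l2le f B -> l2le (step_op (adj_terms zs) f) (L * B).
Proof.
move=> L0 h f B hf; have [B0 _] := hf; split=> [|s us]; first exact: mulr_ge0.
set g := step_op (adj_terms zs) f; set N := \sum_(i <- s) normc (g i) ^+ 2.
have N0 : 0 <= N by apply: sumr_ge0 => i _; exact: sqr_ge0.
pose F h := if h \in s then g h else 0.
have hF : l2le F (Num.sqrt N).
  split=> [|t ut]; first exact: sqrtr_ge0.
  rewrite sqr_sqrtr // /N (bigID (mem s)) /= addrC big1 ?add0r; last first.
    by move=> i /negbTE si; rewrite /F si Normc.normc0 expr0n.
  rewrite -big_filter (eq_big_seq (fun i => normc (g i) ^+ 2)); last first.
    by move=> i; rewrite mem_filter => /andP[/= si _]; rewrite /F si.
  apply: (@le_trans _ _ (\sum_(i <- s | i \in t) normc (g i) ^+ 2)).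
    rewrite -[leRHS]big_filter le_eqVlt; apply/orP; left; apply/eqP/perm_big.
    by apply: uniq_perm; rewrite ?filter_uniq // => i; rewrite !mem_filter andbC.
  rewrite [leRHS](bigID (mem t)) /= lerDl; apply: sumr_ge0 => i _; exact: sqr_ge0.
(* A finite set of points carrying every term of the pairing. *)
pose S := undup [seq (i * p.2^-1)%g | i <- s, p <- zs].
have NE : (N%:C)%C = \sum_(j <- S) conjc (step_op zs F j) * f j.
  rewrite /N rmorph_sum /=.
  transitivity (\sum_(p <- zs) \sum_(i <- s) conjc (p.1 * F i) * f (i * p.2^-1)%g).
    rewrite exchange_big /=; apply: eq_big_seq => i si.
    rewrite -conjcM_normc {2}/g /step_op big_map mulr_sumr; apply: eq_bigr => p _ /=.
    by rewrite /F si rmorphM /= mulrA [in LHS](mulrC (conjc (g i))).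
  transitivity (\sum_(p <- zs) \sum_(j <- S) conjc (p.1 * F (j * p.2)%g) * f j); last first.
    rewrite exchange_big; apply: eq_bigr => j _.
    by rewrite /step_op rmorph_sum mulr_suml.
  apply: eq_big_seq => p pz.
  rewrite (eq_bigr (fun i => (fun j => conjc (p.1 * F (j * p.2)%g) * f j) (i * p.2^-1)%g)); last first.
    by move=> i _ /=; rewrite mulgVK.
  rewrite -(big_map (fun i => i * p.2^-1)%g xpredT (fun j => conjc (p.1 * F (j * p.2)%g) * f j)).
  rewrite [RHS](bigID (fun j => (j * p.2)%g \in s)) /= [X in _ = _ + X]big1 ?addr0; last first.
    by move=> j /negbTE jn; rewrite /F jn mulr0 rmorph0 mul0r.
  rewrite -[RHS]big_filter; apply: perm_big; apply: uniq_perm.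
  - by rewrite map_inj_uniq //; exact: mulIg.
  - by rewrite filter_uniq // undup_uniq.
  move=> j; rewrite mem_filter mem_undup; apply/mapP/andP => [ [i si ->]|[js _] ].
    by rewrite mulgVK; split=> //; apply/allpairsP; exists (i, p).
  by exists (j * p.2)%g; rewrite ?mulgK.
have : normc (N%:C)%C <= L * Num.sqrt N * B.
  rewrite NE; have hc : l2le (fun j => conjc (step_op zs F j)) (L * Num.sqrt N).
    have [c0 c1] := h _ _ hF; split=> // t ut.
    by under eq_bigr do rewrite normc_conjc; exact: c1.
  by apply: (@l2le_dot _ _ _ S id id _ _ _ _ (undup_uniq _) _ _ hc hf).
rewrite normc_real // -{1}(sqr_sqrtr N0) expr2 -mulrA [in X in _ <= X]mulrCA.
have := sqrtr_ge0 N; rewrite le_eqVlt => /predU1P[e _|sN].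
  by rewrite -/N -(sqr_sqrtr N0) -e expr0n sqr_ge0.
rewrite ler_pM2l // => h1.
by rewrite -/N -(sqr_sqrtr N0) lerXn2r // nnegrE ?mulr_ge0 // ltW.
Qed.

Lemma step_op_gram zs f a : step_op (gram_terms zs) f a = step_op (adj_terms zs) (step_op zs f) a.
Proof.
rewrite /step_op big_allpairs_dep big_map /=; apply: eq_bigr => p _.
by rewrite mulr_sumr; apply: eq_bigr => q _; rewrite mulrA mulgA.
Qed.

Lemma gram_step_bound zs (L : R) : 0 <= L ->
  (forall f B, l2le f B -> l2le (step_op zs f) (L * B)) ->
  forall f B, l2le f B -> l2le (step_op (gram_terms zs) f) (L ^+ 2 * B).
Proof.
move=> L0 h f B hf; apply: (@l2le_eq _ _ (step_op (adj_terms zs) (step_op zs f))).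
  by move=> a; rewrite step_op_gram.
by rewrite expr2 -mulrA; apply: adj_step_bound => //; apply: h.
Qed.

Definition fsfun_terms (z : {fsfun G -> R[i] with 0}) : seq (C * G) := [seq (z g, g) | g <- finsupp z].

(** Inversion on the group exchanges left translations with the right multiplications of the
    walk. *)
Lemma regular_step z (f : G -> C) a :
  linear_extension (@regular_rep R G) z (fun h => f (h^-1)%g) a = step_op (fsfun_terms z) f (a^-1)%g.
Proof.
rewrite linear_extension_regularE /step_op big_map /=.
by apply: eq_bigr => g _; rewrite invgM invgK.
Qed.

(** Cauchy-Schwarz over the terms. The constant is crude; it serves to make norms finite and to
    confine the spectrum to a fixed interval. *)
Lemma sum_contractions (I J : eqType) (K : Type) (zs : seq (C * K)) (V : K -> (I -> C) -> (J -> C)) f B :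
  (forall k, l2le (V k f) B) -> 0 <= B ->
  l2le (fun j => \sum_(p <- zs) p.1 * V p.2 f j)
    (Num.sqrt ((\sum_(p <- zs) normc p.1 ^+ 2) * (size zs)%:R) * B).
Proof.
move=> h B0; have S0 : 0 <= (\sum_(p <- zs) normc p.1 ^+ 2) * (size zs)%:R.
  by rewrite mulr_ge0 ?ler0n // sumr_ge0 // => p _; rewrite sqr_ge0.
split=> [|s us]; first by rewrite mulr_ge0 ?sqrtr_ge0.
rewrite exprMn sqr_sqrtr //.
apply: (@le_trans _ _ (\sum_(j <- s) (\sum_(p <- zs) normc p.1 ^+ 2) * (\sum_(p <- zs) normc (V p.2 f j) ^+ 2))).
  apply: ler_sum => j _; apply: le_trans (sum_mul_sqr_le _ _ _).
  rewrite lerXn2r ?nnegrE ?normc_ge0 //.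
    by apply: sumr_ge0 => p _; rewrite mulr_ge0 ?normc_ge0.
  by apply: le_trans (normc_sum _ _ _) _; under eq_bigr do rewrite Normc.normcM.
rewrite -mulr_sumr -mulrA ler_wpM2l; [ |by apply: sumr_ge0 => p _; rewrite sqr_ge0|].
  by [].
rewrite exchange_big /=; apply: (@le_trans _ _ (\sum_(p <- zs) B ^+ 2)).
  by apply: ler_sum => p _; have [_] := h p.2; apply.
by rewrite big_const_seq count_predT iter_addr addr0 mulr_natl.
Qed.

End OperatorNorm.

(** * Representations by signed permutation matrices *)

Section SignedPermRep.
Variables (R : realType) (n r : nat).
Local Notation C := (R[i]).
Local Open Scope sesquilinear_scope.
Local Open Scope complex_scope.

Lemma adj_sum m1 m2 (I : Type) (s : seq I) (F : I -> 'M[C]_(m1, m2)) :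
  (\sum_(i <- s) F i)^t* = \sum_(i <- s) (F i)^t*.
Proof. by rewrite !raddf_sum. Qed.

Lemma adjZ m1 m2 (k : C) (A : 'M[C]_(m1, m2)) : (k *: A)^t* = k^* *: A^t*.
Proof. by apply/matrixP => i j; rewrite !mxE rmorphM. Qed.

Lemma signed_perm_mxE (s : 'S_n) e i j : signed_perm_mx R s e i j = (-1) ^+ e i * (s i == j)%:R.
Proof. by rewrite !mxE. Qed.

Lemma signed_perm_mx_unitary (s : 'S_n) e :
  (signed_perm_mx R s e)^t* = signed_perm_mx R s^-1%g [ffun i => e ((s^-1)%g i)].
Proof.
apply/matrixP => i j; rewrite !mxE ffunE rmorphM rmorph_sign rmorph_nat.
have -> : ((s^-1)%g i == j) = (s j == i).
  by rewrite -(inj_eq (@perm_inj _ s)) permKV eq_sym.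
by case: eqP => [<-|_]; rewrite ?mulr0 // permK.
Qed.

Lemma signed_perm_adjK (s : 'S_n) e : (signed_perm_mx R s e)^t* *m signed_perm_mx R s e = 1%:M.
Proof. by rewrite signed_perm_mx_unitary signed_perm_mulV. Qed.

Lemma signed_perm_mx_inj (s t : 'S_n) e f : signed_perm_mx R s e = signed_perm_mx R t f -> (s, e) = (t, f).
Proof.
move=> /matrixP h; have st i : s i = t i.
  apply/eqP; have := h i (t i); rewrite !signed_perm_mxE eqxx mulr1.
  case: eqP => // _ /eqP; rewrite mulr0 eq_sym expf_eq0 oppr_eq0 oner_eq0 andbF //.
have {}st : s = t by apply/permP.
rewrite st in h *; congr (_, _); apply/ffunP => i; have := h i (t i).
rewrite !signed_perm_mxE eqxx !mulr1; case: (e i) (f i) => [] [] // /eqP.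
  by rewrite expr1 expr0 eq_sym -addr_eq0 -mulr2n pnatr_eq0.
by rewrite expr1 expr0 -addr_eq0 -mulr2n pnatr_eq0.
Qed.

Definition to_signed_perm (p : SP n) : signed_perm R n :=
  SignedPerm (introT (is_signed_perm_mxP _) (ex_intro _ p.1 (ex_intro _ p.2 erefl))).

Lemma to_signed_perm_bij : bijective to_signed_perm.
Proof.
apply: inj_card_bij => [ [s e] [t f] h|].
  exact: (signed_perm_mx_inj (congr1 (@signed_perm_val R n) h)).
rewrite -(card_codom (f := to_signed_perm)); last first.
  by move=> [s e] [t f] h; exact: (signed_perm_mx_inj (congr1 (@signed_perm_val R n) h)).
apply: subset_leq_card; apply/fintype.subsetP => A _.
have /is_signed_perm_mxP[s [e eA] ] := signed_perm_valP A.
by apply/codomP; exists (s, e); apply/val_inj; rewrite /= -eA.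
Qed.

Section Rep.
Variable b : 'I_r -> signed_perm R n.
Definition rep (g : free_group r) : 'M[C]_n := signed_perm_val (free_lift b g).

Lemma repM g h : rep (g * h)%g = rep g *m rep h.
Proof. by rewrite /rep free_liftM. Qed.

Lemma rep1 : rep 1%g = 1%:M.
Proof. by rewrite /rep free_lift1. Qed.

Lemma repP g : exists s e, rep g = signed_perm_mx R s e.
Proof. exact/is_signed_perm_mxP/signed_perm_valP. Qed.

Lemma repV g : rep (g^-1)%g = (rep g)^t*.
Proof.
have [s [e E] ] := repP g; have U : (rep g)^t* *m rep g = 1%:M by rewrite E signed_perm_adjK.
by rewrite -[LHS]mul1mx -U -mulmxA -repM mulgV rep1 mulmx1.
Qed.

Lemma rep_isometry g (v : 'cV[C]_n) : sqnorm (rep g *m v) = sqnorm v.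
Proof.
apply: complexI; rewrite /sqnorm -!adj_mul_diag adj_mul mulmxA -(mulmxA _ _ (rep g)) -repV -repM.
by rewrite mulVg rep1 mulmx1.
Qed.

Definition rep_sum (zs : seq (C * free_group r)) : 'M[C]_n := \sum_(p <- zs) p.1 *: rep p.2.

Lemma rep_sum_gram zs : (rep_sum zs)^t* *m rep_sum zs = rep_sum (gram_terms zs).
Proof.
rewrite /rep_sum big_allpairs_dep /= adj_sum mulmx_suml; apply: eq_bigr => p _.
rewrite mulmx_sumr; apply: eq_bigr => q _.
by rewrite repM repV adjZ -scalemxAl -scalemxAr scalerA.
Qed.

Lemma rep_sum_pow zs j : rep_sum zs ^+ j = rep_sum (group_pow zs j).
Proof.
elim: j => [|j IH]; first by rewrite /rep_sum big_seq1 /= rep1 scale1r expr0.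
rewrite exprS IH /rep_sum /= big_allpairs_dep /= -[LHS]/(_ *m _) mulmx_suml.
apply: eq_bigr => p _; rewrite mulmx_sumr; apply: eq_bigr => q _.
by rewrite repM -scalemxAl -scalemxAr scalerA.
Qed.

(** The inner product of the $i$-th columns of [rep g] and [rep h] is the diagonal entry of
    $g^{-1}h$ at $i$, by unitarity. *)
Lemma rep_orthonormal (U : seq (free_group r)) (c : free_group r -> C) i : uniq U ->
  {in U &, forall g h, g != h -> rep (g^-1 * h)%g i i = 0} ->
  sqnorm (\sum_(g <- U) c g *: col i (rep g)) = \sum_(g <- U) normc (c g) ^+ 2.
Proof.
move=> uU hU; apply: complexI; rewrite /sqnorm -adj_mul_diag adj_sum mulmx_suml.
rewrite summxE rmorph_sum; apply: eq_big_seq => g gU.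
have E h : (((c g *: col i (rep g))^t* *m (c h *: col i (rep h))) 0 0) =
    (c g)^* * c h * rep (g^-1 * h)%g i i.
  rewrite adjZ -scalemxAl -scalemxAr scalerA mxE repM repV; congr (_ * _).
  by rewrite !mxE; apply: eq_bigr => k _; rewrite !mxE.
rewrite mulmx_sumr summxE (bigD1_seq g) //= E mulVg rep1 mxE eqxx mulr1 normc_sqrE.
rewrite big_seq_cond big1 ?addr0 // => h /andP[hhU hg].
by rewrite E hU ?mulr0 // eq_sym.
Qed.

Lemma rep_sum_col zs (U T : seq (free_group r)) (f : free_group r -> C) i :
  uniq U -> uniq T -> {subset T <= U} ->
  (forall p g, p \in zs -> g \in T -> (p.2 * g)%g \in U) ->
  (forall g, g \notin T -> f g = 0) ->
  rep_sum zs *m (\sum_(g <- T) f g *: col i (rep g)) =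
  \sum_(h <- U) (\sum_(p <- zs) p.1 * f (p.2^-1 * h)%g) *: col i (rep h).
Proof.
move=> uU uT TU zTU f0.
rewrite /rep_sum mulmx_suml; under [RHS]eq_bigr do rewrite scaler_suml.
rewrite [RHS]exchange_big /=; apply: eq_big_seq => p pz.
rewrite mulmx_sumr [RHS](bigID (fun h => (p.2^-1 * h)%g \in T)) /= [X in _ = _ + X]big1 ?addr0; last first.
  by move=> h hT; rewrite f0 // mulr0 scale0r.
rewrite -[RHS]big_filter [RHS](perm_big [seq (p.2 * g)%g | g <- T]); last first.
  apply: uniq_perm; rewrite ?filter_uniq ?map_inj_uniq //; first exact: mulgI.
  move=> h; rewrite mem_filter; apply/andP/mapP => [ [hT hU]|[g gT ->] ].
    by exists (p.2^-1 * h)%g; rewrite ?mulVKg.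
  by rewrite mulKg gT zTU.
rewrite big_map; apply: eq_bigr => g _.
rewrite mulKg -scalemxAl -scalemxAr scalerA repM; congr (_ *: _).
by apply/matrixP => k j; rewrite !mxE; apply: eq_bigr => q _; rewrite !mxE.
Qed.
End Rep.

(** The three matrices are treated together so that they share the permutation [s]: a nonzero signed
    diagonal entry is then a fixed point of the plain permutation. *)
Lemma wmx_rep (x : 'I_r -> SP n) (g : free_group r) :
  exists s e, [/\ rep (fun i => to_signed_perm (x i)) g = signed_perm_mx R s e,
    map_mx (real_complex R) (wmx R true x (word g)) = signed_perm_mx R s e &
    wmx R false x (word g) = perm_mx s].
Proof.
pose b i := to_signed_perm (x i).
have L (l : letter r) : exists s e, [/\ signed_perm_val (letter_val b l) = signed_perm_mx R s e,
    map_mx (real_complex R) (lmx R true x l) = signed_perm_mx R s e &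
    lmx R false x l = perm_mx s].
  have adjE (A : signed_perm R n) s e : signed_perm_val A = signed_perm_mx R s e ->
      signed_perm_val (A^-1)%g = signed_perm_mx R s^-1%g [ffun i => e ((s^-1)%g i)].
    move=> AE; rewrite -[LHS]mul1mx -(signed_perm_mulV R s e) -mulmxA -AE.
    by rewrite -[signed_perm_val A *m _]/(signed_perm_val (A * A^-1)%g) mulgV mulmx1.
  case: l => i [] /=; rewrite /letter_val /lmx /entry /=.
    exists ((x i).1)^-1%g, [ffun j => (x i).2 (((x i).1)^-1%g j)]; split; first exact: (@adjE (b i) (x i).1 (x i).2 erefl).
    - apply/matrixP => j k; rewrite !mxE ffunE rmorphM rmorph_sign rmorph_nat /=.
      have -> : (((x i).1)^-1%g j == k) = ((x i).1 k == j).
        by rewrite -(inj_eq (@perm_inj _ (x i).1)) permKV eq_sym.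
      by case: eqP => [<-|_]; rewrite ?mulr0 // permK.
    apply/matrixP => j k; rewrite !mxE expr0 mul1r.
    by rewrite -[in RHS](inj_eq (@perm_inj _ (x i).1)) permKV eq_sym.
  exists (x i).1, (x i).2; split=> //.
    by apply/matrixP => j k; rewrite !mxE rmorphM rmorph_sign rmorph_nat.
  by apply/matrixP => j k; rewrite !mxE expr0 mul1r.
rewrite /rep /free_lift; elim: (word g) => [|l w [s [e [h1 h2 h3] ] ] ].
  exists 1%g, [ffun=> false]; rewrite big_nil signed_perm_mx1 perm_mx1; split=> //.
  by rewrite /wmx /= map_mx1.
have [s' [e' [h1' h2' h3'] ] ] := L l.
exists (s' * s)%g, [ffun i => e' i (+) e (s' i)]; rewrite big_cons -signed_perm_mxM; split.
- by rewrite -h1' -h1.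
- by rewrite /wmx /= map_mxM h2' -/(wmx R true x w) h2.
by rewrite /wmx /= h3' -/(wmx R false x w) h3 perm_mxM.
Qed.

Lemma rep_wmx (x : 'I_r -> SP n) (g : free_group r) :
  rep (fun i => to_signed_perm (x i)) g = map_mx (real_complex R) (wmx R true x (word g)).
Proof. by have [s [e [-> -> _] ] ] := wmx_rep x g. Qed.

Lemma rep_diag0 (x : 'I_r -> SP n) (g : free_group r) i :
  rep (fun i => to_signed_perm (x i)) g i i != 0 -> wmx R false x (word g) i i = 1.
Proof.
have [s [e [-> _ ->] ] ] := wmx_rep x g; rewrite signed_perm_mxE !mxE.
by case: (s i =P i) => [_ _|_] /=; rewrite ?mulr0 ?eqxx.
Qed.

Lemma wmx_unsigned_ge0 (x : 'I_r -> SP n) (g : free_group r) i j :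
  0 <= wmx R false x (word g) i j.
Proof. by have [s [e [_ _ ->] ] ] := wmx_rep x g; rewrite !mxE ler0n. Qed.

End SignedPermRep.

Section Norms.
Variables (R : realType).
Local Notation C := (R[i]).

Lemma l2le_col n (v : 'cV[C]_n) B : 0 <= B -> sqnorm v <= B ^+ 2 <-> l2le (fun i => v i 0) B.
Proof.
move=> B0; split=> [h|[_ h] ].
  split=> // s us; apply: le_trans h; rewrite /sqnorm [leRHS](bigID (mem s)) /= [leLHS]big_uniq //=.
  by rewrite lerDl sumr_ge0 // => i _; exact: sqr_ge0.
by have := h (enum 'I_n) (enum_uniq _); rewrite big_enum.
Qed.

Lemma mx_op_col n (A : 'M[C]_n) (f : 'I_n -> C) i : mx_op A (f : 'I_n -> R[i]^o) i = (A *m \col_j f j) i 0.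
Proof. by rewrite /mx_op mxE; apply: eq_bigr => j _; rewrite mxE. Qed.

Lemma opnorm_mx_le n (A : 'M[C]_n) t : 0 <= t ->
  (forall v, sqnorm (A *m v) <= t ^+ 2 * sqnorm v) -> (opnorm (mx_op A) <= t%:E)%E.
Proof.
move=> t0 h; apply/opnorm_leP => // f hf.
have : sqnorm (A *m \col_j f j) <= t ^+ 2.
  apply: le_trans (h _) _; rewrite -[leRHS]mulr1 ler_wpM2l ?sqr_ge0 // -(expr1n _ 2).
  by apply/l2le_col => //; apply: l2le_eq hf => i; rewrite mxE.
by move/(l2le_col _ t0); apply: l2le_eq => i; rewrite mx_op_col.
Qed.

Lemma opnorm_mx_gt n (A : 'M[C]_n) t v : 0 <= t -> sqnorm v <= 1 -> t ^+ 2 < sqnorm (A *m v) ->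
  ~ (opnorm (mx_op A) <= t%:E)%E.
Proof.
move=> t0 v1 + /(opnorm_leP _ t0) h; apply/negP; rewrite -leNgt.
apply/(l2le_col _ t0); apply: (@l2le_eq _ _ (mx_op A (fun i => v i 0))).
  by move=> i; rewrite mx_op_col; congr ((_ *m _) _ _); apply/matrixP => j k; rewrite mxE ord1.
by apply: h; apply/l2le_col; rewrite // expr1n.
Qed.

Definition crude_bound (K : Type) (zs : seq (C * K)) : R :=
  Num.sqrt ((\sum_(p <- zs) normc p.1 ^+ 2) * (size zs)%:R).

Lemma rep_sum_crude n r (b : 'I_r -> signed_perm R n) zs (v : 'cV[C]_n) :
  sqnorm (rep_sum b zs *m v) <= crude_bound zs ^+ 2 * sqnorm v.
Proof.
pose B := Num.sqrt (sqnorm v); have sv0 : 0 <= sqnorm v by apply: sumr_ge0 => i _; exact: sqr_ge0.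
have B2 : B ^+ 2 = sqnorm v by rewrite sqr_sqrtr.
pose V (g : free_group r) (f : 'I_n -> C) j := (rep b g *m \col_i f i) j 0.
rewrite -B2 -exprMn; apply/l2le_col; first by rewrite mulr_ge0 ?sqrtr_ge0.
have := @sum_contractions R 'I_n 'I_n (free_group r) zs V (fun i => v i 0) B _ (sqrtr_ge0 _).
have vE : \col_i v i 0 = v by apply/matrixP => j k; rewrite mxE ord1.
move=> H; apply: (@l2le_eq _ _ (fun j => \sum_(p <- zs) p.1 * V p.2 (fun i => v i 0) j)).
  move=> j; rewrite /rep_sum mulmx_suml summxE; apply: eq_bigr => p _.
  by rewrite /V vE -scalemxAl [in RHS]mxE.
by apply: H => g; apply/l2le_col; rewrite ?sqrtr_ge0 // vE rep_isometry B2.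
Qed.

Section Regular.
Variables (r : nat) (z : {fsfun free_group r -> R[i] with 0}).
Local Notation zs := (fsfun_terms z).
Local Notation reg := (linear_extension (@regular_rep R (free_group r)) z).

Lemma regE (f : free_group r -> C) h : reg f h = \sum_(p <- zs) p.1 * f (p.2^-1 * h)%g.
Proof. by rewrite linear_extension_regularE big_map. Qed.

Lemma reg_crude f : l2le f 1 -> l2le (reg f) (crude_bound zs).
Proof.
move=> hf; rewrite -[crude_bound _]mulr1.
pose V (g : free_group r) (f : free_group r -> C) h := f (g^-1 * h)%g.
apply: (@l2le_eq _ _ (fun h => \sum_(p <- zs) p.1 * V p.2 f h)).
  by move=> h; rewrite regE.
apply: sum_contractions => // g; apply: (@l2le_inj _ _ _ (fun h => g^-1 * h)%g) hf.
exact: mulgI.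
Qed.

(** The crude bound makes the norm finite. Its upper side passes to [step_op] by inversion; its
    lower side yields a function whose image is already large on a finite set. *)
Lemma regular_opnorm : exists L, [/\ 0 <= L, opnorm reg = L%:E,
  forall f B, l2le f B -> l2le (step_op zs f) (L * B) &
  forall t, 0 <= t -> t < L -> exists f s, [/\ l2le f 1, uniq s &
    t ^+ 2 < \sum_(h <- s) normc (\sum_(p <- zs) p.1 * f (p.2^-1 * h)%g) ^+ 2]].
Proof.
have up : (opnorm reg <= (crude_bound zs)%:E)%E.
  by apply/opnorm_leP; [exact: sqrtr_ge0 | exact: reg_crude].
have fin : opnorm reg \is a fin_num.
  rewrite ge0_fin_numE; last exact: opnorm_ge0.
  exact: le_lt_trans up (ltry _).
have E : opnorm reg = (fine (opnorm reg))%:E by rewrite fineK.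
have L0 : 0 <= fine (opnorm reg) by apply: fine_ge0; exact: opnorm_ge0.
exists (fine (opnorm reg)); split=> //.
  have H : forall f, l2le f 1 -> l2le (reg f) (fine (opnorm reg)).
    by apply/opnorm_leP; rewrite // -E.
  apply: homogeneous_bound => //.
  - by move=> k f a; rewrite /step_op mulr_sumr; apply: eq_bigr => p _; rewrite mulrCA.
  - by move=> f g fg; exact: eq_step_op.
  move=> f hf; have h1 : l2le (fun h => f (h^-1)%g) 1.
    by apply: (@l2le_inj _ _ _ (fun h => h^-1)%g) hf; exact: invg_inj.
  have := l2le_inj (@invg_inj _) (H _ h1); apply: l2le_eq => a /=.
  by rewrite regular_step invgK.
move=> t t0; rewrite -lte_fin -E => tL; apply/not_existsP => H.
suff : (opnorm reg <= t%:E)%E by rewrite leNgt tL.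
apply/opnorm_leP => // f hf; split=> // s us; rewrite leNgt; apply/negP => lt.
apply: (H f); exists s; split=> //; apply: lt_le_trans lt _.
by apply: ler_sum => h _; rewrite regE.
Qed.

Lemma linear_extension_rep n (b : 'I_r -> signed_perm R n) :
  linear_extension (fun g => signed_perm_val (free_lift b g)) z = rep_sum b zs.
Proof. by rewrite /linear_extension /rep_sum big_map. Qed.
End Regular.

(* The columns rep b g e_i, for g in the support involved, are orthonormal when no
   word of W fixes i; the truncation of f is copied onto them. *)
Lemma lower_transplant r (zs : seq (C * free_group r)) (f : free_group r -> C) s t :
  l2le f 1 -> uniq s -> 0 <= t ->
  t ^+ 2 < \sum_(h <- s) normc (\sum_(p <- zs) p.1 * f (p.2^-1 * h)%g) ^+ 2 ->
  exists W : seq (free_group r), 1%g \notin W /\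
   forall n (b : 'I_r -> signed_perm R n) i,
     (forall w, w \in W -> rep b w i i = 0) ->
     ~ (opnorm (mx_op (rep_sum b zs)) <= t%:E)%E.
Proof.
move=> hf us t0 lt.
(* [T] holds all points at which [f] enters the finite sum. [U] adds [s] and the points reached from
   [T], and [W] the nontrivial quotients in [U], whose diagonal entries at $i$ must vanish for
   orthonormality. *)
pose T := undup [seq (p.2^-1 * h)%g | p <- zs, h <- s].
pose f' g := if g \in T then f g else 0.
pose U := undup (s ++ T ++ [seq (p.2 * g)%g | p <- zs, g <- T]).
pose W := [seq w <- [seq (g^-1 * h)%g | g <- U, h <- U] | w != 1%g].
exists W; split; first by rewrite mem_filter eqxx.
move=> n b i hW.
have uU : uniq U := undup_uniq _; have uT : uniq T := undup_uniq _.
have orth : {in U &, forall g h, g != h -> rep b (g^-1 * h)%g i i = 0}.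
  move=> g h gU hU gh; apply: hW; rewrite mem_filter; apply/andP; split.
    apply: contraNneq gh => e; apply/eqP; apply: (mulgI (g^-1)%g).
    by rewrite mulVg e.
  by apply/allpairsP; exists (g, h).
have TU : {subset T <= U} by move=> g gT; rewrite mem_undup !mem_cat gT orbT.
apply: (@opnorm_mx_gt _ _ _ (\sum_(g <- T) f' g *: col i (rep b g))) => //.
  rewrite rep_orthonormal //; last by move=> g h gT hT; apply: orth; exact: TU.
  have [_ h1] := hf; have := h1 T uT; rewrite expr1n; apply: le_trans.
  by rewrite le_eqVlt; apply/orP; left; apply/eqP/eq_big_seq => g gT; rewrite /f' gT.
have zTU p g : p \in zs -> g \in T -> (p.2 * g)%g \in U.
  move=> pz gT; rewrite mem_undup !mem_cat; apply/orP; right; apply/orP; right.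
  by apply/allpairsP; exists (p, g).
have f0 g : g \notin T -> f' g = 0 by move=> /negbTE gT; rewrite /f' gT.
rewrite (rep_sum_col b i uU uT TU zTU f0).
rewrite rep_orthonormal //; apply: lt_le_trans lt _.
rewrite [leRHS](bigID (mem s)) /= -[leLHS]addr0 lerD //; last by apply: sumr_ge0 => g _; exact: sqr_ge0.
have pe : perm_eq [seq x <- U | x \in s] s.
  apply: uniq_perm; [by rewrite filter_uniq | by [] | move=> g].
  by rewrite mem_filter mem_undup mem_cat; case: (g \in s).
rewrite -[leRHS]big_filter [leRHS](perm_big _ pe) /=.
rewrite big_seq [leRHS]big_seq; apply: ler_sum => h hs.
suff -> : \sum_(p <- zs) p.1 * f (p.2^-1 * h)%g = \sum_(p <- zs) p.1 * f' (p.2^-1 * h)%g by [].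
apply: eq_big_seq => p pz; rewrite /f'.
by have -> : (p.2^-1 * h)%g \in T by rewrite mem_undup; apply/allpairsP; exists (p, h).
Qed.
End Norms.

(** * Tail estimates *)

(** For a positive exponent $p$ and $j = \lfloor k/p \rfloor$, one has $k+1 \le p(j+1) \le p 2^j$;
    the $p$-th power is at most $p^p 2^k$. *)
Lemma exp_poly_le p : exists2 Z, (0 < Z)%N & forall k, (k.+1 ^ p <= Z * 2 ^ k)%N.
Proof.
case: p => [|p]; first by exists 1%N => // k; rewrite mul1n expn0 expn_gt0.
exists (p.+1 ^ p.+1)%N => [|k]; first by rewrite expn_gt0.
set j := (k %/ p.+1)%N.
have h1 : (k.+1 <= p.+1 * j.+1)%N by rewrite mulnC; exact: ltn_ceil.
apply: (@leq_trans ((p.+1 * j.+1) ^ p.+1)); first by rewrite leq_exp2r.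
rewrite expnMn leq_mul2l; apply/orP; right.
apply: (@leq_trans ((2 ^ j) ^ p.+1)); first by rewrite leq_exp2r // ltn_expl.
by rewrite -expnM leq_exp2l // leq_divM.
Qed.

(** * The cutoff polynomial *)

Section Filter.
Variable R : realType.
Implicit Types (h : seq (R * nat)) (t : R).

(* Polynomials as lists of monomials, so that the evaluation of the polynomial
   with the absolute values of the coefficients is multiplicative. *)
Definition ev h t : R := \sum_(p <- h) p.1 * t ^+ p.2.
Definition ev_abs h t : R := \sum_(p <- h) `|p.1| * t ^+ p.2.
Definition mul_terms h h' : seq (R * nat) := [seq (p.1 * q.1, (p.2 + q.2)%N) | p <- h, q <- h'].
Fixpoint pow_terms h k := if k is k'.+1 then mul_terms h (pow_terms h k') else [:: (1, 0%N)].

Lemma ev_pow h k t : ev (pow_terms h k) t = ev h t ^+ k.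
Proof.
elim: k => [|k IH]; first by rewrite /ev big_seq1 mulr1.
rewrite exprS -IH /ev big_allpairs_dep /= mulr_suml; apply: eq_bigr => p _.
by rewrite mulr_sumr; apply: eq_bigr => q _; rewrite exprD mulrACA.
Qed.

Lemma ev_abs_pow h k t : ev_abs (pow_terms h k) t = ev_abs h t ^+ k.
Proof.
elim: k => [|k IH]; first by rewrite /ev_abs big_seq1 normr1 mulr1.
rewrite exprS -IH /ev_abs big_allpairs_dep /= mulr_suml; apply: eq_bigr => p _.
by rewrite mulr_sumr; apply: eq_bigr => q _; rewrite exprD normrM mulrACA.
Qed.

Lemma pow_terms_deg h k d : (forall p, p \in h -> (p.2 <= d)%N) ->
  forall p, p \in pow_terms h k -> (p.2 <= k * d)%N.
Proof.
move=> hd; elim: k => [|k IH] p; first by rewrite inE => /eqP ->.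
by case/allpairsP => -[a b] [/= /hd ha /IH hb ->]; rewrite mulSn leq_add.
Qed.

Lemma ev_abs_ge0 h t : 0 <= t -> 0 <= ev_abs h t.
Proof. by move=> t0; apply: sumr_ge0 => p _; rewrite mulr_ge0 ?exprn_ge0. Qed.

Lemma ev_abs_le h t t' : 0 <= t -> t <= t' -> ev_abs h t <= ev_abs h t'.
Proof. by move=> t0 tt; apply: ler_sum => p _; rewrite ler_wpM2l // lerXn2r ?nnegrE // (le_trans t0). Qed.

Lemma bernoulli_ge (x : R) n : 0 <= x -> 1 + n%:R * x <= (1 + x) ^+ n.
Proof.
move=> x0; elim: n => [|n IH]; first by rewrite mul0r addr0 expr0.
have h1 : 0 <= n%:R * x by rewrite mulr_ge0.
rewrite exprS; apply: (@le_trans _ _ ((1 + x) * (1 + n%:R * x))).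
  by rewrite -natr1; nra.
by rewrite ler_wpM2l // addr_ge0.
Qed.

Lemma bernoulli_sub (x : R) n : 0 <= x <= 1 -> 1 - n%:R * x <= (1 - x) ^+ n.
Proof.
move=> /andP[x0 x1]; elim: n => [|n IH]; first by rewrite mul0r subr0 expr0.
have h1 : 0 <= n%:R * x by rewrite mulr_ge0.
rewrite exprS; apply: (@le_trans _ _ ((1 - x) * (1 - n%:R * x))).
  by rewrite -natr1; nra.
by rewrite ler_wpM2l // subr_ge0.
Qed.

(** Binomial expansion of $1 - (1 - (t/K)^m)^N$. Absolute values of the coefficients turn it into
    $(1 + (t/K)^m)^N - 1$. *)
Definition cutoff_terms m N (K : R) : seq (R * nat) :=
  [seq (- ((-1) ^+ i * 'C(N, i)%:R / K ^+ (m * i)), (m * i)%N) | i <- iota 1 N].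

Lemma cutoff_sum (N : nat) (a : R) (x : R) :
  \sum_(i <- iota 1 N) a ^+ i * 'C(N, i)%:R * x ^+ i = (1 + a * x) ^+ N - 1.
Proof.
rewrite exprDn big_ord_recl /= expr1n expr0 mulr1 bin0 mulr1n addrC addKr.
rewrite -[iota 1 N]/(iota (1 + 0) N) iotaDl big_map -{1}(subn0 N) -/(index_iota 0 N) big_mkord.
apply: eq_bigr => i _.
by rewrite expr1n mul1r exprMn /bump /= -[RHS]mulr_natr mulrAC.
Qed.

Lemma ev_cutoff m N K t : K != 0 -> ev (cutoff_terms m N K) t = 1 - (1 - (t / K) ^+ m) ^+ N.
Proof.
move=> K0; have := cutoff_sum N (-1) ((t / K) ^+ m); rewrite mulN1r => /(congr1 -%R).
rewrite opprB => <-; rewrite /ev big_map -sumrN; apply: eq_bigr => i _ /=.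
by rewrite mulNr -exprM expr_div_n mulrAC mulrA.
Qed.

Lemma ev_abs_cutoff m N K t : 0 < K -> ev_abs (cutoff_terms m N K) t = (1 + (t / K) ^+ m) ^+ N - 1.
Proof.
move=> K0; have := cutoff_sum N 1 ((t / K) ^+ m); rewrite mul1r => <-.
rewrite /ev_abs big_map; apply: eq_bigr => i _ /=.
rewrite normrN !normrM normrX normrN1 !expr1n !mul1r normr_nat ger0_norm ?invr_ge0 ?exprn_ge0 ?(ltW K0) //.
by rewrite -exprM expr_div_n mulrAC mulrA.
Qed.

(** $N$ is of the order of $(K/r_2)^m$, so $N(r_2/K)^m \ge 1$; the choice of $m$ makes $(r_1/r_2)^m
    \le 1/256$, hence $N(r_1/K)^m \le 1/128$. *)
Lemma cutoff_exists (r1 r2 K : R) : 0 < r1 -> r1 < r2 -> r2 <= K -> exists h,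
  [/\ forall t, 0 <= t <= K -> 0 <= ev h t <= 1, forall t, r2 <= t <= K -> 1 / 2 <= ev h t
    & ev_abs h r1 <= 1 / 64].
Proof.
move=> r10 r12 r2K; have r20 : 0 < r2 by apply: lt_trans r12.
have K0 : 0 < K by apply: lt_le_trans r2K.
have [m hm] : exists m, 256 <= (r2 / r1) ^+ m.
  pose x := r2 / r1 - 1; have x0 : 0 < x by rewrite subr_gt0 ltr_pdivlMr // mul1r.
  exists (Num.truncn (256 / x)).+1.
  have -> : r2 / r1 = 1 + x by rewrite /x addrC subrK.
  apply: le_trans (bernoulli_ge _ (ltW x0)).
  have := truncnS_gt (256 / x); rewrite ltr_pdivrMr // => h; lra.
pose y := (K / r2) ^+ m; have y1 : 1 <= y by rewrite exprn_ege1 // ler_pdivlMr // mul1r.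
pose N := (Num.truncn y).+1.
have N1 : y <= N%:R by apply/ltW/truncnS_gt.
have N2 : N%:R <= 2 * y.
  have := truncn_le y; rewrite (le_trans ler01 y1) /N -natr1 => h; lra.
exists (cutoff_terms m N K); have Kn0 : K != 0 by rewrite gt_eqF.
have s01 t : 0 <= t <= K -> 0 <= (t / K) ^+ m <= 1.
  move=> /andP[t0 tK]; rewrite exprn_ge0 ?divr_ge0 ?(ltW K0) //= exprn_ile1 ?divr_ge0 ?(ltW K0) //.
  by rewrite ler_pdivrMr // mul1r.
split.
- move=> t /s01/andP[s0 s1]; rewrite ev_cutoff //.
  have u0 : 0 <= 1 - (t / K) ^+ m by rewrite subr_ge0.
  have := exprn_ge0 N u0; have := exprn_ile1 N u0 _; rewrite lerBlDr lerDl s0 => /(_ isT).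
  by move=> h1 h2; apply/andP; split; lra.
- move=> t /andP[t2 tK]; have t0 : 0 <= t by apply: le_trans (ltW r20) t2.
  rewrite ev_cutoff //; set s := (t / K) ^+ m.
  have /andP[s0 s1] : 0 <= s <= 1 by apply: s01; rewrite t0.
  have Ns : 1 <= N%:R * s.
    apply: (@le_trans _ _ (y * (r2 / K) ^+ m)).
      rewrite /y -exprMn (_ : K / r2 * (r2 / K) = 1) ?expr1n //.
      by field; rewrite !gt_eqF.
    apply: ler_pM => //; first exact: le_trans ler01 y1.
      by rewrite exprn_ge0 // divr_ge0 // ltW.
    by rewrite lerXn2r ?nnegrE ?divr_ge0 ?(ltW r20) ?(ltW K0) // ler_wpM2r // invr_ge0 ltW.
  (* From $(1+s)(1-s) \le 1$ and $(1+s)^N \ge 1 + Ns \ge 2$ one gets $(1-s)^N \le 1/2$. *)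
  have b1 := bernoulli_ge N s0; set A := (1 + s) ^+ N in b1.
  have A2 : 2 <= A by apply: le_trans b1; lra.
  have AB : A * (1 - s) ^+ N <= 1.
    rewrite /A -exprMn exprn_ile1 //; last by nra.
    by rewrite mulr_ge0 ?subr_ge0 // addr_ge0.
  have B0 : 0 <= (1 - s) ^+ N by rewrite exprn_ge0 // subr_ge0.
  nra.
rewrite ev_abs_cutoff //; set s := (r1 / K) ^+ m.
have s0 : 0 <= s by rewrite exprn_ge0 // divr_ge0 // ltW.
have Ns : N%:R * s <= 1 / 128.
  apply: (@le_trans _ _ (2 * y * s)); first by rewrite ler_wpM2r.
  have -> : 2 * y * s = 2 * ((r2 / r1) ^+ m)^-1.
    rewrite -mulrA /y /s -exprMn -exprVn; congr (2 * _ ^+ _).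
    by field; rewrite !gt_eqF.
  have := hm; set w := _ ^+ m => hw; have w0 : 0 < w by lra.
  by rewrite ler_pdivrMr //; lra.
have s1 : s <= 1.
  have : 1 * s <= N%:R * s by rewrite ler_wpM2r // ler1n.
  by lra.
(* The same product inequality, read backwards: $(1+s)^N \le 1/(1-Ns) \le 128/127$. *)
have b1 : 1 - N%:R * s <= (1 - s) ^+ N by apply: bernoulli_sub; rewrite s0.
have A0 : 0 <= (1 + s) ^+ N by rewrite exprn_ge0 // addr_ge0.
have AB : (1 + s) ^+ N * (1 - s) ^+ N <= 1.
  rewrite -exprMn exprn_ile1 //; last by nra.
  by rewrite mulr_ge0 ?subr_ge0 // addr_ge0.
nra.
Qed.
End Filter.

(** * The upper bound on the norm *)

Section Upper.
Variables (R : realType) (r : nat) (l0 : letter r).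
Local Notation C := (R[i]).

(** The number of unicyclic patterns is a sum over triples $(a,b,D)$, each handled by
    [lolli_sum_bound]; triples with $D$ odd or zero, or with $a \ge b$, vanish. *)
Lemma unicyclic_sum_bound (xs : seq (C * free_group r)) (rho : R) L P Q :
  0 <= rho -> (forall p, p \in xs -> (size (word p.2) <= L)%N) ->
  (forall f B, l2le f B -> l2le (step_op xs f) (rho * B)) -> (P * L <= Q)%N ->
  normc (\sum_(q <- group_pow xs P | word q.2 != [::]) q.1 * (unicyclic_walks (word q.2))%:R) <=
  (Q.+1 ^ 3 * (#|{: 'I_r * bool}| ^ 2 * (P.+1 * P.+1 * size (word_ball r L) * size (word_ball r L))))%:R * rho ^+ P.
Proof.
move=> rho0 xsL step PQ; set B := (#|{: 'I_r * bool}| ^ 2 * _)%N.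
pose F a b D : C := \sum_(q <- group_pow xs P) q.1 * (lolli_word l0 a b D (word q.2) && ~~ odd D)%:R.
have -> : \sum_(q <- group_pow xs P | word q.2 != [::]) q.1 * (unicyclic_walks (word q.2))%:R =
    \sum_(a < Q.+1) \sum_(b < Q.+1) \sum_(D < Q.+1) F a b D.
  rewrite big_mkcond /= /F.
  transitivity (\sum_(q <- group_pow xs P) \sum_(a < Q.+1) \sum_(b < Q.+1) \sum_(D < Q.+1)
      q.1 * (lolli_word l0 a b D (word q.2) && ~~ odd D)%:R).
    apply: eq_big_seq => q hq; case: ifP => [q0|/negbT].
      have sq : (0 < size (word q.2))%N by rewrite lt0n size_eq0.
      have sQ : (size (word q.2) <= Q)%N by apply: leq_trans (size_group_pow xsL hq) PQ.
      rewrite /unicyclic_walks (count_unicyclic l0 (word_reduced q.2) sq sQ).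
      rewrite natr_sum mulr_sumr; apply: eq_bigr => a _.
      rewrite natr_sum mulr_sumr; apply: eq_bigr => b _.
      by rewrite natr_sum mulr_sumr.
    rewrite negbK => /eqP w0; rewrite big1 // => a _; rewrite big1 // => b _; rewrite big1 // => D _.
    rewrite w0 /lolli_word /lolli /=.
    case: (ltnP a b) => ab //=; rewrite ?mulr0 //; case: (posnP D) => D0 //=; rewrite ?mulr0 //.
    case: eqP => //= h; rewrite ?mulr0 //.
    by move: h; case: (D : nat) D0 => // D' _; rewrite mulSn; lia.
  rewrite exchange_big; apply: eq_bigr => a _.
  rewrite exchange_big; apply: eq_bigr => b _.
  by rewrite exchange_big.
have rP : 0 <= rho ^+ P by exact: exprn_ge0.
have FB a b D : normc (F a b D) <= B%:R * rho ^+ P.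
  have B0 : 0 <= B%:R * rho ^+ P by rewrite mulr_ge0.
  have [D2|D2] := boolP (odd D).
    by rewrite /F big1 ?Normc.normc0 // => q _; rewrite D2 andbF mulr0.
  have [ab|ab] := ltnP a b; last first.
    rewrite /F big1 ?Normc.normc0 // => q _.
    by rewrite /lolli_word /lolli ltnNge ab /= mulr0.
  have [D0|D0] := posnP D.
    rewrite /F big1 ?Normc.normc0 // => q _.
    by rewrite /lolli_word /lolli D0 andbF /= mulr0.
  have D1 : (1 < D)%N by case: D D0 D2 => [|[|D] ].
  have := lolli_sum_bound l0 rho0 xsL step ab D1 P; rewrite -/B.
  by rewrite /F; under [in X in _ -> X]eq_bigr do rewrite D2 andbT.
have cord k (x : R) : \sum_(i < k) x = k%:R * x by rewrite sumr_const card_ord mulr_natl.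
apply: (@le_trans _ _ (\sum_(a < Q.+1) \sum_(b < Q.+1) \sum_(D < Q.+1) B%:R * rho ^+ P)).
  apply: le_trans (normc_sum _ _ _) _; apply: ler_sum => a _.
  apply: le_trans (normc_sum _ _ _) _; apply: ler_sum => b _.
  by apply: le_trans (normc_sum _ _ _) _; apply: ler_sum => D _; exact: FB.
by rewrite !cord !mulrA -!natrM (expnS _ 2) -mulnn !mulnA.
Qed.

Lemma normc_Re (x : C) : `|complex.Re x| <= normc x.
Proof.
case: x => a b; rewrite -[complex.Re _]/a -(sqrtr_sqr a) ler_wsqrtr //.
by rewrite lerDl sqr_ge0.
Qed.

Section Terms.
Variables (zs : seq (C * free_group r)).
Let xs := gram_terms zs.

(** The polynomial [h] applied to $z^* z$. Real parts of the coefficients suffice because the traces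
    of words, and the total, are real. *)
Definition trace_terms (h : seq (R * nat)) : seq (R * seq (letter r)) :=
  flatten [seq [seq (p.1 * complex.Re q.1, word q.2) | q <- group_pow xs p.2] | p <- h].

Lemma sum_trace_terms (h : seq (R * nat)) (F : seq (letter r) -> R) (P : pred (seq (letter r))) :
  \sum_(k <- trace_terms h | P k.2) k.1 * F k.2 =
  \sum_(p <- h) p.1 * complex.Re (\sum_(q <- group_pow xs p.2 | P (word q.2)) q.1 * ((F (word q.2))%:C)%C).
Proof.
rewrite /trace_terms big_flatten big_map /=; apply: eq_bigr => p _.
rewrite big_map /= raddf_sum mulr_sumr; apply: eq_bigr => q _.
by case: (q.1) => a b /=; rewrite mulr0 subr0 mulrA.
Qed.

Lemma mean_trace_terms (h : seq (R * nat)) n :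
  \sum_(k <- trace_terms h) k.1 * mean_trace R true n k.2 =
  (\sum_(x : Omega r n) \sum_(k <- trace_terms h) k.1 * \tr (wmx R true x k.2)) / (#|{:Omega r n}|)%:R.
Proof.
rewrite exchange_big /= mulr_suml; apply: eq_bigr => k _.
by rewrite /mean_trace mulrA mulr_sumr.
Qed.

Lemma trace_terms_spectrum n (x : Omega r n) : exists lam : 'I_n -> R,
  [/\ forall h, \sum_(k <- trace_terms h) k.1 * \tr (wmx R true x k.2) = \sum_i ev h (lam i),
      forall i, 0 <= lam i <= crude_bound zs ^+ 2
    & forall t, 0 <= t -> (forall i, lam i <= t ^+ 2) ->
        (opnorm (mx_op (rep_sum (fun i => to_signed_perm R (x i)) zs)) <= t%:E)%E].
Proof.
pose b i := to_signed_perm R (x i).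
have [lam [h1 h2 h3] ] := gram_spectrum (rep_sum b zs).
exists lam; split.
- move=> h; rewrite (sum_trace_terms h (fun w => \tr (wmx R true x w)) xpredT).
  rewrite /ev exchange_big /=; apply: eq_bigr => p _; rewrite -mulr_sumr; congr (_ * _).
  have := h1 p.2; rewrite rep_sum_gram rep_sum_pow => /(congr1 (@complex.Re R)) /= <-.
  congr complex.Re; rewrite /rep_sum raddf_sum; apply: eq_bigr => q _.
  by rewrite /= mxtraceZ rep_wmx trace_map_mx.
- move=> i; have [u u1 <-] := h2 i; apply/andP; split; first by apply: sumr_ge0 => j _; exact: sqr_ge0.
  by have := rep_sum_crude b zs u; rewrite u1 mulr1.
by move=> t t0 ht; apply: opnorm_mx_le => // v; apply: h3.
Qed.
End Terms.
End Upper.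

Section UpperTail.
Variables (R : realType) (r : nat) (l0 : letter r).
Local Notation C := (R[i]).
Variables (zs : seq (C * free_group r)) (Lop t : R).
Hypotheses (Lop_ge0 : 0 <= Lop) (Lop_lt : Lop < t).
Hypothesis step_bound : forall f B, l2le f B -> l2le (step_op zs f) (Lop * B).
Let xs := gram_terms zs.
Let rho := Lop ^+ 2.

Definition norm_le n (x : Omega r n) : bool :=
  `[< (opnorm (mx_op (rep_sum (fun i => to_signed_perm R (x i)) zs)) <= t%:E)%E >].

Let rho_ge0 : 0 <= rho. Proof. exact: sqr_ge0. Qed.
Let xs_step f B : l2le f B -> l2le (step_op xs f) (rho * B).
Proof. exact: gram_step_bound. Qed.

Let Lw := (\max_(p <- xs) size (word p.2))%N.
Let xs_le p : p \in xs -> (size (word p.2) <= Lw)%N.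
Proof. by move=> pxs; rewrite /Lw; apply: (leq_bigmax_seq (F := fun p => size (word p.2))). Qed.

Section Cutoff.
Variables (f : seq (R * nat)) (K : R).
Hypothesis K_crude : crude_bound zs ^+ 2 <= K.
Hypothesis f01 : forall s, 0 <= s <= K -> 0 <= ev f s <= 1.
Hypothesis f_half : forall s, t ^+ 2 <= s <= K -> 1 / 2 <= ev f s.
Hypothesis f_abs : ev_abs f rho <= 1 / 64.
Let d0 := (\max_(p <- f) p.2)%N.
Let f_deg p : p \in f -> (p.2 <= d0)%N.
Proof. by move=> pf; apply: (leq_bigmax_seq (F := fun p : R * nat => p.2)). Qed.

Let c0 := (#|{: 'I_r * bool}| ^ 2 * (size (word_ball r Lw) * size (word_ball r Lw)))%N.

(* When the norm exceeds t, tr f^k (A^* A) is at least 2^-k, so its mean bounds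
   the proportion of such x. *)
Lemma tail_estimate k n : let Q := (k * d0 * Lw)%N in
  (8 * (r * Q).+2 ^ 3 <= n)%N -> (0 < n)%N ->
  ((#|[set x : Omega r n | ~~ norm_le x]%SET|)%:R : R) <=
  (#|{:Omega r n}|)%:R * (2 ^+ k * (n%:R * (1 / 64) ^+ k +
     2 * ((Q.+1 ^ 3 * (k * d0).+1 ^ 2 * c0)%:R * (1 / 64) ^+ k) +
     4 * (8 * (r * Q).+2%:R ^+ 3 * (8 * (r * Q).+2 ^ 3)%:R) ^+ 2 / n%:R)).
Proof.
move=> Q Nn n0; have nR : 0 < n%:R :> R by rewrite ltr0n.
set N := (8 * (r * Q).+2 ^ 3)%N in Nn *.
pose h := pow_terms f k; pose ks := trace_terms zs h.
have hdeg p : p \in h -> (p.2 <= k * d0)%N by apply: pow_terms_deg.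
have hks e : e \in ks -> reduced e.2 && (size e.2 <= Q)%N.
  case/flatten_mapP => p hp /mapP[q hq ->] /=; rewrite word_reduced /=.
  by apply: leq_trans (size_group_pow xs_le hq) _; rewrite leq_mul2r hdeg ?orbT.
have spec n' (x : Omega r n') : 0 <= \sum_(e <- ks) e.1 * \tr (wmx R true x e.2) <= n'%:R.
  have [lam [-> lam0 _] ] := trace_terms_spectrum zs x.
  have e01 i : 0 <= ev h (lam i) <= 1.
    have /andP[l1 l2] := lam0 i; have /andP[e1 e2] : 0 <= ev f (lam i) <= 1.
      by apply: f01; rewrite l1 (le_trans l2).
    by rewrite ev_pow exprn_ge0 //= exprn_ile1.
  apply/andP; split; first by apply: sumr_ge0 => i _; case/andP: (e01 i).
  apply: (@le_trans _ _ (\sum_(i < n') 1)); first by apply: ler_sum => i _; case/andP: (e01 i).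
  by rewrite sumr_const card_ord.
pose Psi n' := \sum_(e <- ks) e.1 * (mean_trace R true n' e.2 / n'%:R).
have PsiE n' : Psi n' = (\sum_(x : Omega r n') \sum_(e <- ks) e.1 * \tr (wmx R true x e.2)) / (#|{:Omega r n'}|)%:R / n'%:R.
  by rewrite -mean_trace_terms mulr_suml; apply: eq_bigr => e _; rewrite mulrA.
have O0 n' : 0 < (#|{:Omega r n'}|)%:R :> R by rewrite ltr0n card_Omega_gt0.
have Psi1 n' : (N <= n')%N -> `|Psi n'| <= 1.
  move=> Nn'; have n'0 : 0 < n'%:R :> R.
    by rewrite ltr0n (leq_trans _ Nn') // /N muln_gt0 expn_gt0.
  rewrite PsiE ger0_norm; last first.
    by rewrite !divr_ge0 ?ler0n // sumr_ge0 // => x _; case/andP: (spec n' x).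
  rewrite ler_pdivrMr // mul1r ler_pdivrMr //.
  apply: (@le_trans _ _ (\sum_(x : Omega r n') n'%:R)); first by apply: ler_sum => x _; case/andP: (spec n' x).
  by rewrite sumr_const -[leLHS]mulr_natr.
have habs : ev_abs h rho <= (1 / 64) ^+ k.
  by rewrite ev_abs_pow lerXn2r ?nnegrE ?ev_abs_ge0 //; lra.
have k641 : (1 / 64) ^+ k <= 1 :> R by rewrite exprn_ile1 //; lra.
pose tau := \sum_(e <- ks | e.2 == [::]) e.1.
(* In the $j$-th power the empty words carry the weight of return to the identity, at most
   $\rho^j$. *)
have tau_le : `|tau| <= (1 / 64) ^+ k.
  apply: le_trans habs.
  have -> : tau = \sum_(e <- ks | e.2 == [::]) e.1 * 1 by apply: eq_bigr => e _; rewrite mulr1.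
  rewrite (sum_trace_terms zs h (fun=> 1) (fun w => w == [::])).
  apply: le_trans (ler_norm_sum _ _ _) _; apply: ler_sum => p _; rewrite normrM ler_wpM2l //.
  apply: le_trans (normc_Re _) _; apply: le_trans (normc_free_kernel rho_ge0 xs_step p.2 1%g 1%g).
  rewrite -sum_group_pow_delta big_mkcond /= le_eqVlt; apply/orP; left; apply/eqP; congr normc.
  apply: eq_bigr => q _; have -> : (q.2 == 1%g) = (word q.2 == [::]) by [].
  by case: ifP => _; rewrite ?mulr0.
pose U := \sum_(e <- ks | e.2 != [::]) e.1 * (unicyclic_walks e.2)%:R.
have U_le : `|U| <= (Q.+1 ^ 3 * (k * d0).+1 ^ 2 * c0)%:R * (1 / 64) ^+ k.
  apply: (@le_trans _ _ ((Q.+1 ^ 3 * (k * d0).+1 ^ 2 * c0)%:R * ev_abs h rho)); last by rewrite ler_wpM2l.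
  rewrite /U (sum_trace_terms zs h (fun w => (unicyclic_walks w)%:R) (fun w => w != [::])).
  rewrite mulr_sumr; apply: le_trans (ler_norm_sum _ _ _) _; rewrite big_seq [leRHS]big_seq.
  apply: ler_sum => p hp; rewrite normrM mulrCA ler_wpM2l //.
  apply: le_trans (normc_Re _) _.
  have PQ : (p.2 * Lw <= Q)%N by rewrite leq_mul2r hdeg ?orbT.
  have := unicyclic_sum_bound l0 rho_ge0 xs_le xs_step PQ.
  under eq_bigr do rewrite -(rmorph_nat (real_complex R)).
  move/le_trans; apply; rewrite ler_wpM2r ?exprn_ge0 // ler_nat.
  rewrite -(mulnA (Q.+1 ^ 3)%N) leq_mul2l; apply/orP; right.
  rewrite /c0 [leqRHS]mulnCA leq_mul2l; apply/orP; right.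
  have := hdeg _ hp; set B := size _ => pd.
  have pd1 : (p.2.+1 * p.2.+1 <= (k * d0).+1 ^ 2)%N by rewrite -mulnn leq_mul.
  by rewrite -(mulnA (p.2.+1 * p.2.+1)%N) leq_mul.
have tau1 : `|tau| <= 1 by apply: le_trans tau_le _.
have main := mean_trace_expansion hks (leqnn N) Psi1 tau1 Nn.
rewrite -/tau -/U -/(Psi n) in main.
have count : ((#|[set x : Omega r n | ~~ norm_le x]%SET|)%:R : R) * (1 / 2) ^+ k <=
   \sum_(x : Omega r n) \sum_(e <- ks) e.1 * \tr (wmx R true x e.2).
  rewrite -sum1_card natr_sum mulr_suml big_mkcond /=; apply: ler_sum => x _.
  have /andP[s0 _] := spec n x; case: ifP => //; rewrite inE => bad; rewrite (mul1r ((1 / 2) ^+ k)).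
  have [lam [-> lam0 lamt] ] := trace_terms_spectrum zs x.
  have t0 : 0 <= t by apply: le_trans Lop_ge0 (ltW Lop_lt).
  have [i hi] : exists i, t ^+ 2 < lam i.
    apply/not_existsP => H; move: bad; rewrite /norm_le => /asboolP; apply.
    by apply: lamt => // i; rewrite leNgt; apply/negP; exact: H.
  have ev0 j : 0 <= ev h (lam j).
    have /andP[l1 l2] := lam0 j; rewrite ev_pow exprn_ge0 //.
    by have /andP[] : 0 <= ev f (lam j) <= 1 by apply: f01; rewrite l1 (le_trans l2).
  rewrite (bigD1 i) //= -[leLHS]addr0; apply: lerD; last by apply: sumr_ge0.
  have /andP[l1 l2] := lam0 i; rewrite ev_pow; apply: lerXn2r; rewrite ?nnegrE; first by lra.
    by have /andP[] : 0 <= ev f (lam i) <= 1 by apply: f01; rewrite l1 (le_trans l2).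
  by apply: f_half; rewrite (ltW hi) (le_trans l2).
have Psi_le : Psi n * n%:R <= n%:R * (1 / 64) ^+ k +
     2 * ((Q.+1 ^ 3 * (k * d0).+1 ^ 2 * c0)%:R * (1 / 64) ^+ k) +
     4 * (8 * (r * Q).+2%:R ^+ 3 * N%:R) ^+ 2 / n%:R.
  apply: (@le_trans _ _ ((`|tau| + 2 * (`|U| / n%:R + (8 * (r * Q).+2%:R ^+ 3 * N%:R) ^+ 2 * 2 / n%:R ^+ 2)) * n%:R)).
    by rewrite ler_wpM2r // (le_trans (ler_norm _)).
  set CC := (8 * _ ^+ 3 * _) ^+ 2.
  have -> : (`|tau| + 2 * (`|U| / n%:R + CC * 2 / n%:R ^+ 2)) * n%:R = n%:R * `|tau| + 2 * `|U| + 4 * CC / n%:R.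
    by field; rewrite gt_eqF.
  by rewrite lerD2r lerD // ler_wpM2l.
have -> : ((#|[set x : Omega r n | ~~ norm_le x]%SET|)%:R : R) = 2 ^+ k * (((#|[set x : Omega r n | ~~ norm_le x]%SET|)%:R : R) * (1 / 2) ^+ k) :> R.
  have two : 2 * (1 / 2) = 1 :> R by lra.
  by rewrite mulrCA -exprMn two expr1n mulr1.
apply: (@le_trans _ _ (2 ^+ k * ((#|{:Omega r n}|)%:R * (Psi n * n%:R)))).
  rewrite ler_wpM2l ?exprn_ge0 //; apply: le_trans count _.
  by rewrite PsiE divfK ?gt_eqF // mulrC divfK ?gt_eqF.
by rewrite mulrCA ler_wpM2l // ler_wpM2l ?exprn_ge0.
Qed.
End Cutoff.
End UpperTail.

Section Tails.
Variables (R : realType) (r : nat) (l0 : letter r).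
Local Notation C := (R[i]).
Variables (zs : seq (C * free_group r)).

Lemma mul_succ_le (a b : nat) : ((a * b).+1 <= b.+1 * a.+1)%N.
Proof. by rewrite mulSn mulnS addSn ltnS mulnC addnA leq_addl. Qed.

Lemma mul_succ2_le (a b e : nat) : ((a * (b * e)).+2 <= (a * e).+2 * b.+1)%N.
Proof. by rewrite mulnCA mulnS; move: (a * e)%N => x; rewrite mulnC; nia. Qed.

(** With $n$ between $4^k$ and $4^{k+1}$, the prefactors $2^k n 64^{-k}$, $2^k 64^{-k}$ and $2^k/n$
    are all $O(2^{-k})$, and the largest polynomial factor is $(8w^3)^4$, of degree 12 in $k$.
    Exponent 13 leaves a spare factor $k+1$ to beat $AZ/\delta$. *)
Lemma tail_decay (d0 e c0 Z : nat) k n (delta : R) :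
  (k.+1 ^ 13 <= Z * 2 ^ k)%N -> (4 ^ k <= n < 4 ^ k.+1)%N ->
  let c := (r * e).+2 in let Q := (k * e)%N in
  let A := (4 + 2 * (e.+1 ^ 3 * d0.+1 ^ 2 * c0) + 4 * (8 * c ^ 3) ^ 4)%N in
  0 < delta -> A%:R * Z%:R / delta <= k.+1%:R ->
  2 ^+ k * (n%:R * (1 / 64) ^+ k +
     2 * ((Q.+1 ^ 3 * (k * d0).+1 ^ 2 * c0)%:R * (1 / 64) ^+ k) +
     4 * (8 * (r * Q).+2%:R ^+ 3 * (8 * (r * Q).+2 ^ 3)%:R) ^+ 2 / n%:R) <= delta.
Proof.
move=> hZ /andP[n1 n2] c Q A d0' hk.
set y : R := k.+1%:R in hk; have y1 : 1 <= y by rewrite ler1n.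
have y0 : 0 < y by apply: lt_le_trans y1.
pose T : R := 2 ^+ k; have T0 : 0 < T by rewrite exprn_gt0.
have T1 : 1 <= T by rewrite exprn_ege1 // ler1n.
have e64 : (1 / 64) ^+ k = (T ^+ 6)^-1 :> R.
  by rewrite /T -exprM mulnC exprM -exprVn -natrX div1r.
have n1R : T ^+ 2 <= n%:R by rewrite /T exprAC -natrX -natrX ler_nat (_ : 2 ^ 2 = 4)%N.
have n2R : n%:R <= 4 * T ^+ 2.
  by rewrite /T exprAC -!natrX -natrM ler_nat (_ : 2 ^ 2 = 4)%N // -expnS ltnW.
have nR : 0 < n%:R :> R by apply: lt_le_trans n1R; rewrite exprn_gt0.
have yT : y ^+ 13 <= Z%:R * T by rewrite /y /T -!natrX -natrM ler_nat.
have y12 : 1 <= y ^+ 12 by rewrite exprn_ege1.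
have t1 : T * (n%:R * (1 / 64) ^+ k) <= 4 * y ^+ 12 / T.
  rewrite e64 mulrA ler_pdivrMr ?exprn_gt0 //.
  have -> : 4 * y ^+ 12 / T * T ^+ 6 = 4 * T ^+ 2 * T * (T ^+ 2 * y ^+ 12) by field; rewrite gt_eqF.
  rewrite mulrC -[leLHS]mulr1; apply: ler_pM => //; first by rewrite mulr_ge0 // ltW.
    by rewrite ler_wpM2r // ltW.
  by rewrite -[leLHS]mulr1 ler_pM // exprn_ege1.
have t2 : T * (2 * ((Q.+1 ^ 3 * (k * d0).+1 ^ 2 * c0)%:R * (1 / 64) ^+ k)) <=
    (2 * (e.+1 ^ 3 * d0.+1 ^ 2 * c0))%:R * y ^+ 12 / T.
  have h1 : (Q.+1 ^ 3 * (k * d0).+1 ^ 2 * c0 <= e.+1 ^ 3 * d0.+1 ^ 2 * c0 * k.+1 ^ 12)%N.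
    have q1 : (Q.+1 <= e.+1 * k.+1)%N by exact: mul_succ_le.
    have q2 : ((k * d0).+1 <= d0.+1 * k.+1)%N by exact: mul_succ_le.
    rewrite [leqRHS]mulnAC leq_mul2r; apply/orP; right.
    apply: (@leq_trans ((e.+1 * k.+1) ^ 3 * (d0.+1 * k.+1) ^ 2)).
      by rewrite leq_mul // leq_exp2r.
    by rewrite !expnMn mulnACA leq_mul // -expnD leq_pexp2l.
  rewrite e64 -(ler_nat R) in h1 *.
  set a := (_ * c0)%N in h1 *; rewrite natrM in h1; set b := (_ * c0)%N in h1 *.
  rewrite natrX -/y in h1.
  have -> : T * (2 * (a%:R * (T ^+ 6)^-1)) = (2 * a%:R) / T ^+ 5 by field; rewrite gt_eqF.
  rewrite natrM ler_pdivrMr ?exprn_gt0 //.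
  have -> : 2 * b%:R * y ^+ 12 / T * T ^+ 5 = 2 * (b%:R * y ^+ 12) * T ^+ 4 by field; rewrite gt_eqF.
  rewrite -[leLHS]mulr1; apply: ler_pM; rewrite ?mulr_ge0 ?ler_wpM2l //.
  by rewrite exprn_ege1.
have t3 : T * (4 * (8 * (r * Q).+2%:R ^+ 3 * (8 * (r * Q).+2 ^ 3)%:R) ^+ 2 / n%:R) <=
    (4 * (8 * c ^ 3) ^ 4)%:R * y ^+ 12 / T.
  set w : R := (r * Q).+2%:R.
  have wy : w <= c%:R * y by rewrite /w /y -natrM ler_nat mul_succ2_le.
  have w0 : 0 <= w by [].
  have -> : (8 * (r * Q).+2 ^ 3)%:R = 8 * w ^+ 3 by rewrite natrM natrX.
  have -> : T * (4 * (8 * w ^+ 3 * (8 * w ^+ 3)) ^+ 2 / n%:R) = 4 * (8 * w ^+ 3) ^+ 4 * T / n%:R by ring.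
  have h : 4 * (8 * w ^+ 3) ^+ 4 <= (4 * (8 * c ^ 3) ^ 4)%:R * y ^+ 12.
    have -> : (4 * (8 * c ^ 3) ^ 4)%:R * y ^+ 12 = 4 * (8 * (c%:R * y) ^+ 3) ^+ 4.
      by rewrite natrM natrX natrM natrX; ring.
    have cy0 : 0 <= c%:R * y by rewrite mulr_ge0 // ltW.
    have a1 : 8 * w ^+ 3 <= 8 * (c%:R * y) ^+ 3 by rewrite ler_wpM2l // lerXn2r // nnegrE.
    have a0 : 0 <= 8 * w ^+ 3 by rewrite mulr_ge0 // exprn_ge0.
    by rewrite ler_wpM2l // lerXn2r // nnegrE; exact: le_trans a1.
  rewrite ler_pdivrMr //; apply: (le_trans (ler_wpM2r (ltW T0) h)).
  by rewrite -[leRHS]mulrA ler_wpM2l ?mulr_ge0 ?exprn_ge0 ?(ltW y0) // mulrC ler_pdivlMr // -expr2.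
rewrite -/T 2!mulrDr; apply: le_trans (lerD (lerD t1 t2) t3) _.
rewrite -!mulrDl -!natrD.
rewrite ler_pdivrMr //.
have hd : A%:R * Z%:R <= delta * y by rewrite -ler_pdivrMl // mulrC.
rewrite -(@ler_pM2r _ y) //.
apply: (@le_trans _ _ (A%:R * (Z%:R * T))).
  by rewrite -mulrA -exprSr ler_wpM2l.
by rewrite mulrA [leRHS]mulrAC ler_wpM2r // ltW.
Qed.

Lemma upper_tail (Lop t : R) : 0 <= Lop -> Lop < t ->
  (forall f B, l2le f B -> l2le (step_op zs f) (Lop * B)) ->
  forall delta, 0 < delta -> exists n0, forall n, (n0 <= n)%N ->
  ((#|[set x : Omega r n | ~~ norm_le zs t x]%SET|)%:R : R) <= delta * (#|{:Omega r n}|)%:R.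
Proof.
move=> L0 Lt hstep delta d0.
(* The midpoint [r1] is positive even when [Lop] is 0, and [K] dominates both [r2] and the a priori
   bound on the spectrum. *)
pose r2 := t ^+ 2; pose r1 := (Lop ^+ 2 + r2) / 2; pose K := r2 + crude_bound zs ^+ 2.
have t0 : 0 < t by apply: le_lt_trans Lt.
have L2 : 0 <= Lop ^+ 2 by exact: sqr_ge0.
have L2t : Lop ^+ 2 < r2 by rewrite /r2 ltrXn2r // nnegrE ltW.
have K1 : r2 <= K by rewrite lerDl sqr_ge0.
have [f [f1 f2 f3] ] : exists f, [/\ forall s, 0 <= s <= K -> 0 <= ev f s <= 1,
    forall s, r2 <= s <= K -> 1 / 2 <= ev f s & ev_abs f r1 <= 1 / 64].
  by apply: cutoff_exists => //; rewrite /r1; lra.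
have fabs : ev_abs f (Lop ^+ 2) <= 1 / 64.
  by apply: le_trans f3; apply: ev_abs_le; rewrite // /r1; lra.
have Kc : crude_bound zs ^+ 2 <= K by rewrite lerDr sqr_ge0.
have est := tail_estimate l0 L0 Lt hstep Kc f1 f2 fabs.
set deg := (\max_(p <- f) p.2)%N in est; set Lw := (\max_(p <- gram_terms zs) size (word p.2))%N in est.
set c0 := (#|{: 'I_r * bool}| ^ 2 * _)%N in est.
have [Z Z0 hZ] := exp_poly_le 13.
pose e := (deg * Lw)%N; pose c := (r * e).+2.
pose A := (4 + 2 * (e.+1 ^ 3 * deg.+1 ^ 2 * c0) + 4 * (8 * c ^ 3) ^ 4)%N.
(* The first entry makes $n$ exceed the threshold on the degree, the second meets the condition of
   [tail_decay] on $k$. *)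
pose k0 := maxn (8 * c ^ 3 * Z) (Num.truncn (A%:R * Z%:R / delta)).+1.
exists (4 ^ k0)%N => n n0; have np : (0 < n)%N by apply: leq_trans n0; rewrite expn_gt0.
pose k := trunc_log 4 n.
have /andP[n1 n2] : (4 ^ k <= n < 4 ^ k.+1)%N by apply: trunc_log_bounds.
have kk : (k0 <= k)%N by apply: trunc_log_max.
have QE : (k * deg * Lw)%N = (k * e)%N by rewrite mulnA.
have := est k n; rewrite QE /= => est'.
have y1 : (8 * c ^ 3 * Z <= k.+1)%N by apply: leq_trans (leqW kk); exact: leq_maxl.
have N0n : (8 * (r * (k * e)).+2 ^ 3 <= n)%N.
  apply: leq_trans n1; apply: (@leq_trans (2 ^ k)); last by rewrite -[4%N]/(2 * 2)%N expnMn leq_pmulr // expn_gt0.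
  have w : ((r * (k * e)).+2 <= c * k.+1)%N by exact: mul_succ2_le.
  apply: (@leq_trans (8 * (c * k.+1) ^ 3)); first by rewrite leq_mul2l /= leq_exp2r.
  rewrite -(leq_pmul2r (ltn0Sn k)) expnMn mulnA -mulnA -expnSr.
  apply: (@leq_trans (8 * c ^ 3 * (Z * 2 ^ k))).
    by rewrite leq_mul2l; apply/orP; right; apply: leq_trans (hZ k); rewrite leq_pexp2l.
  by rewrite mulnA mulnC leq_mul2l y1 orbT.
rewrite mulrC; apply: le_trans (est' N0n np) _; rewrite ler_wpM2l //.
apply: (@tail_decay deg e c0 Z) => //; first by rewrite n1.
have := truncnS_gt (A%:R * Z%:R / delta) => /ltW/le_trans; apply.
by rewrite ler_nat; apply: leq_trans (leqW kk); exact: leq_maxr.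
Qed.

(** If the norm is at most $t$, every point is fixed by some word of $W$, so the unsigned traces
    over $W$ sum to at least $n$. Their mean is bounded in $n$, and Markov's inequality gives a
    proportion of order $1/n$. *)
Lemma lower_tail (t : R) (f : free_group r -> C) (s : seq (free_group r)) :
  l2le f 1 -> uniq s -> 0 <= t ->
  t ^+ 2 < \sum_(h <- s) normc (\sum_(p <- zs) p.1 * f (p.2^-1 * h)%g) ^+ 2 ->
  forall delta, 0 < delta -> exists n0, forall n, (n0 <= n)%N ->
  ((#|[set x : Omega r n | norm_le zs t x]%SET|)%:R : R) <= delta * (#|{:Omega r n}|)%:R.
Proof.
move=> hf us t0 lt delta d0; have [W [W1 hW] ] := lower_transplant hf us t0 lt.
pose CW : R := \sum_(w <- W) (size (rgs (size (word w)).+1 0) * 2 ^ size (word w))%:R.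
pose m := (\max_(w <- W) size (word w))%N.
exists (maxn (2 * m) (Num.truncn (CW / delta)).+1) => n hn.
have n1 : (2 * m <= n)%N by apply: leq_trans hn; exact: leq_maxl.
have n2 : CW / delta <= n%:R.
  apply: le_trans (ltW (truncnS_gt _)) _; rewrite ler_nat; apply: leq_trans hn; exact: leq_maxr.
have np : (0 < n)%N by apply: leq_trans hn; rewrite leq_max orbT.
have nR : 0 < n%:R :> R by rewrite ltr0n.
have O0 : 0 < (#|{:Omega r n}|)%:R :> R by rewrite ltr0n card_Omega_gt0.
have cnt : ((#|[set x : Omega r n | norm_le zs t x]%SET|)%:R : R) * n%:R <=
    \sum_(x : Omega r n) \sum_(w <- W) \tr (wmx R false x (word w)).
  rewrite -sum1_card natr_sum mulr_suml big_mkcond /=; apply: ler_sum => x _.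
  have tr0 w : 0 <= \tr (wmx R false x (word w)).
    by apply: sumr_ge0 => i _; exact: wmx_unsigned_ge0.
  case: ifP => [|_]; last by apply: sumr_ge0 => w _; exact: tr0.
  rewrite inE => /asboolP bad; rewrite mul1r.
  have fixP i : exists2 w, w \in W & wmx R false x (word w) i i = 1.
    apply/not_exists2P => H; apply: (hW n (fun i => to_signed_perm R (x i)) i) bad => w wW.
    by apply/eqP/negPn/negP => /rep_diag0 h; case: (H w) => [/(_ wW)|/(_ h)].
  rewrite /mxtrace exchange_big /= -[n in leLHS](card_ord n) -sum1_card natr_sum.
  apply: ler_sum => i _; have [w wW e] := fixP i.
  by rewrite (big_rem w) //= e lerDl; apply: sumr_ge0 => v _; exact: wmx_unsigned_ge0.
rewrite -(ler_pM2r nR); apply: (le_trans cnt); rewrite exchange_big /=.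
have -> : \sum_(w <- W) \sum_(x : Omega r n) \tr (wmx R false x (word w)) =
    (\sum_(w <- W) mean_trace R false n (word w)) * (#|{:Omega r n}|)%:R.
  by rewrite mulr_suml; apply: eq_bigr => w _; rewrite divfK ?gt_eqF.
rewrite [leRHS]mulrAC ler_wpM2r ?(ltW O0) //; apply: (@le_trans _ _ CW); last first.
  by rewrite mulrC -ler_pdivrMr.
rewrite big_seq /CW [leRHS]big_seq; apply: ler_sum => w wW.
apply: mean_trace_unsigned_le => //; first exact: word_reduced.
  by rewrite lt0n size_eq0; apply: contra W1 => /eqP w1; rewrite (_ : 1%g = w) //; apply: val_inj.
apply: leq_trans n1; rewrite leq_mul2l /=.
by apply: (leq_bigmax_seq (F := fun w : free_group r => size (word w))).
Qed.
End Tails.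

(** * Convergence in probability *)

Section Measure.
Variables (R : realType) (d : measure_display) (T : measurableType d) (P : probability T R).

Lemma measure_bigsetU_le (I : Type) (s : seq I) (Q : pred I) (F : I -> set T) :
  (forall i, measurable (F i)) ->
  (P (\big[setU/set0]_(i <- s | Q i) F i) <= \sum_(i <- s | Q i) P (F i))%E.
Proof.
move=> mF; elim: s => [|i s IH]; first by rewrite !big_nil measure0.
rewrite !big_cons; case: ifP => // _.
apply: (le_trans (measureU2 P (mF i) _)); first by apply: bigsetU_measurable.
by rewrite leeD2l.
Qed.

Variables (r n : nat) (X : 'I_r -> {RV P >-> signed_perm R n}).
Hypothesis X_uniform : forall i, uniform_signed_perm (X i).
Hypothesis X_indep : mutually_independent X.

Lemma prob_point (y : 'I_r -> signed_perm R n) :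
  P (\bigcap_(i in [set` [set: 'I_r]%SET]) (X i @^-1` [set y i])) = ((#|{:Omega r n}|)%:R^-1)%:E.
Proof.
rewrite (@X_indep _ (fun i => [set y i])) //.
rewrite (eq_bigr (fun=> ((#|{: signed_perm R n}|%:R^-1)%:E))) => [|i _]; last exact: X_uniform.
rewrite prodEFin prodr_const cardsT card_ord card_ffun card_ord natrX exprVn.
by rewrite (bij_eq_card (@to_signed_perm_bij R n)).
Qed.

(** The event is a finite union of events prescribing all $r$ matrices, each of mass $1/|\Omega|$ by
    uniformity and independence. *)
Lemma prob_le_count (B : set ('I_r -> signed_perm R n)) (e : R) :
  (#|[set x : Omega r n | `[< B (fun i => to_signed_perm R (x i)) >] ]%SET|)%:R <=
     e * (#|{:Omega r n}|)%:R ->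
  (P [set w | B (fun i => X i w)] <= e%:E)%E.
Proof.
move=> hB; pose Q (x : Omega r n) := `[< B (fun i => to_signed_perm R (x i)) >].
pose F (x : Omega r n) := \bigcap_(i in [set` [set: 'I_r]%SET]) (X i @^-1` [set to_signed_perm R (x i)]).
have mF x : measurable (F x).
  apply: fin_bigcap_measurable => [|i _]; first exact: finite_finset.
  by rewrite -[X in measurable X]setTI; exact: measurable_funPT.
have -> : [set w | B (fun i => X i w)] = \big[setU/set0]_(x | Q x) F x.
  rewrite -bigcup_pred; apply/seteqP; split => w /=.
    move=> Bw; have [g gK Kg] := @to_signed_perm_bij R n.
    have E : (fun i => to_signed_perm R ([ffun i => g (X i w)] i)) = (fun i => X i w).
      by apply/funext => i; rewrite ffunE Kg.
    by exists [ffun i => g (X i w)] => /= [|i _]; [apply/asboolP; rewrite E | rewrite ffunE Kg].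
  move=> [x /asboolP Bx] Fx; suff -> : (fun i => X i w) = (fun i => to_signed_perm R (x i)) by [].
  by apply/funext => i; apply: Fx => /=; rewrite inE.
apply: le_trans (measure_bigsetU_le _ _ mF) _.
rewrite (eq_bigr (fun=> ((#|{:Omega r n}|)%:R^-1)%:E)) => [|x _]; last exact: prob_point.
rewrite sumEFin lee_fin sumr_const -[leLHS]mulr_natl ler_pdivrMr ?ltr0n ?card_Omega_gt0 //.
apply: le_trans hB; rewrite ler_nat; apply: subset_leq_card; apply/fintype.subsetP => x.
by rewrite inE.
Qed.
End Measure.

Lemma cvg0_ereal (R : realType) (u : nat -> \bar R) : (forall n, (0 <= u n)%E) ->
  (forall e : R, 0 < e -> exists n0, forall n, (n0 <= n)%N -> (u n <= e%:E)%E) ->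
  u @ \oo --> 0%E.
Proof.
move=> u0 h; apply/fine_cvgP; split.
  have [n0 h0] := h 1 ltr01; exists n0 => // n /= /h0 un.
  by rewrite ge0_fin_numE //; apply: le_lt_trans un (ltry _).
apply/cvgr0Pnorm_le => e e0; have [n0 h0] := h e e0; exists n0 => // n /= /h0 un.
rewrite ger0_norm ?fine_ge0 // -lee_fin fineK // ge0_fin_numE //.
exact: le_lt_trans un (ltry _).
Qed.

Theorem theorem3p1 (R : realType) (r : nat) (r_ge2 : (2 <= r)%N)
    (d : nat -> measure_display) (T : forall n, measurableType (d n))
    (P : forall n, probability (T n) R)
    (Rmx : forall n, 'I_r -> {RV (P n) >-> signed_perm R n})
    (Rmx_uniform : forall n i, uniform_signed_perm (Rmx n i))
    (Rmx_indep : forall n, mutually_independent (Rmx n))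
    (z : {fsfun free_group r -> R[i] with 0}) :
  cvg_in_probability P
    (fun n w => opnorm (mx_op (linear_extension
       (fun g => signed_perm_val (free_lift (fun i => Rmx n i w) g)) z)))
    (opnorm (linear_extension (@regular_rep R (free_group r)) z)).
Proof.
have l0 : letter r := (Ordinal (ltnW r_ge2), false).
have [L [L0 -> step low] ] := regular_opnorm z.
move=> eps eps0; apply: cvg0_ereal => // delta delta0.
(* The deviation event is a non-strict inequality; a norm at most $L + \varepsilon/2$ stays strictly
   below $L + \varepsilon$. *)
have Lt : L < L + eps / 2 by lra.
have d2 : 0 < delta / 2 by lra.
have [n1 up] := upper_tail l0 L0 Lt step d2.
(* A norm cannot be at most $L - \varepsilon$ when that number is negative; the Boolean guard makes
   the set empty in this case. *)
have [n2 dn] : exists n0, forall n, (n0 <= n)%N ->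
    ((#|[set x : Omega r n |
       (0 <= L - eps) && norm_le (fsfun_terms z) (L - eps) x]%SET|)%:R : R) <=
    delta / 2 * (#|{:Omega r n }|)%:R.
  have [Le|_] := leP 0 (L - eps); last first.
    exists 0%N => n _; rewrite [X in X%:R]eq_card0; last by move=> x; rewrite !inE.
    by rewrite mulr_ge0 // ltW.
  have [|f [s [f1 us hs] ] ] := low _ Le; first by lra.
  exact: (lower_tail l0 f1 us Le hs d2).
exists (maxn n1 n2) => n; rewrite geq_max => /andP[/up {}up /dn {}dn].
pose B (b : 'I_r -> signed_perm R n) :=
  (eps%:E <= `|opnorm (mx_op (rep_sum b (fsfun_terms z))) - L%:E|)%E.
have := @prob_le_count R _ _ (P n) r n (Rmx n) (Rmx_uniform n) (Rmx_indep n) B delta.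
rewrite /B; under eq_set do rewrite -linear_extension_rep.
apply; rewrite [delta]splitr mulrDl; apply: le_trans (lerD up dn).
rewrite -natrD ler_nat; apply: leq_trans (leq_card_setU _ _).
apply/subset_leq_card/fintype.subsetP => x; rewrite !inE => /asboolP Bx.
apply/orP; have [nx|nx] := boolP (norm_le (fsfun_terms z) (L + eps / 2) x); last by left.
right; move: nx Bx => /asboolP; rewrite /norm_le.
set o := opnorm _; have o0 : (0 <= o)%E by exact: opnorm_ge0.
case: o o0 => [a| |] //; rewrite !lee_fin => a0 a1.
have [La|La] := leP L a.
  by rewrite ger0_norm ?subr_ge0 // => /asboolP h; exfalso; lra.
rewrite ltr0_norm ?subr_lt0 // => /asboolP h; apply/andP; split; first by lra.
by apply/asboolP; lra.
Qed.
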